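(* Let $\rho:[0,1]^2\to[0,\infty)$ be a twice continuously differentiable function which is symmetric, $\rho(x,y)=\rho(y,x)$, and satisfies $\int_0^1\rho(x,y)\,dy=1$ for every $x\in[0,1]$ and $\int_0^1\rho(x,y)\,dx=1$ for every $y\in[0,1]$. Let $T$ be the integral operator on $L^2([0,1])$ with kernel $\rho$, let $H=\{f\in L^2([0,1]):\int_0^1 f(x)\,dx=0\}$, and assume the spectral gap condition $\lambda_*:=\|T|_H\|_{L^2\to L^2}<1$. For $n\ge 1$ let $$D_n=\frac{1}{n!}\sum_{\sigma\in\mathfrak{S}_n}\prod_{i=1}^n\rho\left(\frac{i}{n},\frac{\sigma(i)}{n}\right).$$ Then $$\lim_{n\to\infty}D_n=\det\nolimits_F\bigl(I-(T|_H)^2\bigr)^{-1/2}.$$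
   Context: $\mathfrak{S}_n$ is the set of all permutations of $\{1,\dots,n\}$. The operator $T$ is given by $(Tf)(x)=\int_0^1\rho(x,y)f(y)\,dy$; it is a self-adjoint Hilbert-Schmidt operator on $L^2([0,1])$, and $H$ is $T$-invariant because $T\mathbf 1=\mathbf 1$ for the constant function $\mathbf 1$. Thus $(T|_H)^2$ is trace class, and $\det_F$ denotes the Fredholm determinant: $\det_F(I-(T|_H)^2)=\prod_{i\ge 1}(1-\lambda_i^2)$, where $(\lambda_i)_{i\ge1}$ are the eigenvalues of $T|_H$ counted with multiplicity. Equivalently, $D_n=\frac1{n!}\operatorname{per}\bigl(\rho(i/n,j/n)\bigr)_{1\le i,j\le n}$, where $\operatorname{per}$ is the permanent. *)

(* Defs.v *)
From mathcomp Require Import all_boot all_order all_algebra all_fingroup.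
From mathcomp Require Import all_classical all_reals all_analysis.
Import Order.TTheory GRing.Theory Num.Theory.
Import numFieldNormedType.Exports.

Set Implicit Arguments.
Unset Strict Implicit.
Unset Printing Implicit Defensive.

Local Open Scope classical_set_scope.
Local Open Scope ring_scope.

(* The kernel is a total function on R * R; only its values on the closed unit
   square are ever constrained or used. *)
Definition unit_square (R : realType) : set (R * R) :=
  `[0, 1]%classic `*` `[0, 1]%classic.

Definition open_unit_square (R : realType) : set (R * R) :=
  `]0, 1[%classic `*` `]0, 1[%classic.

(* C^k on the closed square, in the usual sense: the partial derivatives of
   order at most k exist in the open square and they, like f, extend
   continuously to the closed square. The functions fx and fy are determined
   on the closed square by f, and there they are the (at the boundary,
   one-sided) partial derivatives of f. *)
Fixpoint Ck_unit_square (R : realType) (k : nat) (f : R * R -> R) : Prop :=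
  {within @unit_square R, continuous f} /\
  match k with
  | 0 => True
  | k'.+1 => exists fx fy : R * R -> R,
      [/\ Ck_unit_square k' fx,
          Ck_unit_square k' fy &
          forall p, open_unit_square p ->
            is_derive p ((1, 0) : R * R) f (fx p) /\
            is_derive p ((0, 1) : R * R) f (fy p)]
  end.

(* L^2([0,1]) consists of the f : R -> R with f \in Lfun (leb01 R) 2%:E, taken
   up to leb01-almost everywhere equality. *)
Definition leb01 (R : realType) : {measure set (measurableTypeR R) -> \bar R} :=
  mrestr (@lebesgue_measure R) (measurable_itv `[(0 : R), 1]).

Section Eigenvalues.
Context d (X : measurableType d) (R : realType).
Variable mu : {measure set X -> \bar R}.
Implicit Types (A : (X -> R) -> (X -> R)) (V E : set (X -> R)).

Definition eigenspace_on A V (m : R) : set (X -> R) :=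
  [set f | V f /\ A f = m \*: f %[ae mu]].

(* The image of E in the space of functions modulo a.e. equality has
   dimension k. *)
Definition has_ae_dim E (k : nat) : Prop :=
  exists b : 'I_k -> X -> R,
    [/\ forall i, E (b i),
        forall c : 'I_k -> R,
          (fun x => \sum_(i < k) c i * b i x) = cst 0 %[ae mu] ->
          forall i, c i = 0 &
        forall f, E f -> exists c : 'I_k -> R,
          f = (fun x => \sum_(i < k) c i * b i x) %[ae mu]].

(* lam lists the nonzero eigenvalues of A restricted to V, each one as often as
   its multiplicity (for m != 0 not an eigenvalue, k is 0). The value 0 may
   occur any number of times: an operator of finite rank needs padding, and 0
   contributes a factor 1 to the determinant. *)
Definition eigenvalue_seq A V (lam : nat -> R) : Prop :=
  forall m : R, m != 0 ->
    exists k, has_ae_dim (eigenspace_on A V m) k /\ ([set i | lam i = m] #= `I_k)%card.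

(* det_F (I - (A|_V)^2) = \prod_i (1 - lam_i ^ 2) over the eigenvalues of A|_V,
   for A|_V self-adjoint and Hilbert-Schmidt. By the spectral theorem
   an enumeration then exists; the product converges absolutely, so that it does
   not depend on the enumeration chosen. *)
Definition fredholm_det_1_sub_sqr A V : R :=
  let lam := xget (cst 0) [set lam | eigenvalue_seq A V lam] in
  lim ((\prod_(i < n) (1 - lam i ^+ 2)) @[n --> \oo]).

Definition opnorm2_on A V : \bar R :=
  ereal_sup [set 'N[mu]_2%:E[EFin \o A f]%E |
             f in [set f | V f /\ ('N[mu]_2%:E[EFin \o f] <= 1)%E]].

End Eigenvalues.

(* Set to 0 outside [0,1], where rho is unconstrained, to keep T f measurable. *)
Definition kernel_op (R : realType) (rho : R * R -> R) (f : R -> R) : R -> R :=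
  (fun x => \int[@lebesgue_measure R]_(y in `[0, 1]) (rho (x, y) * f y))
    \_ `[0, 1]%classic.

Definition L2_mean0 (R : realType) : set (R -> R) :=
  [set f | (f : measurableTypeR R -> R) \in Lfun (leb01 R) 2%:E /\
           \int[@lebesgue_measure R]_(x in `[0, 1]) f x = 0].

(* The ordinal i stands for the index i + 1 of {1, ..., n}. *)
Definition perm_average (R : realType) (rho : R * R -> R) (n : nat) : R :=
  (n`!%:R)^-1 * \sum_(s : 'S_n) \prod_(i < n)
    rho (i.+1%:R / n%:R, (s i).+1%:R / n%:R).

(* Main.v *)
(* On the grid x_i = i/n write rho(x_i,x_j) = u_i u_j + n K_ij, where u_i is 1 + O(1/n)
   and the symmetric matrix K annihilates constants. Diagonalising K, with eigenvalues k_a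
   and eigenvectors v_a, and expanding the permanent gives
     D_n = (prod_i u_i^2) sum_m C(n,m) sum_(t in [n]^m) k_(t_1) ... k_(t_m) G(t)^2,
   where G(t) is the average over permutations s of prod_l psi_(t_l)(s(l)) and
   psi_a = sqrt n v_a / u. Fix an ultrafilter refining n -> oo. Along it the k_a tend to the
   eigenvalues of T on H (Lipschitz eigenfunctions are obtained as limits of the v_a, and
   they exhaust the eigenspaces), and n^(m/2) G(t) tends to prod_a He_(m_a)(0), where m_a is the
   number of occurrences of a in t: the elementary symmetric functions of normalised
   variables tend to Hermite polynomials of their normalised sum, and here sum psi_a is
   bounded. A bound on G(t)^2 as a Fourier coefficient of a generating function, together
   with a bound on the tail sums of |k_a|, allows one to pass to the limit in the series,
   which yields
     prod_a sum_m k_a^m He_m(0)^2 / m! = prod_a (1 - k_a^2)^(-1/2).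
   All ultrafilters give the same limit, so D_n converges. *)
Require Import Defs.
From HB Require Import structures.
From mathcomp Require Import all_boot all_order all_algebra all_fingroup.
From mathcomp Require Import separable cyclotomic cyclic complex.
From mathcomp Require Import all_classical all_reals all_analysis.
From mathcomp Require Import measurable_realfun ring lra zify.
Import Order.TTheory GRing.Theory Num.Theory.
Import numFieldNormedType.Exports.
Set Implicit Arguments.
Unset Strict Implicit.
Unset Printing Implicit Defensive.
Local Open Scope ring_scope.

(** * Words and the multiplicities of their letters *)

(** The matrix K need not be positive, so its trace norm is not its trace, and boundedness of [rho]
    only makes K Hilbert-Schmidt. Summability of |k_a|, uniformly in n, comes from the Lipschitz
    bound instead, by comparing K with its averages over blocks. Second derivatives matter for the
    weights: u_i - 1 has order 1/n, so prod_i u_i could tend to a limit other than 1; the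
    first-order terms cancel on average because the slices rho(0, .) and rho(1, .) have the same
    integral. The bound on G(t)^2 has to be exponentially sharp. A letter of multiplicity m costs
    only the factor m! e^m / m^m, of order sqrt m, so the majorant converges on the whole range
    |k_a| < 1 that the spectral gap allows; termwise limits alone say nothing about words whose
    length grows with n. Eigenvectors are chosen separately for every n, with arbitrary signs and
    arbitrary bases of the eigenspaces, so they need not converge in n. An ultrafilter makes all
    bounded quantities converge at once, and its choice does not affect the limit because the
    multiplicities of the eigenvalues of T are intrinsic. *)

Definition mult (I : finType) k (t : {ffun 'I_k -> I}) (a : I) : nat :=
  \sum_(l < k) (t l == a)%N.

Definition ffcons (I : finType) k (p : I * {ffun 'I_k -> I}) : {ffun 'I_k.+1 -> I} :=
  [ffun l => if unlift ord0 l is Some j then p.2 j else p.1].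

Lemma ffcons_bij (I : finType) k : bijective (@ffcons I k).
Proof.
exists (fun t : {ffun 'I_k.+1 -> I} =>
  (t ord0, [ffun j : 'I_k => t (lift ord0 j)] : {ffun 'I_k -> I})).
  move=> [a t]; congr pair; first by rewrite ffunE unlift_none.
  by apply/ffunP => j; rewrite !ffunE liftK.
move=> t; apply/ffunP => l; rewrite ffunE /=.
by case: unliftP => [j|] ->; rewrite ?ffunE.
Qed.

Lemma mult_ffcons (I : finType) k a (t : {ffun 'I_k -> I}) b :
  mult (ffcons (a, t)) b = ((a == b) + mult t b)%N.
Proof.
rewrite /mult big_ord_recl ffunE unlift_none; congr (_ + _)%N.
by apply: eq_bigr => j _; rewrite ffunE liftK.
Qed.

Lemma sum_mult (I : finType) k (t : {ffun 'I_k -> I}) : (\sum_a mult t a)%N = k.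
Proof.
rewrite /mult exchange_big /= -[RHS]card_ord -sum1_card; apply: eq_bigr => l _.
by rewrite (bigD1 (t l)) //= eqxx big1 ?addn0 // => a /negPf; rewrite eq_sym => ->.
Qed.

Lemma mult_le (I : finType) k (t : {ffun 'I_k -> I}) a : (mult t a <= k)%N.
Proof. by rewrite -[leqRHS](sum_mult t) (bigD1 a) //= leq_addr. Qed.

Lemma mult_gt0 (I : finType) k (t : {ffun 'I_k -> I}) l : (0 < mult t (t l))%N.
Proof. by rewrite /mult (bigD1 l) //= eqxx. Qed.

Lemma prod_mult (R : comNzRingType) (I : finType) k (t : {ffun 'I_k -> I})
    (x : I -> R) : \prod_l x (t l) = \prod_a x a ^+ mult t a.
Proof.
rewrite /mult; under [RHS]eq_bigr => a _ do rewrite expr_sum.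
rewrite exchange_big /=; apply: eq_bigr => l _.
rewrite (bigD1 (t l)) //= eqxx expr1 big1 ?mulr1 // => a /negPf.
by rewrite eq_sym => ->; rewrite expr0.
Qed.

Lemma deriv_prod_fin (R : comNzRingType) (I : finType) (H : I -> {poly R}) :
  (\prod_b H b)^`() = \sum_a \prod_b (if a == b then (H b)^`() else H b).
Proof.
have gen : forall s : seq I, uniq s ->
  (\prod_(b <- s) H b)^`() =
    \sum_(a <- s) \prod_(b <- s) (if a == b then (H b)^`() else H b).
  elim=> [|c s IH]; first by rewrite !big_nil derivC.
  move=> /= /andP[cs us]; rewrite !big_cons derivM IH // eqxx; congr (_ + _).
    congr (_ * _); apply: eq_big_seq => b bs.
    by case: eqP => // cb; rewrite cb bs in cs.
  rewrite mulr_sumr; apply: eq_big_seq => a a_s; rewrite big_cons.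
  by case: eqP => // ac; rewrite -ac a_s in cs.
rewrite -(big_enum _ _ _ _) gen ?enum_uniq // big_enum /=; apply: eq_bigr => a _.
by rewrite big_enum.
Qed.

(* Leibniz' rule for the k-th derivative of a product, at 0. *)
Lemma sum_mult_coef (R : comNzRingType) (I : finType) k (H : I -> {poly R}) :
  \sum_(t : {ffun 'I_k -> I}) \prod_a ((H a)`_(mult t a) *+ (mult t a)`!) =
  (\prod_a H a)`_k *+ k`!.
Proof.
elim: k H => [|k IH] H.
  rewrite coef0_prod fact0 mulr1n.
  transitivity (\sum_(t in [set: {ffun 'I_0 -> I}]) \prod_a (H a)`_0).
    apply: eq_big => t; first by rewrite inE.
    by move=> _; apply: eq_bigr => a _; rewrite /mult big_ord0.
  by rewrite sumr_const cardsT card_ffun card_ord expn0.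
rewrite (reindex (@ffcons I k)) /=; last exact/onW_bij/ffcons_bij.
rewrite -(pair_bigA _ (fun a t => \prod_b ((H b)`_(mult (ffcons (a, t)) b) *+
  (mult (ffcons (a, t)) b)`!))) /=.
rewrite factS mulrnA -coef_deriv deriv_prod_fin coef_sum -sumrMnl.
apply: eq_bigr => a _; rewrite -IH; apply: eq_bigr => t _; apply: eq_bigr => b _.
by rewrite mult_ffcons; case: eqP => _ //; rewrite coef_deriv -mulrnA -factS.
Qed.

(** Leibniz' rule for the monomials ['X^(mult t0 a)]: words with other multiplicities contribute 0,
    and the product of the monomials is ['X^k]. The cardinal is thus a multinomial coefficient. *)
Lemma card_same_mult (I : finType) k (t0 : {ffun 'I_k -> I}) :
  (#|[set t : {ffun 'I_k -> I} | [forall a, mult t a == mult t0 a]]| *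
     \prod_a (mult t0 a)`! = k`!)%N.
Proof.
have := @sum_mult_coef int I k (fun a => 'X^(mult t0 a)).
rewrite prodrXr sum_mult coefXn eqxx -sum1dep_card => E.
apply/eqP; rewrite -(eqr_nat int) -E natrM natr_sum mulr_suml [X in X == _]big_mkcond /=; apply/eqP.
apply: eq_bigr => t _; case: forallP => [h|/forallP].
  rewrite mul1r natr_prod; apply: eq_bigr => a _.
  by rewrite coefXn (eqP (h a)) eqxx.
rewrite negb_forall => /existsP[a ha]; rewrite (bigD1 a) //= coefXn (negPf ha).
by rewrite mul0rn mul0r.
Qed.

Lemma same_mult_perm (I : finType) k (t t0 : {ffun 'I_k -> I}) :
  (forall a, mult t a = mult t0 a) -> exists s : 'S_k, forall l, t l = t0 (s l).
Proof.
move=> h.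
have cE (u : {ffun 'I_k -> I}) a : count_mem a [tuple u l | l < k] = mult u a.
  rewrite /mult -sum1_count big_mkcond big_tuple; apply: eq_bigr => l _.
  by rewrite tnth_mktuple /=; case: eqP.
have /tuple_permP[s es] : perm_eq [tuple t l | l < k] [tuple t0 l | l < k].
  by apply/allP => a _ /=; rewrite !cE h.
exists s => l.
have -> : t l = tnth [tuple t l | l < k] l by rewrite tnth_mktuple.
rewrite (tnth_nth (t l)) es -[X in nth _ X _]/(val [tuple _ | _ < _]) -tnth_nth.
by rewrite !tnth_mktuple.
Qed.

(** * Averages over permutations *)

(** Sets of positions are words over [bool]; [S] and the set of the first [#|S|] positions are words
    with the same multiplicities. *)
Lemma exists_perm_lt n (S : {set 'I_n}) :
  exists s : 'S_n, forall i : 'I_n, (s i \in S) = (i < #|S|)%N.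
Proof.
pose c : {ffun 'I_n -> bool} := [ffun i => i \in S].
pose c0 : {ffun 'I_n -> bool} := [ffun i : 'I_n => (i < #|S|)%N].
have cS : (#|S| <= n)%N by rewrite -[leqRHS]card_ord max_card.
have multT (u : {ffun 'I_n -> bool}) : mult u true = #|[set i | u i]|.
  rewrite /mult -sum1dep_card [RHS]big_mkcond; apply: eq_bigr => i _.
  by case: (u i).
have multF (u : {ffun 'I_n -> bool}) : (mult u true + mult u false = n)%N.
  by rewrite -[RHS](sum_mult u) big_bool.
have cT : mult c true = mult c0 true.
  rewrite !multT; transitivity #|S|; first by apply: eq_card => i; rewrite inE ffunE.
  rewrite -sum1dep_card (eq_bigl (fun i : 'I_n => (i < #|S|)%N)); last first.
    by move=> i; rewrite ffunE.
  by rewrite (big_ord_narrow cS) sum1_card card_ord.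
have [|s hs] := @same_mult_perm _ _ c0 c.
  by case => //; apply/eqP; rewrite -(eqn_add2l (mult c0 true)) multF -cT multF.
by exists s => i; have := hs i; rewrite !ffunE => ->.
Qed.

(** Expand over the set [S] of the factors that contribute [c]. Renumbering the positions of [p] and
    [q] simultaneously moves [S] to the first [#|S|] positions, so only its cardinal matters. *)
Lemma sum_perm2_prod1D (R : comNzRingType) n (x : R) (c : 'I_n -> 'I_n -> R) :
  \sum_(p : 'S_n) \sum_(q : 'S_n) \prod_i (x + c (p i) (q i)) =
  \sum_(k < n.+1) ('C(n, k)%:R * x ^+ (n - k) *
    \sum_(p : 'S_n) \sum_(q : 'S_n) \prod_(i < n | (i < k)%N) c (p i) (q i)).
Proof.
pose T (S : {set 'I_n}) := \sum_(p : 'S_n) \sum_(q : 'S_n) \prod_(i in S) c (p i) (q i).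
have TE S : T S = \sum_(p : 'S_n) \sum_(q : 'S_n)
    \prod_(i < n | (i < #|S|)%N) c (p i) (q i).
  have [s hs] := exists_perm_lt S.
  rewrite [RHS](reindex_inj (mulgI s)); apply: eq_bigr => p _.
  rewrite [RHS](reindex_inj (mulgI s)); apply: eq_bigr => q _.
  rewrite (reindex_inj (@perm_inj _ s)); apply: eq_big => i; first exact: hs.
  by rewrite !permM.
transitivity (\sum_(S : {set 'I_n}) x ^+ (n - #|S|) * T S).
  under eq_bigr => p _ do under eq_bigr => q _ do rewrite (eq_bigr _ (fun i _ => addrC _ _)) bigA_distr.
  under eq_bigr => p _ do rewrite exchange_big /=.
  rewrite exchange_big /=; apply: eq_bigr => S _.
  rewrite /T mulr_sumr; apply: eq_bigr => p _; rewrite mulr_sumr; apply: eq_bigr => q _.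
  rewrite (bigID (mem S)) /= mulrC; congr (_ * _).
    rewrite (eq_bigr (fun=> x)) => [|i /negPf -> //].
    rewrite prodr_const -[X in (X - _)%N](card_ord n) -(cardC (mem S)) addKn.
    by congr (_ ^+ _); apply: eq_card.
  by apply: eq_bigr => i ->.
pose g (S : {set 'I_n}) : 'I_n.+1 := inord #|S|.
have gE S : g S = #|S| :> nat.
  by rewrite inordK // ltnS -[leqRHS]card_ord max_card.
have gEk S (k : 'I_n.+1) : (g S == k) = (#|S| == k :> nat).
  by rewrite -(inj_eq val_inj) /= gE.
rewrite (partition_big g predT) //=; apply: eq_bigr => k _.
transitivity (\sum_(S in [set S : {set 'I_n} | #|S| == k]) (x ^+ (n - k) *
    \sum_(p : 'S_n) \sum_(q : 'S_n) \prod_(i < n | (i < k)%N) c (p i) (q i))).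
  apply: eq_big => S; first by rewrite inE gEk.
  by rewrite gEk => /eqP Sk; rewrite TE Sk.
by rewrite sumr_const card_draws card_ord -mulrA mulr_natl.
Qed.

(** Positions are natural numbers and the length is a filter, so that induction on [k] and merging
    of positions need no casts between ordinals. *)
Definition pavg (R : fieldType) n k (p : nat -> 'I_n -> R) : R :=
  (n`!%:R)^-1 * \sum_(s : 'S_n) \prod_(i < n | (i < k)%N) p i (s i).

(* Each sum over all of 'I_n is a sum over the values of a permutation; the
   positions outside the first k contribute equally, by symmetry. *)
Lemma pavg_rec (R : numFieldType) n k (p : nat -> 'I_n -> R) : (k < n)%N ->
  (n - k)%:R * pavg k.+1 p =
  (\sum_j p k j) * pavg k p -
  \sum_(m < k) pavg k (fun l j => if l == m then p l j * p k j else p l j).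
Proof.
move=> kn; pose ok := Ordinal kn.
pose W (m : 'I_n) := \sum_(s : 'S_n) (\prod_(i < n | (i < k)%N) p i (s i)) * p k (s m).
have W0 : \sum_m W m = (\sum_j p k j) * \sum_(s : 'S_n) \prod_(i < n | (i < k)%N) p i (s i).
  rewrite /W exchange_big mulr_sumr; apply: eq_bigr => s _.
  by rewrite -mulr_sumr [in RHS](reindex_inj (@perm_inj _ s)) mulrC.
have W1 (m : 'I_n) : (k <= m)%N ->
    W m = \sum_(s : 'S_n) \prod_(i < n | (i < k.+1)%N) p i (s i).
  move=> km; rewrite /W (reindex_inj (mulgI (tperm ok m))); apply: eq_bigr => s _.
  rewrite permM tpermR [RHS](bigD1 ok) //= mulrC; congr (_ * _).
  apply: eq_big => i.
    by rewrite ltnS -(inj_eq val_inj) /=; lia.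
  move=> ik; rewrite permM tpermD //; apply/eqP => e; move: ik; rewrite -e //=.
    by rewrite ltnn.
  by rewrite ltnNge km.
have W2 (m : 'I_n) : (m < k)%N -> W m = \sum_(s : 'S_n) \prod_(i < n | (i < k)%N)
    (if i == m :> nat then p i (s i) * p k (s i) else p i (s i)).
  move=> mk; apply: eq_bigr => s _.
  rewrite (bigD1 m) //= [RHS](bigD1 m) //= eqxx -!mulrA; congr (_ * _).
  rewrite mulrC; congr (_ * _); apply: eq_bigr => i /andP[_].
  by rewrite -(inj_eq val_inj) => /negPf ->.
have : \sum_(m < n | (k <= m)%N) W m = \sum_m W m - \sum_(m < n | (m < k)%N) W m.
  rewrite [X in X - _](bigID (fun m : 'I_n => (m < k)%N)) /= addrAC subrr add0r.
  by apply: eq_bigl => m; rewrite -leqNgt.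
rewrite (eq_bigr _ W1) sumr_const (eq_bigr _ W2) W0.
have -> : #|[pred m : 'I_n | (k <= m)%N]| = (n - k)%N.
  rewrite -[X in (X - _)%N](card_ord n) -(cardC [pred m : 'I_n | (k <= m)%N]).
  rewrite [X in (_ + X - _)%N](_ : _ = k) ?addnK //.
  rewrite -sum1_card (eq_bigl (fun i : 'I_n => (i < k)%N)); last first.
    by move=> i; rewrite !inE -ltnNge.
  by rewrite (big_ord_narrow (ltnW kn)) sum1_card card_ord.
rewrite (big_ord_narrow (ltnW kn)) /= => E.
rewrite /pavg mulrCA mulr_natl E mulrBr mulrCA; congr (_ - _).
by rewrite mulr_sumr; apply: eq_bigr => m _.
Qed.

Lemma prim_root_exists (C : numClosedFieldType) n : (0 < n)%N ->
  exists w : C, n.-primitive_root w.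
Proof.
pose p : {poly C} := 'X^n - 1; have [r Dp] := closed_field_poly_normal p.
move=> n_gt0; rewrite (monicP _) ?monicXnsubC // scale1r in Dp.
have rn1 : all n.-unity_root r.
  by apply/allP => z; rewrite -root_prod_XsubC -Dp.
have sz_r : (n < (size r).+1)%N.
  by rewrite -(size_prod_XsubC r id) -Dp size_XnsubC.
have [|z] := hasP (has_prim_root n_gt0 rn1 _ sz_r); last by exists z.
by rewrite -separable_prod_XsubC -Dp separable_Xn_sub_1 // pnatr_eq0 -lt0n.
Qed.

(* Positions [l >= k] carry the junk value 0; [pavg k] ignores them. *)
Definition tseq (F : fieldType) (I : finType) n (f : I -> 'I_n -> F) k
    (t : {ffun 'I_k -> I}) : nat -> 'I_n -> F :=
  fun l => oapp (fun j => f (t j)) (fun=> 0) (insub l).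

(* Locked, as unification would otherwise unfold it. *)
HB.lock Definition tavg (F : fieldType) (I : finType) n (f : I -> 'I_n -> F) k
  (t : {ffun 'I_k -> I}) : F := pavg k (tseq f t).

Lemma tavgE (F : fieldType) (I : finType) n (f : I -> 'I_n -> F) k
    (t : {ffun 'I_k -> I}) (kn : (k <= n)%N) :
  tavg f t = (n`!%:R)^-1 * \sum_(s : 'S_n) \prod_l f (t l) (s (widen_ord kn l)).
Proof.
rewrite unlock /pavg; congr (_ * _); apply: eq_bigr => s _.
rewrite (big_ord_narrow kn) /=; apply: eq_bigr => l _.
by rewrite /tseq (valK l).
Qed.

Lemma tavg_perm (F : fieldType) (I : finType) n (f : I -> 'I_n -> F) k
    (t t0 : {ffun 'I_k -> I}) (kn : (k <= n)%N) :
  (forall a, mult t a = mult t0 a) -> tavg f t = tavg f t0.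
Proof.
move=> /same_mult_perm[r hr]; rewrite !(tavgE _ _ kn); congr (_ * _).
pose w := @widen_ord k n kn.
have wi : injective w by move=> x y [] /val_inj.
(* [g] extends the inverse of [r] from the first [k] positions to all of them by the identity. *)
have [s hs] : exists s : 'S_n, forall l, s (w (r l)) = w l.
  pose g (i : 'I_n) := if insub (val i) is Some l then w (r^-1%g l) else i.
  have gw l : g (w l) = w (r^-1%g l).
    by rewrite /g (_ : val (w l) = val l) // valK.
  have gi : injective g.
    have wP (i : 'I_n) : (exists l, i = w l) \/ (g i = i /\ (k <= i)%N).
      rewrite /g; case: insubP => [l lk e|]; first by left; exists l; apply: val_inj.
      by rewrite -leqNgt; right.
    move=> i j; case: (wP i) => [[l ->]|[-> ki]]; case: (wP j) => [[l' ->]|[-> kj]] //.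
    - by rewrite !gw => /wi /perm_inj ->.
    - by rewrite gw => e; move: kj; rewrite -e leqNgt /= ltn_ord.
    - by rewrite gw => e; move: ki; rewrite e leqNgt /= ltn_ord.
  by exists (perm gi) => l; rewrite permE gw permK.
rewrite [RHS](reindex_inj (mulgI s)); apply: eq_bigr => p _.
rewrite [RHS](reindex_inj (@perm_inj _ r)); apply: eq_bigr => l _.
by rewrite permM hr hs.
Qed.

(** Two families are expanded at once: [g = f] gives the permanent, and [g = 1] gives the product
    whose coefficients are the averages [tavg f t]. *)
Lemma sum_perm2_expand (F : numFieldType) (I : finType) n (x : F) (c : I -> F)
    (f g : I -> 'I_n -> F) :
  \sum_(p : 'S_n) \sum_(q : 'S_n) \prod_i (x + \sum_a c a * f a (p i) * g a (q i)) =
  (n`!%:R) ^+ 2 * \sum_(k < n.+1) ('C(n, k)%:R * x ^+ (n - k) *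
    \sum_(t : {ffun 'I_k -> I}) (\prod_l c (t l)) * tavg f t * tavg g t).
Proof.
rewrite (@sum_perm2_prod1D _ _ x (fun i j => \sum_a c a * f a i * g a j)).
rewrite mulr_sumr; apply: eq_bigr => k _; rewrite [RHS]mulrCA; congr (_ * _).
have kn : (k <= n)%N by rewrite -ltnS.
have nf : n`!%:R != 0 :> F by rewrite pnatr_eq0 -lt0n fact_gt0.
rewrite mulr_sumr.
under eq_bigr => p _ do under eq_bigr => q _ do
  rewrite (big_ord_narrow kn) bigA_distr_bigA /=.
under eq_bigr => p _ do rewrite exchange_big /=.
rewrite exchange_big /=; apply: eq_bigr => t _.
rewrite !(tavgE _ _ kn) [RHS](_ : _ = (\prod_l c (t l)) *
   ((\sum_(s : 'S_n) \prod_l f (t l) (s (widen_ord kn l))) *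
    (\sum_(s : 'S_n) \prod_l g (t l) (s (widen_ord kn l))))); last first.
  by field.
rewrite mulr_suml mulr_sumr; apply: eq_bigr => p _.
rewrite !mulr_sumr; apply: eq_bigr => q _.
by rewrite -!big_split /=; apply: eq_bigr => l _; rewrite mulrA.
Qed.

Lemma permanent_expand (F : numFieldType) (I : finType) n (c : I -> F)
    (f : I -> 'I_n -> F) :
  (n`!%:R)^-1 * \sum_(s : 'S_n) \prod_i (1 + \sum_a c a * f a i * f a (s i)) =
  \sum_(k < n.+1) ('C(n, k)%:R *
    \sum_(t : {ffun 'I_k -> I}) (\prod_l c (t l)) * tavg f t ^+ 2).
Proof.
have nf : n`!%:R != 0 :> F by rewrite pnatr_eq0 -lt0n fact_gt0.
set D := \sum_(s : 'S_n) _; have := sum_perm2_expand 1 c f f.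
have E (p : 'S_n) :
    \sum_(q : 'S_n) \prod_i (1 + \sum_a c a * f a (p i) * f a (q i)) = D.
  rewrite (reindex_inj (mulgI p)) /=; apply: eq_bigr => q _.
  rewrite [RHS](reindex_inj (@perm_inj _ p)); apply: eq_bigr => i _.
  by rewrite permM.
under eq_bigr => p _ do rewrite E.
rewrite (_ : \sum_(p : 'S_n) D = n`!%:R * D); last first.
  transitivity (\sum_(p in [set: 'S_n]) D); first by apply: eq_bigl => p; rewrite inE.
  by rewrite sumr_const cardsT card_Sn mulr_natl.
rewrite expr2 -mulrA => /(mulfI nf) ->; rewrite mulrA mulVf // mul1r.
apply: eq_bigr => k _; rewrite expr1n mulr1; congr (_ * _).
by apply: eq_bigr => t _; rewrite expr2 mulrA.
Qed.

(** The generating function of the averages. With [g = 1] the double sum consists of equal terms,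
    since every permutation [p] only reorders the product. *)
Lemma prod_expand (F : numFieldType) (I : finType) n (x : F) (c : I -> F)
    (f : I -> 'I_n -> F) :
  \prod_j (x + \sum_a c a * f a j) =
  \sum_(k < n.+1) ('C(n, k)%:R * x ^+ (n - k) *
    \sum_(t : {ffun 'I_k -> I}) (\prod_l c (t l)) * tavg f t).
Proof.
have nf : n`!%:R != 0 :> F by rewrite pnatr_eq0 -lt0n fact_gt0.
have cst (y : F) : \sum_(p : 'S_n) y = n`!%:R * y.
  transitivity (\sum_(p in [set: 'S_n]) y); first by apply: eq_bigl => p; rewrite inE.
  by rewrite sumr_const cardsT card_Sn mulr_natl.
set D := \prod_j _; have := sum_perm2_expand x c f (fun _ _ => 1) => /=.
have E (p : 'S_n) : \prod_i (x + \sum_a c a * f a (p i) * 1) = D.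
  rewrite [RHS](reindex_inj (@perm_inj _ p)); apply: eq_bigr => i _.
  by congr (_ + _); apply: eq_bigr => a _; rewrite mulr1.
rewrite (eq_bigr (fun=> \sum_(q : 'S_n) D)) => [|p _]; last first.
  by apply: eq_bigr => q _; exact: E.
rewrite !cst mulrA -expr2 => /(mulfI (expf_neq0 2 nf)) ->.
apply: eq_bigr => k _; congr (_ * _); apply: eq_bigr => t _.
have kn : (k <= n)%N by rewrite -ltnS.
have -> : tavg (fun _ : I => fun _ : 'I_n => 1 : F) t = 1.
  rewrite (tavgE _ _ kn) -[RHS](mulVf nf) -[X in _ = _ * X]mulr1 -cst.
  by congr (_ * _); apply: eq_bigr => s _; rewrite big1.
by rewrite mulr1.
Qed.

Definition mclass (I : finType) k (t0 : {ffun 'I_k -> I}) : {set {ffun 'I_k -> I}} :=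
  [set t | [forall a, mult t a == mult t0 a]].

(** The sum over the phases factors into one geometric sum per letter. Multiplicities are less than
    [N], so those that agree modulo [N] are equal. *)
Lemma fourier_orth (C : fieldType) (I : finType) N (w : C) k k'
    (t : {ffun 'I_k -> I}) (t' : {ffun 'I_k' -> I}) :
  N.-primitive_root w -> (k < N)%N -> (k' < N)%N ->
  \sum_(th : {ffun I -> 'I_N})
    (\prod_l w ^+ th (t' l)) * (\prod_l (w^-1) ^+ th (t l)) =
  ([forall a, mult t' a == mult t a])%:R * N%:R ^+ #|I|.
Proof.
move=> pw kN kN'; have wN := prim_expr_order pw.
have w0 : w != 0.
  apply/eqP => w0; move/eqP: wN.
  by rewrite w0 expr0n gtn_eqF ?(leq_ltn_trans _ kN) // eq_sym oner_eq0.
pose g a (j : 'I_N) := (w ^+ mult t' a / w ^+ mult t a) ^+ j.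
transitivity (\sum_(th : {ffun I -> 'I_N}) \prod_a g a (th a)).
  apply: eq_bigr => th _.
  rewrite (prod_mult t' (fun a => w ^+ th a)) (prod_mult t (fun a => w^-1 ^+ th a)).
  rewrite -big_split; apply: eq_bigr => a _ /=.
  by rewrite /g expr_div_n !exprVn -!exprM !(mulnC (th a)).
rewrite -bigA_distr_bigA /=.
have gs a : \sum_j g a j = (mult t' a == mult t a)%:R * N%:R.
  rewrite /g; set z := _ / _; case: eqP => [e|/eqP ne].
    rewrite (_ : z = 1); last by rewrite /z e divff // expf_neq0.
    by under eq_bigr do rewrite expr1n; rewrite sumr_const card_ord mul1r.
  rewrite mul0r; apply/eqP; rewrite -(mulrI_eq0 _ (x := z - 1)); last first.
    apply/mulfI; rewrite subr_eq0 /z; apply: contraNneq ne => /divr1_eq /eqP.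
    by rewrite (eq_prim_root_expr pw) !modn_small //; apply: leq_ltn_trans (mult_le _ _) _.
  rewrite -subrX1 /z expr_div_n -!exprM !(mulnC _ N) !(exprM w) wN !expr1n.
  by rewrite divr1 subrr.
under eq_bigr => a _ do rewrite gs.
case: forallP => [h|/forallP].
  rewrite mul1r -prodr_const; apply: eq_big => a; first by rewrite inE.
  by rewrite (eqP (h a)) eqxx mul1r.
by rewrite negb_forall => /existsP[a /negPf ha]; rewrite mul0r (bigD1 a) //= ha !mul0r.
Qed.

(* [tavg f t] is a Fourier coefficient of the product as a function of the
   phases; the phases are sampled at roots of unity of order [n + 1]. *)
Lemma tavg_le_sup (C : numClosedFieldType) (I : finType) n (f : I -> 'I_n -> C)
    (r0 M : C) (r : I -> C) k (t : {ffun 'I_k -> I}) :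
    0 <= r0 -> (forall a, 0 <= r a) -> (k <= n)%N ->
    (forall s : I -> C, (forall a, `|s a| = r a) ->
       `|\prod_j (r0 + \sum_a s a * f a j)| <= M) ->
  ('C(n, k) * #|mclass t|)%:R * r0 ^+ (n - k) * \prod_l r (t l) * `|tavg f t| <= M.
Proof.
move=> r0_ge0 r_ge0 kn hM; have [w pw] := prim_root_exists C (ltn0Sn n).
have wN := prim_expr_order pw.
have w1 : `|w| = 1 by apply/eqP; rewrite -(@pexpr_eq1 _ _ n.+1) // -normrX wN normr1.
pose s (th : {ffun I -> 'I_n.+1}) a := r a * w ^+ th a.
pose A (th : {ffun I -> 'I_n.+1}) := \prod_j (r0 + \sum_a s th a * f a j).
have hA th : `|A th| <= M.
  by apply: hM => a; rewrite normrM normrX w1 expr1n mulr1 ger0_norm.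
(* The conjugate of the character belonging to [t]; summing against it keeps just the words with the
   multiplicities of [t]. *)
pose V (th : {ffun I -> 'I_n.+1}) := \prod_l (w^-1) ^+ th (t l).
have hV th : `|V th| = 1.
  by rewrite normr_prod big1 // => l _; rewrite normrX normrV ?unitfE -?normr_gt0 w1 // invr1 expr1n.
have E : \sum_(th : {ffun I -> 'I_n.+1}) A th * V th = (n.+1)%:R ^+ #|I| *
    (('C(n, k) * #|mclass t|)%:R * r0 ^+ (n - k) * \prod_l r (t l) * tavg f t).
  transitivity (\sum_(k' < n.+1) 'C(n, k')%:R * r0 ^+ (n - k') *
     \sum_(t' : {ffun 'I_k' -> I}) (\prod_l r (t' l)) * tavg f t' *
       ([forall a, mult t' a == mult t a]%:R * n.+1%:R ^+ #|I|)).
    under eq_bigr => th _ do rewrite /A prod_expand mulr_suml.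
    rewrite exchange_big /=; apply: eq_bigr => k' _.
    under eq_bigr => th _ do rewrite -[_ * V th]mulrA mulr_suml.
    rewrite -mulr_sumr exchange_big /=; congr (_ * _); apply: eq_bigr => t' _.
    rewrite -(fourier_orth t t' pw) // mulr_sumr; apply: eq_bigr => th _.
    by rewrite /s /V big_split /=; ring.
  have kn' : (k < n.+1)%N by [].
  rewrite (bigD1 (Ordinal kn')) //= [X in _ + X]big1 ?addr0 => [|k' k'k].
    rewrite (bigID (mem (mclass t))) /= [X in _ + X]big1 ?addr0 => [|t'].
      rewrite (eq_bigr (fun=> (\prod_l r (t l)) * tavg f t * n.+1%:R ^+ #|I|)).
        by rewrite sumr_const natrM -[_ *+ #|_|]mulr_natl; ring.
      move=> t'; rewrite inE => ht; rewrite ht mul1r; congr (_ * _).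
      rewrite (@tavg_perm _ _ _ f _ t' t) // ?(prod_mult t' r) ?(prod_mult t r).
        by congr (_ * _); apply: eq_bigr => a _; rewrite (eqP (forallP ht a)).
      by move=> a; rewrite (eqP (forallP ht a)).
    by rewrite inE => /negPf ->; rewrite mul0r mulr0.
  rewrite big1 ?mulr0 // => t' _; case: forallP => [h|_]; last by rewrite mul0r mulr0.
  case/eqP: k'k; apply: val_inj; rewrite /= -(sum_mult t') -(sum_mult t).
  by apply: eq_bigr => a _; rewrite (eqP (h a)).
set X := _ * _ * _ * tavg f t in E.
have NX : `|X| <= M.
  have N0 : 0 < (n.+1)%:R ^+ #|I| :> C by rewrite exprn_gt0 // ltr0n.
  rewrite -(ler_pM2l N0) -[X in X * `|_|](gtr0_norm N0) -normrM -E.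
  apply: le_trans (ler_norm_sum _ _ _) _.
  apply: le_trans (ler_sum _ (fun th _ => _ : `|A th * V th| <= M)) _.
    by move=> th _; rewrite normrM hV mulr1.
  have -> : (n.+1)%:R ^+ #|I| * M = \sum_(th in [set: {ffun I -> 'I_n.+1}]) M.
    by rewrite sumr_const cardsT card_ffun card_ord -natrX mulr_natl.
  by rewrite le_eqVlt; apply/orP; left; apply/eqP; apply: eq_bigl => th; rewrite inE.
apply: le_trans NX; rewrite /X !normrM ger0_norm ?ler0n // ger0_norm ?exprn_ge0 //.
by rewrite ger0_norm // prodr_ge0.
Qed.

(** * The Fourier bound on averages *)

Section PhaseSup.
Variables (C : numClosedFieldType) (n : nat) (u : 'I_n -> C) (v : 'I_n -> 'I_n -> C).
Variables (c sn r0 : C) (r s : 'I_n -> C).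
Hypotheses (n_gt0 : (0 < n)%N) (c_ge0 : 0 <= c).
Hypotheses (sn_ge0 : 0 <= sn) (sn2 : sn ^+ 2 = n%:R).
Hypotheses (u_gt0 : forall j, 0 < u j) (u1 : forall j, `|u j - 1| <= c / n%:R).
Hypotheses (v_real : forall a j, v a j \is Num.real).
Hypotheses (v_orth : forall a b, \sum_j v a j * v b j = (a == b)%:R).
Hypotheses (r0_ge0 : 0 <= r0) (rs : forall a, `|s a| = r a).
Hypotheses (r_mean : forall a, r a != 0 -> \sum_j v a j = 0).

Let y j := \sum_a s a * v a j.

Let sum_y : \sum_j y j = 0.
Proof.
rewrite exchange_big big1 //= => a _; rewrite -mulr_sumr.
have [r_a0|/r_mean ->] := eqVneq (r a) 0; last by rewrite mulr0.
by move: (rs a); rewrite r_a0 => /normr0_eq0 ->; rewrite mul0r.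
Qed.

Let conj_y j : (y j)^* = \sum_a (s a)^* * v a j.
Proof.
by rewrite rmorph_sum; apply: eq_bigr => a _; rewrite rmorphM /= [X in _ * X]conj_Creal.
Qed.

Let sum_norm_y : \sum_j `|y j| ^+ 2 = \sum_a r a ^+ 2.
Proof.
under eq_bigr => j _ do rewrite normCK conj_y /y mulr_suml.
rewrite exchange_big /=; apply: eq_bigr => a _.
under eq_bigr => j _ do rewrite mulr_sumr.
rewrite exchange_big /= (bigD1 a) //= [X in _ + X]big1 ?addr0 => [|b ba].
  rewrite (eq_bigr (fun j => (s a * (s a)^*) * (v a j * v a j))) => [|j _]; last by ring.
  by rewrite -mulr_sumr v_orth eqxx mulr1 -normCK rs.
rewrite (eq_bigr (fun j => (s a * (s b)^*) * (v a j * v b j))) => [|j _]; last by ring.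
by rewrite -mulr_sumr v_orth eq_sym (negPf ba) mulr0.
Qed.

(** As [y] sums to 0, the weight [u j] in the cross terms may be replaced by [u j - 1], which is at
    most [c / n] and turns a term of order [sn] into a bounded one. The constant is [2 c + c^2] from
    the squares of the weights plus [c] from the cross terms. *)
Let sum_norm_Y : \sum_j `|r0 * u j + sn * y j| ^+ 2 <=
  (n%:R + (3%:R * c + c ^+ 2)) * (r0 ^+ 2 + \sum_a r a ^+ 2).
Proof.
have n0 : 0 < n%:R :> C by rewrite ltr0n.
have cr : c \is Num.real by exact: ger0_real.
have E : \sum_j `|r0 * u j + sn * y j| ^+ 2 = r0 ^+ 2 * \sum_j u j ^+ 2 +
    \sum_j sn * r0 * (u j - 1) * (y j + (y j)^*) + n%:R * \sum_a r a ^+ 2.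
  have sy2 : \sum_j (y j + (y j)^*) = 0.
    by rewrite big_split /= -rmorph_sum /= sum_y conjC0 addr0.
  transitivity (\sum_j (r0 ^+ 2 * u j ^+ 2 + (sn * r0 * (u j - 1) * (y j + (y j)^*)
      + (sn * r0) * (y j + (y j)^*)) + n%:R * `|y j| ^+ 2)).
    apply: eq_bigr => j _; rewrite !normCK !rmorphD !rmorphM /=.
    rewrite (conj_Creal (ger0_real r0_ge0)) (conj_Creal (ger0_real sn_ge0)).
    by rewrite (conj_Creal (gtr0_real (u_gt0 j))) -sn2; ring.
  rewrite !big_split /= -!mulr_sumr sy2 mulr0 addr0 sum_norm_y.
  by [].
rewrite E.
have h1 : \sum_j u j ^+ 2 <= n%:R + 2%:R * c + c ^+ 2.
  have : \sum_(j < n) u j ^+ 2 <= \sum_(j < n) (1 + c / n%:R) ^+ 2.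
    apply: ler_sum => j _; rewrite lerXn2r ?nnegrE ?(ltW (u_gt0 j)) //.
      by rewrite addr_ge0 // divr_ge0 // ler0n.
    rewrite -lerBlDl; apply: le_trans (u1 j).
    by rewrite real_ler_norm // rpredB // gtr0_real.
  move=> /le_trans; apply; rewrite sumr_const card_ord -[leLHS]mulr_natl.
  have -> : n%:R * (1 + c / n%:R) ^+ 2 = n%:R + 2%:R * c + c ^+ 2 / n%:R.
    by field; rewrite gt_eqF.
  rewrite lerD2l ler_pdivrMr // ler_peMr ?exprn_ge0 // ler1n //.
have h2 : \sum_j sn * r0 * (u j - 1) * (y j + (y j)^*) <= c * (r0 ^+ 2 + \sum_a r a ^+ 2).
  rewrite -sum_norm_y.
  have -> : c * (r0 ^+ 2 + \sum_j `|y j| ^+ 2) =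
      \sum_j (c / n%:R) * (r0 ^+ 2 + n%:R * `|y j| ^+ 2).
    rewrite -mulr_sumr big_split /= sumr_const card_ord -mulr_sumr -[r0 ^+ 2 *+ n]mulr_natl.
    by field; rewrite gt_eqF.
  apply: ler_sum => j _.
  have yr : y j + (y j)^* \is Num.real by rewrite CrealE rmorphD /= conjCK addrC.
  have h3 : `|y j + (y j)^*| <= 2%:R * `|y j|.
    by apply: le_trans (ler_normD _ _) _; rewrite norm_conjC; rewrite mulr_natl mulr2n.
  apply: le_trans (_ : `|sn * r0 * (u j - 1) * (y j + (y j)^*)| <= _).
    apply: real_ler_norm; apply: rpredM yr; apply: rpredM.
      by apply: rpredM; apply: ger0_real.
    by rewrite rpredB // gtr0_real.
  rewrite !normrM (ger0_norm sn_ge0) (ger0_norm r0_ge0).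
  apply: le_trans (_ : (c / n%:R) * (sn * r0 * (2%:R * `|y j|)) <= _).
    rewrite mulrAC [leRHS]mulrC; apply: ler_pM => //.
    - by rewrite !mulr_ge0.
    - by rewrite ler_wpM2l // mulr_ge0.
  rewrite ler_wpM2l ?divr_ge0 ?ler0n // -sn2 -exprMn -subr_ge0.
  have -> : r0 ^+ 2 + (sn * `|y j|) ^+ 2 - sn * r0 * (2%:R * `|y j|) =
     (r0 - sn * `|y j|) ^+ 2 by ring.
  by apply: real_exprn_even_ge0 => //; rewrite rpredB ?ger0_real // mulr_ge0.
have r2 : 0 <= \sum_a r a ^+ 2.
  by apply: sumr_ge0 => a _; rewrite -rs exprn_ge0.
have -> : (n%:R + (3%:R * c + c ^+ 2)) * (r0 ^+ 2 + \sum_a r a ^+ 2) =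
  r0 ^+ 2 * (n%:R + 2%:R * c + c ^+ 2) + c * (r0 ^+ 2 + \sum_a r a ^+ 2) +
  (n%:R * \sum_a r a ^+ 2 + (2%:R * c + c ^+ 2) * \sum_a r a ^+ 2) by ring.
apply: lerD; first by apply: lerD h2; rewrite ler_wpM2l // exprn_ge0.
by rewrite lerDl mulr_ge0 // addr_ge0 ?mulr_ge0 ?exprn_ge0 // ler0n.
Qed.

(* By the AM-GM inequality for the squared moduli of the factors. *)
Lemma phase_sup : `|\prod_j (r0 + \sum_a s a * (sn * v a j / u j))| ^+ 2 <=
  ((1 + (3%:R * c + c ^+ 2) / n%:R) * (r0 ^+ 2 + \sum_a r a ^+ 2)) ^+ n /
  (\prod_j u j) ^+ 2.
Proof.
have n0 : 0 < n%:R :> C by rewrite ltr0n.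
have U0 : 0 < \prod_j u j by rewrite prodr_gt0.
rewrite ler_pdivlMr ?exprn_gt0 // -(ger0_norm (ltW U0)) -exprMn -normrM -big_split /=.
rewrite (eq_bigr (fun j => r0 * u j + sn * y j)) => [|j _]; last first.
  rewrite mulrDl mulr_suml mulr_sumr; congr (_ + _); apply: eq_bigr => a _.
  by field; rewrite gt_eqF.
rewrite normr_prod -prodrXl.
have [] := @leif_AGM C 'I_n predT (fun j => `|r0 * u j + sn * y j| ^+ 2) _.
  by move=> j _; rewrite exprn_ge0.
move=> /le_trans h _; apply: h; rewrite card_ord.
rewrite lerXn2r ?nnegrE //.
- by rewrite divr_ge0 ?ler0n // sumr_ge0 // => j _; rewrite exprn_ge0.
- rewrite mulr_ge0 //; first by rewrite addr_ge0 // divr_ge0 ?ler0n // addr_ge0 ?mulr_ge0 ?exprn_ge0 ?ler0n.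
  by rewrite addr_ge0 ?exprn_ge0 // sumr_ge0 // => a _; rewrite -rs exprn_ge0.
rewrite ler_pdivrMr //; apply: le_trans sum_norm_Y _.
by rewrite le_eqVlt; apply/orP; left; apply/eqP; field; rewrite gt_eqF.
Qed.

End PhaseSup.

Lemma tavg_rmorph (F K : fieldType) (phi : {rmorphism F -> K}) (I : finType) n
    (f : I -> 'I_n -> F) k (t : {ffun 'I_k -> I}) (kn : (k <= n)%N) :
  tavg (fun a j => phi (f a j)) t = phi (tavg f t).
Proof.
rewrite !(tavgE _ _ kn) rmorphM fmorphV rmorph_nat; congr (_ * _).
by rewrite rmorph_sum; apply: eq_bigr => s _; rewrite rmorph_prod.
Qed.

Definition scaled (R : rcfType) n (u : 'I_n -> R) (v : 'I_n -> 'I_n -> R) a j : R :=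
  Num.sqrt n%:R * v a j / u j.

(** The data are real but the phases are complex; the order embedding [phi] carries the real data to
    a closed field, where [tavg_le_sup] and [phase_sup] apply. *)
Lemma tavg_mult_bound_closed (R : rcfType) (C : numClosedFieldType)
    (phi : {rmorphism R -> C}) n (u : 'I_n -> R) (v : 'I_n -> 'I_n -> R) c k
    (t : {ffun 'I_k -> 'I_n}) :
  (forall x y, (phi x <= phi y) = (x <= y)) ->
  (0 < n)%N -> 0 <= c -> (forall j, 0 < u j) -> (forall j, `|u j - 1| <= c / n%:R) ->
  (forall a b, \sum_j v a j * v b j = (a == b)%:R) -> (k <= n)%N ->
  (forall l, \sum_j v (t l) j = 0) ->
  ('C(n, k) * #|mclass t|)%:R ^+ 2 * (n - k)%:R ^+ (n - k) *
    (\prod_a (mult t a)%:R ^+ mult t a) * tavg (scaled u v) t ^+ 2 <=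
  ((1 + (3%:R * c + c ^+ 2) / n%:R) * n%:R) ^+ n / (\prod_j u j) ^+ 2.
Proof.
move=> phi_le n0 c0 u0 u1 vo kn vt.
have phi_ge0 x : 0 <= x -> 0 <= phi x by move=> x0; rewrite -(rmorph0 phi) phi_le.
have phi_real x : phi x \is Num.real.
  by case: (leP 0 x) => [/phi_ge0/ger0_real//|/ltW]; rewrite -oppr_ge0 => /phi_ge0;
     rewrite rmorphN oppr_ge0 => /ler0_real.
have phi_norm x : `|phi x| = phi `|x|.
  have [x0|x0] := leP 0 x.
    by rewrite (ger0_norm x0) (ger0_norm (phi_ge0 _ x0)).
  rewrite (ltr0_norm x0) rmorphN ler0_norm //.
  by rewrite -oppr_ge0 -rmorphN phi_ge0 // oppr_ge0 ltW.
set B : R := _ / _.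
have B0 : 0 <= B.
  rewrite /B divr_ge0 ?exprn_ge0 ?mulr_ge0 ?ler0n ?addr_ge0 ?divr_ge0 ?addr_ge0 //.
  - by rewrite mulr_ge0.
  - by rewrite exprn_ge0.
  - by apply: prodr_ge0 => j _; exact: ltW.
(* These radii maximise [r0 ^+ (n - k) * \prod_a r a ^+ mult t a] on the sphere
   [r0 ^+ 2 + \sum_a r a ^+ 2 = n], by Lagrange multipliers. *)
pose r0 := Num.sqrt (n - k)%:R : R; pose r a := Num.sqrt (mult t a)%:R : R.
have r00 : 0 <= r0 by exact: sqrtr_ge0.
have rge a : 0 <= r a by exact: sqrtr_ge0.
have H : ('C(n, k) * #|mclass t|)%:R * (phi r0) ^+ (n - k) *
    \prod_l phi (r (t l)) * `|tavg (fun a j => phi (scaled u v a j)) t| <= phi (Num.sqrt B).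
  apply: (@tavg_le_sup C _ n (fun a j => phi (scaled u v a j)) (phi r0)
    (phi (Num.sqrt B)) (fun a => phi (r a))) => // [|a|s hs]; rewrite ?phi_ge0 //.
  rewrite -(@ler_pXn2r _ 2) ?nnegrE ?normr_ge0 ?(phi_ge0 _ (sqrtr_ge0 _)) //.
  rewrite -(rmorphXn phi) sqr_sqrtr //.
  have := @phase_sup C n (fun j => phi (u j)) (fun a j => phi (v a j)) (phi c)
    (phi (Num.sqrt n%:R)) (phi r0) (fun a => phi (r a)) s n0 (phi_ge0 _ c0)
    (phi_ge0 _ (sqrtr_ge0 _)).
  rewrite -(rmorphXn phi) sqr_sqrtr ?ler0n // rmorph_nat.
  move=> /(_ erefl) h.
  have {h} := h.
  rewrite /B.
  have -> : \prod_j (phi r0 + \sum_a s a * (phi (Num.sqrt n%:R) * phi (v a j) / phi (u j)))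
     = \prod_j (phi r0 + \sum_a s a * phi (scaled u v a j)).
    apply: eq_bigr => j _; congr (_ + _); apply: eq_bigr => a _.
    by rewrite /scaled fmorph_div rmorphM.
  have -> : phi r0 ^+ 2 + \sum_a phi (r a) ^+ 2 = n%:R.
    rewrite -(rmorphXn phi) sqr_sqrtr ?ler0n //.
    under eq_bigr => a _ do rewrite -(rmorphXn phi) sqr_sqrtr ?ler0n // rmorph_nat.
    by rewrite -natr_sum (sum_mult t) rmorph_nat -natrD subnK.
  have -> : ((1 + (3%:R * phi c + phi c ^+ 2) / n%:R) * n%:R) ^+ n / (\prod_j phi (u j)) ^+ 2 =
    phi (((1 + (3 * c + c ^+ 2) / n%:R) * n%:R) ^+ n / (\prod_j u j) ^+ 2).
    rewrite fmorph_div !rmorphXn rmorph_prod !rmorphM rmorphD rmorphM rmorph1.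
    by rewrite fmorphV rmorphD rmorphM rmorphXn !rmorph_nat.
  apply.
  - by move=> j; rewrite -(rmorph0 phi) lt_neqAle phi_le (inj_eq (fmorph_inj phi)) -lt_neqAle.
  - move=> j; have -> : phi (u j) - 1 = phi (u j - 1) by rewrite rmorphB rmorph1.
    rewrite phi_norm -(rmorph_nat phi) -fmorph_div.
    by rewrite phi_le.
  - by move=> a j.
  - move=> a b; rewrite -(rmorph_nat phi) -vo rmorph_sum; apply: eq_bigr => j _.
    by rewrite rmorphM.
  - exact: phi_ge0.
  - by move=> a; rewrite hs.
  move=> a ra; rewrite -(rmorph_sum phi) /=.
  suff -> : \sum_j v a j = 0 by rewrite rmorph0.
  have : (0 < mult t a)%N.
    by rewrite lt0n; apply: contraNneq ra => h; rewrite /r h sqrtr0 rmorph0.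
  rewrite /mult lt0n sum_nat_eq0 negb_forall => /existsP[l].
  by case: (t l =P a) => [<- _|_ //]; exact: vt.
rewrite tavg_rmorph // phi_norm -(rmorph_nat phi) -(rmorphXn phi) -(rmorph_prod phi) in H.
rewrite -!(rmorphM phi) phi_le in H.
have /= := lerXn2r 2 _ _ H; rewrite !nnegrE => h.
move: (h); rewrite sqr_sqrtr // !exprMn real_normK ?num_real // => {}h.
apply: le_trans (h _ _); rewrite ?sqrtr_ge0 //; last first.
  by rewrite !mulr_ge0 ?ler0n ?exprn_ge0 ?prodr_ge0.
rewrite -[(r0 ^+ _) ^+ 2]exprM (mulnC _ 2) exprM sqr_sqrtr ?ler0n // -prodrXl.
rewrite (eq_bigr (fun l => (mult t (t l))%:R)) => [|l _]; last by rewrite sqr_sqrtr ?ler0n.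
by rewrite (prod_mult t (fun a => (mult t a)%:R)).
Qed.

Lemma tavg_mult_bound (R : rcfType) n (u : 'I_n -> R) (v : 'I_n -> 'I_n -> R) c k
    (t : {ffun 'I_k -> 'I_n}) :
  (0 < n)%N -> 0 <= c -> (forall j, 0 < u j) -> (forall j, `|u j - 1| <= c / n%:R) ->
  (forall a b, \sum_j v a j * v b j = (a == b)%:R) -> (k <= n)%N ->
  (forall l, \sum_j v (t l) j = 0) ->
  ('C(n, k) * #|mclass t|)%:R ^+ 2 * (n - k)%:R ^+ (n - k) *
    (\prod_a (mult t a)%:R ^+ mult t a) * tavg (scaled u v) t ^+ 2 <=
  ((1 + (3%:R * c + c ^+ 2) / n%:R) * n%:R) ^+ n / (\prod_j u j) ^+ 2.
Proof.
apply: (@tavg_mult_bound_closed R (complex R) (real_complex R)).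
by move=> x y; rewrite lecR.
Qed.

(** * Sums over words *)

(** Asymptotic to the square root of [2 pi m] by Stirling's formula, and equal to 1 at [m = 0]. It
    is what the Fourier bound loses at a letter of multiplicity [m]. *)
Definition stirling_ratio (R : realType) m : R :=
  m`!%:R * expR 1 ^+ m / m%:R ^+ m.

Lemma natrXn_gt0 (R : realType) m : 0 < m%:R ^+ m :> R.
Proof. by case: m => [|m]; [rewrite expr0 ltr01|rewrite exprn_gt0 ?ltr0n]. Qed.

Section StirlingRatio.
Variable R : realType.
Local Notation st := (@stirling_ratio R).

Lemma stirling_ratio_gt0 m : 0 < st m.
Proof.
by rewrite divr_gt0 ?natrXn_gt0 ?mulr_gt0 ?exprn_gt0 ?expR_gt0 ?ltr0n ?fact_gt0.
Qed.

Lemma stirling_ratioS m : (0 < m)%N ->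
  st m.+1 = st m * (expR 1 / (1 + m%:R^-1) ^+ m).
Proof.
move=> m0; have m0' : m%:R != 0 :> R by rewrite pnatr_eq0 -lt0n.
have m1 : (m.+1)%:R != 0 :> R by rewrite pnatr_eq0.
have -> : 1 + m%:R^-1 = m.+1%:R / m%:R :> R by rewrite -natr1; field.
rewrite /stirling_ratio factS natrM !exprS expr_div_n.
by field; rewrite nat1r m1 !expf_neq0.
Qed.

(** The quotient of consecutive terms is [e / (1 + 1/m)^m], which is at least 1. *)
Lemma stirling_ratio_homo m n : (m <= n)%N -> st m <= st n.
Proof.
move=> mn; apply: (homo_leq (@lexx _ _) (@le_trans _ _)) mn => {}m.
have [->|m0] := posnP m.
  rewrite /stirling_ratio (factS 0) fact0 muln1 !expr0 !expr1 !invr1 !mulr1 !mul1r.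
  by rewrite -[leLHS](expR0 R) ler_expR.
rewrite stirling_ratioS // ler_peMr ?(ltW (stirling_ratio_gt0 _)) //.
have m0' : 0 < m%:R :> R by rewrite ltr0n.
rewrite ler_pdivlMr ?mul1r ?exprn_gt0 ?addr_gt0 ?invr_gt0 //.
rewrite -[X in expR X](divff (lt0r_neq0 m0')) expRM_natl.
by rewrite lerXn2r ?nnegrE ?expR_ge0 ?addr_ge0 ?invr_ge0 ?expR_ge1Dx // ltW.
Qed.

(** Induction by the inequality [e <= (1 + 1/m)^(m + 1)], obtained from [1 + x <= exp x] at
    [x = - 1 / (m + 1)]. *)
Lemma stirling_ratio_le m : (0 < m)%N -> st m <= expR 1 * m%:R.
Proof.
case: m => // m _; elim: m => [|m IH].
  by rewrite /stirling_ratio (factS 0) fact0 muln1 !expr1 invr1 !mulr1 mul1r.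
rewrite stirling_ratioS //; set x : R := (m.+1)%:R.
have x0 : 0 < x by rewrite ltr0n.
have -> : (m.+2)%:R = x + 1 :> R by rewrite /x -natr1.
apply: le_trans (ler_wpM2r _ IH) _.
  by rewrite divr_ge0 ?expR_ge0 // exprn_ge0 // addr_ge0 ?invr_ge0 // ltW.
rewrite -mulrA ler_pM2l ?expR_gt0 // mulrA ler_pdivrMr ?exprn_gt0 ?addr_gt0 ?invr_gt0 //.
have -> : x + 1 = x * (1 + x^-1) by rewrite mulrDr divff ?gt_eqF // mulr1.
rewrite -mulrA ler_pM2l // -exprS.
have h : expR (- (x + 1)^-1) >= (1 + x^-1)^-1.
  have -> : (1 + x^-1)^-1 = 1 + - (x + 1)^-1.
    by field; rewrite nat1r natr1 !pnatr_eq0.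
  exact: expR_ge1Dx.
have {}h : (expR ((x + 1)^-1) <= 1 + x^-1).
  by move: h; rewrite expRN lef_pV2 ?posrE ?expR_gt0 ?addr_gt0 ?invr_gt0.
have -> : expR 1 = expR ((x + 1)^-1) ^+ m.+2 :> R.
  by rewrite -expRM_natl /x natr1 divff ?pnatr_eq0.
by rewrite lerXn2r ?nnegrE ?expR_ge0 // addr_ge0 ?invr_ge0 // ltW.
Qed.

End StirlingRatio.

(** The right-hand side of [tavg_mult_bound] without its factor [n ^+ n]; for the weights of the
    kernel it stays bounded as [n] grows. *)
Definition perturb_const (R : realType) n (u : 'I_n -> R) (c : R) : R :=
  (1 + (3 * c + c ^+ 2) / n%:R) ^+ n / (\prod_j u j) ^+ 2.

(** [tavg_mult_bound] solved for the square of the average: [#|mclass t|] is a multinomial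
    coefficient, and the powers of [n] and [n - k] are compared through the monotonicity of
    [stirling_ratio]. *)
Lemma term_bound (R : realType) n (u : 'I_n -> R) (v : 'I_n -> 'I_n -> R)
    (ka : 'I_n -> R) c k (t : {ffun 'I_k -> 'I_n}) :
  (0 < n)%N -> 0 <= c -> (forall j, 0 < u j) -> (forall j, `|u j - 1| <= c / n%:R) ->
  (forall a b, \sum_j v a j * v b j = (a == b)%:R) -> (k <= n)%N ->
  (forall a, ka a != 0 -> \sum_j v a j = 0) ->
  'C(n, k)%:R * (\prod_l `|ka (t l)|) * tavg (scaled u v) t ^+ 2 <=
  perturb_const u c / k`!%:R * \prod_a (`|ka a| ^+ mult t a * stirling_ratio R (mult t a)
     * (mult t a)`!%:R).
Proof.
move=> n0 c0 u0 u1 vo kn vk.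
have n0' : 0 < n%:R :> R by rewrite ltr0n.
have E0 : 0 <= perturb_const u c.
  rewrite /perturb_const divr_ge0 ?exprn_ge0 ?addr_ge0 ?divr_ge0 ?addr_ge0 ?mulr_ge0 ?exprn_ge0 ?ler0n //.
  by apply: prodr_ge0 => j _; exact: ltW.
have [[l kl]|nz] := pselect (exists l, ka (t l) = 0).
  rewrite (bigD1 l) //= kl normr0 mul0r mulr0 mul0r.
  apply: mulr_ge0; first by rewrite divr_ge0 ?ler0n.
  apply: prodr_ge0 => a _.
  by rewrite !mulr_ge0 ?exprn_ge0 ?ler0n // (ltW (stirling_ratio_gt0 _ _)).
have {nz} vt l : \sum_j v (t l) j = 0.
  by apply: vk; apply/eqP => h; apply: nz; exists l.
have := tavg_mult_bound n0 c0 u0 u1 vo kn vt.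
have := card_same_mult t; rewrite -/(mclass t).
set P := (\prod_a (mult t a)`!)%N; set Q := \prod_a (mult t a)%:R ^+ mult t a => kE.
have P0 : 0 < P%:R :> R by rewrite ltr0n prodn_gt0 // => a; exact: fact_gt0.
have Q0 : 0 < Q.
  by apply: prodr_gt0 => a _; exact: natrXn_gt0.
have k0 : 0 < k`!%:R :> R by rewrite ltr0n fact_gt0.
have -> : \prod_a (`|ka a| ^+ mult t a * stirling_ratio R (mult t a) * (mult t a)`!%:R) =
   (\prod_l `|ka (t l)|) * (P%:R ^+ 2 * expR 1 ^+ k / Q).
  rewrite !big_split /= (prod_mult t (fun a => `|ka a|)) -natr_prod -/P.
  rewrite natr_prod -natr_prod -/P prodfV -/Q.
  rewrite prodrXr (sum_mult t).
  by field; rewrite gt_eqF.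
set W := \prod_l `|ka (t l)|; set G2 := tavg _ _ ^+ 2; set C := 'C(n, k).
have W0 : 0 <= W by apply: prodr_ge0.
have C0 : 0 < C%:R :> R by rewrite ltr0n bin_gt0.
have clE : #|mclass t|%:R = k`!%:R / P%:R :> R.
  by rewrite -kE natrM mulfK // gt_eqF.
rewrite natrM clE => H.
rewrite mulrAC [leLHS]mulrC [leRHS]mulrCA ler_wpM2l //.
have Z0 : 0 < (n - k)%:R ^+ (n - k) :> R.
  exact: natrXn_gt0.
(* The inequality between the Stirling ratios of [n - k] and [n], with denominators cleared. *)
have K : n%:R ^+ n <= C%:R * k`!%:R * (n - k)%:R ^+ (n - k) * expR 1 ^+ k :> R.
  have := stirling_ratio_homo R (leq_subr k n).
  rewrite /stirling_ratio ler_pdivrMr // mulrAC ler_pdivlMr ?exprn_gt0 //.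
  have -> : n`! = (C * k`! * (n - k)`!)%N by rewrite /C -mulnA bin_fact.
  rewrite -[in X in _ <= X -> _](subnK kn) [in X in _ <= X -> _]exprD !natrM.
  rewrite (subnK kn) => h.
  have F0 : 0 < (n - k)`!%:R * expR 1 ^+ (n - k) :> R.
    by rewrite mulr_gt0 ?exprn_gt0 ?expR_gt0 // ltr0n fact_gt0.
  rewrite -(ler_pM2l F0); apply: le_trans h _.
  by rewrite le_eqVlt; apply/orP; left; apply/eqP; ring.
have H' : (C%:R * (k`!%:R / P%:R)) ^+ 2 * (n - k)%:R ^+ (n - k) * Q * G2 <=
   perturb_const u c * (C%:R * k`!%:R * (n - k)%:R ^+ (n - k) * expR 1 ^+ k).
  apply: le_trans H _; rewrite exprMn mulrAC -/(perturb_const u c).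
  by rewrite ler_wpM2l.
have D0 : 0 < C%:R * k`!%:R ^+ 2 * (n - k)%:R ^+ (n - k) * Q / P%:R ^+ 2.
  have k2 : 0 < k`!%:R ^+ 2 :> R by rewrite exprn_gt0.
  have P2 : 0 < P%:R ^+ 2 :> R by rewrite exprn_gt0.
  by rewrite divr_gt0 // !mulr_gt0.
rewrite -(ler_pM2l D0); move: H'; congr (_ <= _); field; rewrite !gt_eqF //.
Qed.

Lemma sum_m_exp_le (R : realFieldType) (y : R) n : 0 <= y -> y < 1 ->
  \sum_(m < n.+1) m%:R * y ^+ m <= y / (1 - y) ^+ 2.
Proof.
move=> y0 y1; have d0 : 0 < 1 - y by rewrite subr_gt0.
rewrite ler_pdivlMr ?exprn_gt0 //.
have -> : (\sum_(m < n.+1) m%:R * y ^+ m) * (1 - y) ^+ 2 =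
    y - n.+1%:R * y ^+ n.+1 + n%:R * y ^+ n.+2.
  elim: n => [|n IH]; first by rewrite big_ord_recl big_ord0 /=; ring.
  by rewrite big_ord_recr mulrDl IH -!natr1 !exprS; ring.
rewrite [y ^+ n.+2]exprS -natr1.
have yn : 0 <= y ^+ n.+1 by rewrite exprn_ge0.
have : n%:R * y ^+ n.+1 * y <= n%:R * y ^+ n.+1.
  by rewrite ler_piMr ?mulr_ge0 ?ler0n // ltW.
by move: yn; set a := _ ^+ n.+1; move: a => a; lra.
Qed.

Lemma coefM_ge0 (R : numDomainType) (p q : {poly R}) :
  (forall k, 0 <= p`_k) -> (forall k, 0 <= q`_k) -> forall k, 0 <= (p * q)`_k.
Proof. by move=> p0 q0 k; rewrite coefM; apply: sumr_ge0 => i _; rewrite mulr_ge0. Qed.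

Lemma coef_prod_ge0 (R : numDomainType) (I : finType) (P : pred I) (p : I -> {poly R}) :
  (forall a k, 0 <= (p a)`_k) -> forall k, 0 <= (\prod_(a | P a) p a)`_k.
Proof.
move=> p0; apply: (big_ind (fun q : {poly R} => forall k, 0 <= q`_k)) => [k||a _] //.
  by rewrite coef1 ler0n.
exact: coefM_ge0.
Qed.

Section TupleSums.
Variables (R : realType) (n : nat) (u : 'I_n -> R) (v : 'I_n -> 'I_n -> R).
Variables (ka : 'I_n -> R) (c q : R).
Hypotheses (n_gt0 : (0 < n)%N) (c_ge0 : 0 <= c) (u_gt0 : forall j, 0 < u j).
Hypothesis u1 : forall j, `|u j - 1| <= c / n%:R.
Hypothesis v_orth : forall a b, \sum_j v a j * v b j = (a == b)%:R.
Hypothesis v_mean : forall a, ka a != 0 -> \sum_j v a j = 0.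
Hypothesis q1 : q < 1.

Let st := @stirling_ratio R.
Let E := perturb_const u c.

Definition tuple_sum (A : pred 'I_n) k : R :=
  'C(n, k)%:R * \sum_(t : {ffun 'I_k -> 'I_n} | [forall l, A (t l)])
    (\prod_l ka (t l)) * tavg (scaled u v) t ^+ 2.

(** Majorants: by [term_bound] and Leibniz' rule, the words of length [k] contribute at most [E]
    times the coefficient of degree [k] in the product of these polynomials. Degrees above [n] never
    occur as multiplicities. *)
Definition letter_poly a : {poly R} := \poly_(m < n.+1) (`|ka a| ^+ m * st m).
Definition letters_poly (A : pred 'I_n) : {poly R} := \prod_(a | A a) letter_poly a.

Let E_ge0 : 0 <= E.
Proof.
rewrite /E /perturb_const divr_ge0 ?exprn_ge0 ?addr_ge0 ?divr_ge0 ?addr_ge0 ?mulr_ge0 ?exprn_ge0 ?ler0n //.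
by apply: prodr_ge0 => j _; exact: ltW.
Qed.

(** Leibniz' rule with the polynomial 1 at the letters outside [A], which discards every word that
    contains one of them. *)
Let sum_letters (A : pred 'I_n) k : (k <= n)%N ->
  \sum_(t : {ffun 'I_k -> 'I_n} | [forall l, A (t l)])
    \prod_a (`|ka a| ^+ mult t a * st (mult t a) * (mult t a)`!%:R) =
  (letters_poly A)`_k * k`!%:R.
Proof.
move=> kn; rewrite /letters_poly [\prod_(a | A a) _]big_mkcond /= mulr_natr.
rewrite -(@sum_mult_coef R _ k (fun a => if A a then letter_poly a else 1)).
rewrite big_mkcond /=; apply: eq_bigr => t _; case: forallP => [At|/forallP].
  apply: eq_bigr => a _; case: ifPn => Aa.
    by rewrite coef_poly ltnS (leq_trans (mult_le _ _) kn) mulr_natr.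
  suff -> : mult t a = 0%N.
    by rewrite fact0 coef1 expr0 mul1r mulr1 /st /stirling_ratio fact0 !expr0 invr1 !mulr1.
  apply/eqP; rewrite sum_nat_eq0; apply/forallP => l /=.
  by apply/eqP; case: eqP => // e; move: (At l); rewrite e (negPf Aa).
rewrite negb_forall => /existsP[l Al]; rewrite (bigD1 (t l)) //= (negPf Al) coef1.
by rewrite gtn_eqF ?mult_gt0 // mul0rn mul0r.
Qed.

(** Stated for an arbitrary set of words, as it serves both the words over [A] and those that leave
    [A]. *)
Let norm_sum_le (P : forall k, pred {ffun 'I_k -> 'I_n}) k : (k <= n)%N ->
  `|'C(n, k)%:R * \sum_(t | P k t) (\prod_l ka (t l)) * tavg (scaled u v) t ^+ 2| <=
  E / k`!%:R * \sum_(t | P k t)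
    \prod_a (`|ka a| ^+ mult t a * st (mult t a) * (mult t a)`!%:R).
Proof.
move=> kn; rewrite !mulr_sumr; apply: le_trans (ler_norm_sum _ _ _) _.
apply: ler_sum => t _; apply: le_trans (term_bound t n_gt0 c_ge0 u_gt0 u1 v_orth kn v_mean).
by rewrite normrM normrM normr_prod normr_nat normrX real_normK ?num_real // mulrA.
Qed.

Lemma tuple_sum_le A k : (k <= n)%N -> `|tuple_sum A k| <= E * (letters_poly A)`_k.
Proof.
move=> kn; apply: le_trans (norm_sum_le (fun k t => [forall l, A (t l)]) kn) _.
have k0 : k`!%:R != 0 :> R by rewrite pnatr_eq0 -lt0n fact_gt0.
by rewrite sum_letters // le_eqVlt; apply/orP; left; apply/eqP; field.
Qed.

Lemma tuple_sum_diff A k : (k <= n)%N ->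
  `|tuple_sum predT k - tuple_sum A k| <= E * (letters_poly predT - letters_poly A)`_k.
Proof.
move=> kn.
have split (f : {ffun 'I_k -> 'I_n} -> R) :
    \sum_(t : {ffun 'I_k -> 'I_n} | [forall l, predT (t l)]) f t -
    \sum_(t : {ffun 'I_k -> 'I_n} | [forall l, A (t l)]) f t =
    \sum_(t : {ffun 'I_k -> 'I_n} | ~~ [forall l, A (t l)]) f t.
  rewrite (bigID (fun t : {ffun 'I_k -> 'I_n} => [forall l, A (t l)])) /=.
  rewrite [X in X + _ - _](eq_bigl (fun t : {ffun 'I_k -> 'I_n} => [forall l, A (t l)])).
    rewrite addrAC subrr add0r; apply: eq_bigl => t; rewrite -[RHS]andTb; congr (_ && _).
    exact/forallP.
  by move=> t; rewrite -[RHS]andTb; congr (_ && _); exact/forallP.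
rewrite /tuple_sum -mulrBr split.
apply: le_trans (norm_sum_le (fun k t => ~~ [forall l, A (t l)]) kn) _.
have k0 : k`!%:R != 0 :> R by rewrite pnatr_eq0 -lt0n fact_gt0.
rewrite -split !sum_letters // coefB.
by rewrite le_eqVlt; apply/orP; left; apply/eqP; field.
Qed.

Lemma letter_poly_ge0 a k : 0 <= (letter_poly a)`_k.
Proof.
rewrite coef_poly; case: ifP => _ //.
by rewrite mulr_ge0 ?exprn_ge0 // ltW // stirling_ratio_gt0.
Qed.

Lemma letter_poly0 a : (letter_poly a)`_0 = 1.
Proof.
by rewrite coef_poly /= expr0 mul1r /st /stirling_ratio fact0 !expr0 invr1 !mulr1.
Qed.

Lemma letters_poly_ge0 A k : 0 <= (letters_poly A)`_k.
Proof. by apply: coef_prod_ge0; exact: letter_poly_ge0. Qed.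

(** The difference is the product over [A] times the product over the complement minus 1, and the
    latter product has constant term 1. *)
Lemma letters_poly_diff_ge0 A k : 0 <= (letters_poly predT - letters_poly A)`_k.
Proof.
have -> : letters_poly predT = letters_poly A * letters_poly (predC A).
  by rewrite /letters_poly (bigID A).
rewrite -[X in _ - X]mulr1 -mulrBr; apply: coefM_ge0 => {k} [|[|k]].
- exact: letters_poly_ge0.
- rewrite coefB coef1 coef0_prod big1 ?subrr // => a _; exact: letter_poly0.
by rewrite coefB coef1 subr0 letters_poly_ge0.
Qed.

Lemma sum_coef_le (p : {poly R}) m (r : R) : 0 <= r -> (forall k, 0 <= p`_k) ->
  \sum_(k < m) p`_k * r ^+ k <= p.[r].
Proof.
move=> r0 pn.
have p0 k : 0 <= p`_k * r ^+ k by rewrite mulr_ge0 ?exprn_ge0.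
rewrite (horner_coef_wide _ (leq_maxr m (size p))).
rewrite (big_ord_widen _ (fun k => p`_k * r ^+ k) (leq_maxl m (size p))) big_mkcond /=.
by apply: ler_sum => k _; case: ifP.
Qed.

(** From [stirling_ratio m <= e m] and the series of [m y^m]. Since the excess over 1 is linear in
    [|ka a|], products over letters are controlled by the sum of the [|ka a|] and not by the number
    of letters. *)
Lemma letter_poly_horner r a : 0 <= r -> r * `|ka a| <= q ->
  (letter_poly a).[r] <= 1 + expR 1 / (1 - q) ^+ 2 * (r * `|ka a|).
Proof.
move=> r0 rq; set y := r * `|ka a|.
have y0 : 0 <= y by rewrite mulr_ge0.
have d0 : 0 < 1 - q by rewrite subr_gt0.
rewrite horner_poly.
rewrite (eq_bigr (fun m : 'I_n.+1 => y ^+ m * st m)) => [|m _]; last first.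
  by rewrite /y exprMn; ring.
rewrite big_ord_recl /= expr0 mul1r /st {1}/stirling_ratio fact0 !expr0 invr1 !mulr1 lerD2l.
apply: le_trans (_ : expR 1 * (y / (1 - y) ^+ 2) <= _); last first.
  rewrite -mulrA ler_wpM2l ?expR_ge0 // mulrC ler_wpM2r // lef_pV2 ?posrE ?exprn_gt0 //.
    by rewrite lerXn2r ?nnegrE ?(ltW d0) // ?lerD2l ?lerN2 // subr_ge0 (le_trans rq) // ltW.
  by rewrite subr_gt0 (le_lt_trans rq).
apply: le_trans (ler_wpM2l (expR_ge0 1) (sum_m_exp_le n y0 (le_lt_trans rq q1))).
rewrite big_ord_recl mul0r add0r mulr_sumr; apply: ler_sum => m _.
rewrite [leLHS]mulrC mulrA ler_wpM2r ?exprn_ge0 //; exact: stirling_ratio_le.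
Qed.

Lemma letters_poly_horner r (A : pred 'I_n) : 0 <= r -> (forall a, r * `|ka a| <= q) ->
  (letters_poly A).[r] <= expR (expR 1 / (1 - q) ^+ 2 * r * \sum_(a | A a) `|ka a|).
Proof.
move=> r0 rq; rewrite horner_prod mulr_sumr expR_sum.
have d0 : 0 < 1 - q by rewrite subr_gt0.
apply: ler_prod => a _; apply/andP; split.
  have := sum_coef_le 0 r0 (letter_poly_ge0 a); by rewrite big_ord0.
apply: le_trans (letter_poly_horner r0 (rq a)) _.
by rewrite [X in 1 + X]mulrA; exact: expR_ge1Dx.
Qed.

(** Evaluating the majorant at [r > 1] instead of 1 gains the factor [r ^- K] on the coefficients of
    degree at least [K]. *)
Lemma sum_tuple_sum_tail A K r : 1 < r -> (forall a, r * `|ka a| <= q) ->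
  \sum_(k < n.+1 | (K <= k)%N) `|tuple_sum A k| <=
  E * r ^- K * expR (expR 1 / (1 - q) ^+ 2 * r * \sum_(a | A a) `|ka a|).
Proof.
move=> r1 rq; have r0 : 0 < r by apply: lt_trans r1.
rewrite -mulrA [leRHS]mulrC; apply: le_trans (_ : (r ^- K * (letters_poly A).[r]) * E <= _); last first.
  rewrite ler_wpM2r // ler_wpM2l ?invr_ge0 ?exprn_ge0 ?(ltW r0) //.
  exact: (letters_poly_horner A (ltW r0) rq).
apply: le_trans (_ : (r ^- K * \sum_(k < n.+1) (letters_poly A)`_k * r ^+ k) * E <= _).
  rewrite mulr_sumr mulr_suml big_mkcond /=; apply: ler_sum => k _.
  have pk := letters_poly_ge0 A k.
  have rX m : 0 <= r ^+ m by rewrite exprn_ge0 // ltW.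
  case: ifP => Kk; last by rewrite mulr_ge0 // mulr_ge0 ?invr_ge0 // mulr_ge0.
  apply: le_trans (tuple_sum_le _ _) _; first by rewrite -ltnS.
  rewrite mulrC ler_wpM2r // mulrCA ler_peMr // -(subnK Kk) exprD mulrCA mulVf ?mulr1.
    by rewrite exprn_ege1 // ltW.
  by rewrite expf_neq0 // gt_eqF.
rewrite ler_wpM2r // ler_wpM2l ?invr_ge0 ?exprn_ge0 ?(ltW r0) //.
by apply: sum_coef_le; [exact: ltW|exact: letters_poly_ge0].
Qed.

(** The value at 1 of the difference of the two majorants, factored as in [letters_poly_diff_ge0];
    it is small when the letters outside [A] have a small sum of [|ka a|]. *)
Lemma sum_tuple_sum_diff (A : pred 'I_n) : (forall a, `|ka a| <= q) ->
  let cq := expR 1 / (1 - q) ^+ 2 in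
  `|\sum_(k < n.+1) tuple_sum predT k - \sum_(k < n.+1) tuple_sum A k| <=
  E * expR (cq * \sum_a `|ka a|) * (expR (cq * \sum_(a | ~~ A a) `|ka a|) - 1).
Proof.
move=> kq /=; set cq := expR 1 / (1 - q) ^+ 2; rewrite -sumrB; apply: le_trans (ler_norm_sum _ _ _) _.
have kq1 a : 1 * `|ka a| <= q by rewrite mul1r.
apply: le_trans (_ : E * (letters_poly predT - letters_poly A).[1] <= _).
  apply: le_trans (ler_wpM2l E_ge0 (sum_coef_le n.+1 ler01 (letters_poly_diff_ge0 A))).
  rewrite mulr_sumr; apply: ler_sum => k _; rewrite expr1n mulr1.
  by apply: tuple_sum_diff; rewrite -ltnS.
rewrite -mulrA ler_wpM2l //.
have -> : letters_poly predT = letters_poly A * letters_poly (predC A).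
  by rewrite /letters_poly (bigID A).
rewrite hornerD hornerN hornerM -[X in _ - X]mulr1 -mulrBr.
have h1 := letters_poly_horner A ler01 kq1.
have h2 := letters_poly_horner (predC A) ler01 kq1.
have g0 : 0 <= (letters_poly A).[1].
  by have := sum_coef_le 0 ler01 (letters_poly_ge0 A); rewrite big_ord0.
have g1 : 1 <= (letters_poly (predC A)).[1].
  have := sum_coef_le 1 ler01 (letters_poly_ge0 (predC A)).
  rewrite big_ord_recl big_ord0 addr0 expr0 mulr1 coef0_prod big1 // => a _.
  exact: letter_poly0.
apply: ler_pM => //; first by rewrite subr_ge0.
  apply: le_trans h1 _; rewrite mulr1 ler_expR ler_wpM2l ?divr_ge0 ?expR_ge0 ?exprn_ge0 ?subr_ge0 ?(ltW q1) //.
  by rewrite [leRHS](bigID A) /= lerDl sumr_ge0.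
by rewrite lerD2r; move: h2; rewrite mulr1.
Qed.

End TupleSums.

Local Open Scope classical_set_scope.
Local Open Scope ring_scope.

(** * Limits of finite sums and products *)

Lemma cvg_sumr (R : realType) T (F : set_system T) {FF : Filter F} I (s : seq I)
    (P : pred I) (f : I -> T -> R) (l : I -> R) : (forall i, f i x @[x --> F] --> l i) ->
  \sum_(i <- s | P i) f i x @[x --> F] --> \sum_(i <- s | P i) l i.
Proof.
move=> fl; elim: s => [|i s IH].
  by rewrite big_nil; under eq_fun do rewrite big_nil; exact: cvg_cst.
rewrite big_cons; under eq_fun do rewrite big_cons.
by case: (P i) => //; apply: cvgD.
Qed.

Lemma cvg_near_eq (R : realType) T (F : set_system T) {FF : Filter F} (f g : T -> R)
    (l : R) : (\forall x \near F, f x = g x) ->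
  f x @[x --> F] --> l -> g x @[x --> F] --> l.
Proof. by move=> fg; apply: cvg_trans; apply: near_eq_cvg. Qed.

Lemma cvg_prodr (R : realType) T (F : set_system T) {FF : Filter F} I (s : seq I)
    (P : pred I) (f : I -> T -> R) (l : I -> R) : (forall i, f i x @[x --> F] --> l i) ->
  \prod_(i <- s | P i) f i x @[x --> F] --> \prod_(i <- s | P i) l i.
Proof.
move=> fl; elim: s => [|i s IH].
  by rewrite big_nil; under eq_fun do rewrite big_nil; exact: cvg_cst.
rewrite big_cons; under eq_fun do rewrite big_cons.
by case: (P i) => //; apply: cvgM.
Qed.

Lemma continuous_sumr (R : realType) (T : topologicalType) I (s : seq I) (P : pred I)
    (f : I -> T -> R) : (forall i, continuous (f i)) ->
  continuous (fun x => \sum_(i <- s | P i) f i x).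
Proof. by move=> fc x; apply: cvg_sumr => i; exact: fc. Qed.

Lemma continuousM_fun (R : realType) (T : topologicalType) (f g : T -> R) :
  continuous f -> continuous g -> continuous (fun x => f x * g x).
Proof. by move=> fc gc x; apply: cvgM; [exact: fc|exact: gc]. Qed.

(** * Eigenvectors of symmetric matrices *)

Section SymmetricEigenbasis.
Variables (R : realType) (n : nat) (A : 'I_n -> 'I_n -> R).
Hypothesis A_sym : forall i j, A i j = A j i.

Let dot (x y : 'I_n -> R) := \sum_j x j * y j.
Let app (x : 'I_n -> R) := fun i => \sum_j A i j * x j.
Let quad x := dot x (app x).

Let dotC x y : dot x y = dot y x.
Proof. by apply: eq_bigr => j _; rewrite mulrC. Qed.

Let dot_app x y : dot x (app y) = dot (app x) y.
Proof.
rewrite /dot /app; under eq_bigr => i _ do rewrite mulr_sumr.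
under [RHS]eq_bigr => i _ do rewrite mulr_suml.
rewrite exchange_big; apply: eq_bigr => j _; apply: eq_bigr => i _ /=.
by rewrite A_sym; ring.
Qed.

Let dotDr x y z c : dot x (fun j => y j + c * z j) = dot x y + c * dot x z.
Proof. by rewrite /dot mulr_sumr -big_split; apply: eq_bigr => j _ /=; ring. Qed.

Let dotDl x y z c : dot (fun j => y j + c * z j) x = dot y x + c * dot z x.
Proof. by rewrite dotC dotDr !(dotC x). Qed.

Let app_lin y z c : app (fun j => y j + c * z j) = fun j => app y j + c * app z j.
Proof.
apply/funext => i; rewrite /app mulr_sumr -big_split.
by apply: eq_bigr => j _ /=; ring.
Qed.

Let dot_ge0 x : 0 <= dot x x.
Proof. by apply: sumr_ge0 => j _; rewrite -expr2 sqr_ge0. Qed.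

Let dot_eq0 x : dot x x = 0 -> forall j, x j = 0.
Proof.
move=> /eqP; rewrite psumr_eq0 => [/allP h j|j _]; last by rewrite -expr2 sqr_ge0.
by apply/eqP; have := h j (mem_index_enum j); rewrite mulf_eq0 orbb.
Qed.

Let dotZ c x y : dot (fun j => c * x j) y = c * dot x y.
Proof. by rewrite /dot mulr_sumr; apply: eq_bigr => j _; rewrite mulrA. Qed.

Let exists_orth k (v : nat -> 'I_n -> R) : (k < n)%N ->
  exists x, dot x x = 1 /\ forall a, (a < k)%N -> dot (v a) x = 0.
Proof.
move=> kn; pose V : 'M[R]_(n, k) := \matrix_(i, j) v j i.
have : kermx V != 0.
  rewrite -mxrank_eq0 mxrank_ker -lt0n subn_gt0.
  exact: leq_ltn_trans (rank_leq_col V) kn.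
rewrite -nz_row_eq0; set w := nz_row _ => w0.
have wV : w *m V = 0 by apply/sub_kermxP/nz_row_sub.
pose y i := w 0 i.
have y0 : dot y y != 0.
  apply: contraNneq w0 => /dot_eq0 h; apply/eqP/matrixP => i j.
  by rewrite ord1 mxE; exact: h.
have yp : 0 < dot y y by rewrite lt_neqAle eq_sym y0 dot_ge0.
exists (fun j => (Num.sqrt (dot y y))^-1 * y j); split.
  rewrite dotZ dotC dotZ mulrA -invfM -expr2 sqr_sqrtr ?dot_ge0 //.
  by rewrite mulVf.
move=> a ak; rewrite dotC dotZ dotC.
have := congr1 (fun M : matrix R 1 k => M ord0 (Ordinal ak)) wV.
rewrite !mxE => h; have -> : dot (v a) y = 0; last by rewrite mulr0.
by rewrite -[RHS]h; apply: eq_bigr => j _; rewrite !mxE mulrC.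
Qed.

(* A maximiser x of the quadratic form on the unit sphere of an invariant
   subspace is an eigenvector: the form m |y|^2 - <y, A y> is nonnegative
   there (m being the maximum) and vanishes at x, so x is a critical point. *)
Let maximiser_eigen (W : ('I_n -> R) -> Prop) s m x : s ^+ 2 = 1 -> W x -> W (app x) ->
  (forall y z c, W y -> W z -> W (fun j => y j + c * z j)) ->
  (forall y, W y -> s * quad y <= m * dot y y) ->
  dot x x = 1 -> s * quad x = m -> forall i, app x i = quad x * x i.
Proof.
move=> s2 Wx WAx Wlin Wm x1 xm.
pose z := fun j => app x j + (- quad x) * x j.
have Wz : W z by exact: Wlin.
have zx : dot z x = 0.
  by rewrite /z dotDl x1 mulr1 -dot_app subrr.
pose d := dot z z.
have dE : d = dot (app x) z.
  by rewrite /d {1}/z dotDl (dotC x) zx mulr0 addr0.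
have z_def i : z i = app x i - quad x * x i by rewrite /z mulNr.
clearbody z.
have key c : 0 <= - (2 * c * d) + c ^+ 2 * (m * d - s * quad z).
  have := Wm _ (Wlin _ _ (s * c) Wx Wz); rewrite -subr_ge0; congr (0 <= _).
  rewrite /quad app_lin !(dotDl, dotDr) x1 (dotC x z) zx -/(quad x).
  rewrite -/(quad z) -/d (dot_app x z) -dE (dotC z (app x)) -dE -xm.
  transitivity (- (2 * s ^+ 2 * c * d) + s ^+ 2 * c ^+ 2 * (s * quad x * d - s * quad z)).
    by ring.
  by rewrite s2 mulr1 mul1r.
have d0 : d = 0.
  apply/eqP; rewrite eq_le dot_ge0 andbT leNgt; apply/negP => dp.
  (* Any positive bound on the coefficient of [c ^+ 2] in [key] would do: at [c = d / e] the
     quadratic term is at most half of the linear one, and the sum is negative. *)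
  pose e := `|m * d - s * quad z| + 1.
  have ep : 0 < e by rewrite ltr_wpDl.
  have := key (d / e).
  have le1 : m * d - s * quad z <= e by rewrite /e (le_trans (ler_norm _)) // lerDl.
  have : (d / e) ^+ 2 * (m * d - s * quad z) <= (d / e) ^+ 2 * e by rewrite ler_wpM2l // sqr_ge0.
  have -> : (d / e) ^+ 2 * e = d / e * d by field; rewrite gt_eqF.
  have : 0 < d / e * d by rewrite mulr_gt0 // divr_gt0.
  set X := d / e * d; have -> : 2 * (d / e) * d = 2 * X by rewrite /X; ring.
  by set Y := _ * (_ - _); lra.
by move=> i; have := dot_eq0 d0 i; rewrite z_def => /eqP; rewrite subr_eq0 => /eqP.
Qed.

(** The modulus of the form is maximised on the compact unit sphere of the complement, so that
    eigenvalues appear in decreasing order of modulus, whatever their sign. *)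
Let exists_max k (v : nat -> 'I_n -> R) : (k < n)%N ->
  exists x, [/\ dot x x = 1, forall a, (a < k)%N -> dot (v a) x = 0 &
    forall y, (forall a, (a < k)%N -> dot (v a) y = 0) ->
      `|quad y| <= `|quad x| * dot y y].
Proof.
move=> kn; pose f (w : 'rV[R]_n) : 'I_n -> R := fun j => w 0 j.
have fcont j : continuous (fun w : 'rV[R]_n => f w j).
  by move=> w; exact: coord_continuous.
have dcont c : continuous (fun w : 'rV[R]_n => dot c (f w)).
  by apply: continuous_sumr => j; apply: continuousM_fun; [exact: cst_continuous|exact: fcont].
have ncont : continuous (fun w : 'rV[R]_n => dot (f w) (f w)).
  by apply: continuous_sumr => j; apply: continuousM_fun; exact: fcont.
have qcont : continuous (fun w : 'rV[R]_n => `|quad (f w)|).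
  have qc : continuous (fun w : 'rV[R]_n => quad (f w)).
    apply: continuous_sumr => j; apply: continuousM_fun; first exact: fcont.
    by apply: continuous_sumr => i; apply: continuousM_fun; [exact: cst_continuous|exact: fcont].
  by move=> w; apply: (continuous_comp (qc w)); exact: norm_continuous.
pose S := [set w : 'rV[R]_n | dot (f w) (f w) = 1 /\
   forall a, (a < k)%N -> dot (v a) (f w) = 0].
have Sc : compact S.
  apply: (@subclosed_compact _ _ [set w : 'rV[R]_n | forall i, w ord0 i \in `[-1, 1]]).
  - have -> : S = ((fun w : 'rV[R]_n => dot (f w) (f w)) @^-1` [set 1]) `&`
        \bigcap_(a in [set a | (a < k)%N]) ((fun w : 'rV[R]_n => dot (v a) (f w)) @^-1` [set 0]).
      by apply/seteqP; split => w [].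
    apply: closedI; last apply: closed_bigI => a _.
      by apply: preimage_closed; [move=> w _; exact: ncont|exact: closed_eq].
    by apply: preimage_closed; [move=> w _; exact: dcont|exact: closed_eq].
  - apply: (@rV_compact _ n (fun=> `[(-1 : R), 1]%classic)) => _.
    exact: segment_compact.
  move=> w [w1 _] i; rewrite in_itv /= -ler_norml -(@ler_pXn2r _ 2) ?nnegrE //.
  rewrite expr1n real_normK ?num_real // -w1 /dot (bigD1 i) //= -expr2 lerDl.
  by apply: sumr_ge0 => j _; rewrite -expr2 sqr_ge0.
have S0 : S !=set0.
  have [x [x1 xo]] := exists_orth v kn; exists (\row_j x j).
  have fx : f (\row_j x j) = x by apply/funext => j; rewrite /f mxE.
  by rewrite /S /= fx.
have [w wS wmax] := @EVT_max_rV R n _ S S0 Sc (continuous_subspaceT qcont).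
move: wS; rewrite inE => -[w1 wo].
exists (f w); split => // y yo.
have [y0|y0] := eqVneq (dot y y) 0.
  have -> : quad y = 0 by rewrite /quad /dot big1 // => j _; rewrite (dot_eq0 y0) mul0r.
  by rewrite normr0 y0 mulr0.
have yp : 0 < dot y y by rewrite lt_neqAle eq_sym y0 dot_ge0.
pose s := Num.sqrt (dot y y); have sp : 0 < s by rewrite sqrtr_gt0.
have s2 : s ^+ 2 = dot y y by rewrite sqr_sqrtr // dot_ge0.
have fE : f (\row_j (s^-1 * y j)) = fun j => s^-1 * y j.
  by apply/funext => j; rewrite /f mxE.
have : \row_j (s^-1 * y j) \in S.
  rewrite inE /S /= fE; split.
    by rewrite dotZ dotC dotZ mulrA -invfM -expr2 -/s s2 mulVf.
  by move=> a ak; rewrite dotC dotZ dotC yo // mulr0.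
move=> /wmax; rewrite fE.
have -> : quad (fun j => s^-1 * y j) = quad y / dot y y.
  rewrite /quad dotZ -s2.
  have -> : app (fun j => s^-1 * y j) = fun j => s^-1 * app y j.
    apply/funext => i; rewrite /app mulr_sumr; apply: eq_bigr => j _; ring.
  rewrite dotC dotZ dotC; field; by rewrite gt_eqF.
by rewrite normrM normfV (gtr0_norm yp) ler_pdivrMr.
Qed.

(** The last clause is the invariant that keeps the eigenvalues sorted: on the complement the form
    is bounded by every eigenvalue already found. *)
Let partial_basis k : (k <= n)%N -> exists (v : nat -> 'I_n -> R) (ka : nat -> R),
  [/\ forall a b, (a < k)%N -> (b < k)%N -> dot (v a) (v b) = (a == b)%:R,
      forall a i, (a < k)%N -> app (v a) i = ka a * v a i,
      forall a b, (a <= b)%N -> (b < k)%N -> `|ka b| <= `|ka a| &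
      forall a y, (a < k)%N -> (forall b, (b < k)%N -> dot (v b) y = 0) ->
        `|quad y| <= `|ka a| * dot y y].
Proof.
elim: k => [|k IH] kn; first by exists (fun _ _ => 0), (fun=> 0).
have [v [ka [vo ve ks kq]]] := IH (ltnW kn).
have [x [x1 xo xm]] := exists_max v kn.
pose W y := forall a, (a < k)%N -> dot (v a) y = 0.
have WA y : W y -> W (app y).
  move=> Wy a ak; rewrite dot_app.
  have -> : app (v a) = fun i => ka a * v a i by apply/funext => i; exact: ve.
  by rewrite dotZ Wy // mulr0.
have xe i : app x i = quad x * x i.
  pose s : R := if 0 <= quad x then 1 else -1.
  have sE : s * quad x = `|quad x|.
    rewrite /s; case: ifPn => [h|]; first by rewrite mul1r ger0_norm.
    by rewrite -ltNge => h; rewrite mulN1r ltr0_norm.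
  have s2 : s ^+ 2 = 1 by rewrite /s; case: ifP => _; rewrite ?sqrrN expr1n.
  apply: (@maximiser_eigen W s `|quad x|) => //; first exact: WA.
    by move=> y z c Wy Wz a ak; rewrite dotDr Wy // Wz // mulr0 addr0.
  move=> y Wy; apply: le_trans (xm y Wy); apply: le_trans (ler_norm _) _.
  rewrite normrM; suff -> : `|s| = 1 by rewrite mul1r.
  by rewrite /s; case: ifP => _; rewrite ?normrN normr1.
exists (fun a => if a == k then x else v a), (fun a => if a == k then quad x else ka a).
split.
- have lt1 a : (a < k.+1)%N -> a = k \/ (a < k)%N.
    by rewrite ltnS leq_eqVlt => /orP[/eqP|]; [left|right].
  move=> a b /lt1[->|ak] /lt1[->|bk].
  + by rewrite !eqxx.
  + by rewrite eqxx (gtn_eqF bk) (ltn_eqF bk) dotC xo.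
  + by rewrite eqxx (ltn_eqF ak) xo.
  + by rewrite (ltn_eqF ak) (ltn_eqF bk) vo.
- move=> a i; rewrite ltnS leq_eqVlt => /orP[/eqP ->|ak]; first by rewrite eqxx xe.
  by rewrite (ltn_eqF ak) ve.
- move=> a b ab; rewrite ltnS leq_eqVlt => /orP[/eqP bk|bk].
    rewrite bk eqxx; case: eqP => // /eqP ak.
    have := kq a x; rewrite x1 mulr1; apply => //.
    by rewrite ltn_neqAle ak -bk.
  by rewrite (ltn_eqF bk) (ltn_eqF (leq_ltn_trans ab bk)) ks.
move=> a y ak Wy.
have Wky : W y.
  by move=> b bk; have := Wy b; rewrite (ltn_eqF bk); apply; exact: ltnW.
move: ak; rewrite ltnS leq_eqVlt => /orP[/eqP ->|ak]; first by rewrite eqxx; exact: xm.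
by rewrite (ltn_eqF ak); exact: kq.
Qed.

Lemma symmetric_eigenbasis : exists (v : 'I_n -> 'I_n -> R) (ka : 'I_n -> R),
  [/\ forall a b, \sum_j v a j * v b j = (a == b)%:R,
      forall a i, \sum_j A i j * v a j = ka a * v a i &
      forall a b : 'I_n, (a <= b)%N -> `|ka b| <= `|ka a|].
Proof.
have [v [ka [vo ve ks _]]] := partial_basis (leqnn n).
exists (fun a => v a), (fun a => ka a); split => [a b|a i|a b ab].
- exact: vo.
- exact: ve.
- exact: ks.
Qed.

End SymmetricEigenbasis.

Section Orthonormal.
Variables (R : comUnitRingType) (n : nat) (v : 'I_n -> 'I_n -> R).
Hypothesis v_orth : forall a b, \sum_j v a j * v b j = (a == b)%:R.

Lemma orthonormal_dual i j : \sum_a v a i * v a j = (i == j)%:R.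
Proof.
pose V : 'M[R]_n := \matrix_(a, j) v a j.
have : V *m V^T = 1%:M.
  apply/matrixP => a b; rewrite !mxE -v_orth; apply: eq_bigr => l _.
  by rewrite !mxE.
move=> /mulmx1C /matrixP/(_ i j); rewrite !mxE => <-.
by apply: eq_bigr => a _; rewrite !mxE.
Qed.

Lemma orthonormal_expand (x : 'I_n -> R) i :
  x i = \sum_a (\sum_j v a j * x j) * v a i.
Proof.
under eq_bigr => a _ do rewrite mulr_suml.
rewrite exchange_big /= (bigD1 i) //=.
rewrite [X in _ + X]big1 ?addr0 => [|j ji].
  rewrite (eq_bigr (fun a => x i * (v a i * v a i))) => [|a _]; last by ring.
  by rewrite -mulr_sumr orthonormal_dual eqxx mulr1.
rewrite (eq_bigr (fun a => x j * (v a j * v a i))) => [|a _]; last by ring.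
by rewrite -mulr_sumr orthonormal_dual (negPf ji) mulr0.
Qed.

Lemma parseval (x y : 'I_n -> R) :
  \sum_a (\sum_j v a j * x j) * (\sum_j v a j * y j) = \sum_j x j * y j.
Proof.
under [RHS]eq_bigr => i _ do rewrite (orthonormal_expand x) mulr_suml.
rewrite exchange_big; apply: eq_bigr => a _ /=; rewrite mulr_sumr.
by apply: eq_bigr => i _; rewrite mulrA.
Qed.

Lemma spectral_decomposition (A : 'I_n -> 'I_n -> R) (ka : 'I_n -> R) :
  (forall a i, \sum_j A i j * v a j = ka a * v a i) ->
  forall i j, A i j = \sum_a ka a * v a i * v a j.
Proof.
move=> ve i j; rewrite [LHS](orthonormal_expand (A i)); apply: eq_bigr => a _.
by rewrite -ve; congr (_ * _); apply: eq_bigr => l _; rewrite mulrC.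
Qed.

End Orthonormal.

(** * Tails of eigenvalue sums *)

Lemma cauchy_schwarz_sum (R : realFieldType) (I : finType) (x y : I -> R) :
  (\sum_i x i * y i) ^+ 2 <= (\sum_i x i ^+ 2) * (\sum_i y i ^+ 2).
Proof.
have : 0 <= \sum_i \sum_j (x i * y j - x j * y i) ^+ 2.
  by apply: sumr_ge0 => i _; apply: sumr_ge0 => j _; exact: sqr_ge0.
have -> : \sum_i \sum_j (x i * y j - x j * y i) ^+ 2 =
    2 * ((\sum_i x i ^+ 2) * (\sum_i y i ^+ 2)) - 2 * (\sum_i x i * y i) ^+ 2.
  transitivity (\sum_i \sum_j (x i ^+ 2 * y j ^+ 2 + y i ^+ 2 * x j ^+ 2
      - 2 * ((x i * y i) * (x j * y j)))).
    by apply: eq_bigr => i _; apply: eq_bigr => j _; ring.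
  under eq_bigr => i _ do rewrite sumrB big_split /= -!mulr_sumr.
  rewrite sumrB big_split /= -!mulr_sumr -!mulr_suml expr2.
  by ring.
lra.
Qed.

Lemma sum_norm_mul_le (R : rcfType) (I : finType) (x y : I -> R) (a b : R) :
  0 <= a -> 0 <= b -> \sum_i x i ^+ 2 <= a ^+ 2 -> \sum_i y i ^+ 2 <= b ^+ 2 ->
  \sum_i `|x i * y i| <= a * b.
Proof.
move=> a0 b0 xa yb.
rewrite -(@ler_pXn2r _ 2) ?nnegrE ?mulr_ge0 //; last by apply: sumr_ge0.
under eq_bigr do rewrite normrM.
apply: le_trans (cauchy_schwarz_sum _ _) _; rewrite exprMn; apply: ler_pM.
- by apply: sumr_ge0 => i _; exact: sqr_ge0.
- by apply: sumr_ge0 => i _; exact: sqr_ge0.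
- by under eq_bigr do rewrite real_normK ?num_real //.
- by under eq_bigr do rewrite real_normK ?num_real //.
Qed.

Section TraceTail.
Variables (R : realType) (n b : nat) (K : 'I_n -> 'I_n -> R) (C ep : R).
Variables (v : 'I_n -> 'I_n -> R) (ka : 'I_n -> R) (A : pred 'I_n).
Hypotheses (b_gt0 : (0 < b)%N) (C_ge0 : 0 <= C) (ep_ge0 : 0 <= ep).
Hypothesis v_orth : forall a c, \sum_j v a j * v c j = (a == c)%:R.
Hypothesis v_eig : forall a i, \sum_j K i j * v a j = ka a * v a i.
Hypothesis K_lip : forall i i' j : 'I_n, i' = i.+1 :> nat ->
  `|K i' j - K i j| <= C / n%:R ^+ 2.
Hypothesis A_ep : forall a, A a -> `|ka a| <= ep.

(* [P] averages over blocks of [b] consecutive indices. It has trace at most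
   [n / b + 1], which bounds the first term of [trace_tail]; as it fixes
   constants, [1 - P] only sees the increments of [K]. *)
Let q (i : 'I_n) : nat := (i %/ b)%N.
Let blk (i : 'I_n) : pred 'I_n := fun j => q j == q i.
Let cnt (i : 'I_n) : R := \sum_(j | blk i j) 1.
Let P (x : 'I_n -> R) i : R := (cnt i)^-1 * \sum_(j | blk i j) x j.

Let cnt_gt0 i : 0 < cnt i.
Proof. by rewrite /cnt (bigD1 i) ?/blk ?eqxx //= ltr_pwDl // sumr_ge0. Qed.

Let cnt_blk i j : blk i j -> cnt j = cnt i.
Proof. by rewrite /blk /cnt => /eqP h; apply: eq_bigl => l; rewrite /blk h. Qed.

Let P_sym x y : \sum_i P x i * y i = \sum_i x i * P y i.
Proof.
rewrite /P; under eq_bigr => i _ do rewrite mulr_sumr mulr_suml.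
under [RHS]eq_bigr => i _ do rewrite !mulr_sumr.
rewrite (exchange_big_dep predT) //=; apply: eq_bigr => i _.
apply: eq_big => [j|j bij]; first by rewrite /blk eq_sym.
by rewrite (cnt_blk bij); ring.
Qed.

Let P_idem x i : P (P x) i = P x i.
Proof.
rewrite {1}/P (eq_bigr (fun=> P x i)) => [|j bij]; last first.
  by rewrite /P (cnt_blk bij); congr (_ * _); apply: eq_bigl => l; move: bij; rewrite /blk => /eqP ->.
rewrite -[X in _ * X](_ : P x i * cnt i = _); first by field; rewrite gt_eqF.
by rewrite /cnt mulr_sumr; apply: eq_bigr => j _; rewrite mulr1.
Qed.

Let P_ge0 x : 0 <= \sum_i P x i * x i.
Proof.
have -> : \sum_i P x i * x i = \sum_i P x i ^+ 2.
  by under [RHS]eq_bigr => i _ do rewrite expr2; rewrite [RHS]P_sym;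
     rewrite [LHS]P_sym; apply: eq_bigr => i _; rewrite P_idem.
by apply: sumr_ge0 => i _; exact: sqr_ge0.
Qed.

(** The trace in the basis [v] equals that in the standard basis, [\sum_i (cnt i)^-1], to which each
    nonempty block contributes 1. *)
Let trace_P : \sum_a \sum_i P (v a) i * v a i <= (n %/ b).+1%:R.
Proof.
have -> : \sum_a \sum_i P (v a) i * v a i = \sum_i (cnt i)^-1.
  rewrite exchange_big; apply: eq_bigr => i _ /=; rewrite /P.
  under eq_bigr => a _ do rewrite -mulrA mulr_suml.
  rewrite -mulr_sumr exchange_big /= (bigD1 i) ?/blk ?eqxx //=.
  rewrite orthonormal_dual // eqxx big1 ?addr0 ?mulr1 // => j /andP[_ ji].
  by rewrite orthonormal_dual // (negPf ji).
pose Q (i : 'I_n) : 'I_(n %/ b).+1 := inord (q i).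
have QE i : Q i = q i :> nat.
  by rewrite inordK // ltnS leq_div2r // ltnW.
rewrite (partition_big Q predT) //= -[leRHS]mulr1 -[X in X%:R * _]card_ord -sumr_const mulr1.
apply: ler_sum => l _.
case: (pickP (fun i => Q i == l)) => [i0 /eqP Qi0|h]; last by rewrite big_pred0.
have bl i : (Q i == l) = blk i0 i.
  by rewrite -Qi0 -(inj_eq val_inj) /= !QE.
rewrite (eq_bigl _ _ bl) (eq_bigr (fun=> (cnt i0)^-1 * 1)) => [|i /cnt_blk ->]; last by rewrite mulr1.
by rewrite -mulr_sumr mulVf ?gt_eqF.
Qed.

Let step (l : 'I_n) : 'I_n -> R := fun j => (l <= j)%N%:R.

Let card_blk l : cnt l <= b%:R.
Proof.
rewrite /cnt; have -> : \sum_(j | blk l j) 1 = (\sum_(j | blk l j) 1%N)%:R :> R.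
  by rewrite natr_sum.
rewrite ler_nat sum1_card -[leqRHS]card_ord.
pose f (i : 'I_n) : 'I_b := Ordinal (ltn_pmod i b_gt0).
rewrite -(@card_in_imset _ _ f (blk l)) ?max_card //.
move=> i j; rewrite -!topredE /= /blk /q => /eqP qi /eqP qj [] fij; apply: val_inj => /=.
by rewrite (divn_eq i b) (divn_eq j b) qi qj fij.
Qed.

(** A step is constant on every block except the one containing [l]; there it differs from its
    average by at most 1. *)
Let step_residual l : \sum_j (step l j - P (step l) j) ^+ 2 <= b%:R.
Proof.
apply: le_trans (card_blk l); rewrite [leRHS]big_mkcond; apply: ler_sum => i _.
have Pst0 : 0 <= P (step l) i by rewrite mulr_ge0 ?invr_ge0 ?(ltW (cnt_gt0 _)) // sumr_ge0.
have Pst1 : P (step l) i <= 1.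
  rewrite /P mulrC ler_pdivrMr // mul1r; apply: ler_sum => j _.
  by rewrite /step; case: (_ <= _)%N.
case: ifPn => [_|].
  have : 0 <= step l i <= 1 by rewrite /step; case: (_ <= _)%N; rewrite lexx ler01.
  move=> /andP[s0 s1]; rewrite -real_normK ?num_real // expr_le1 // ler_norml.
  by apply/andP; split; lra.
rewrite /blk => qil; suff -> : P (step l) i = step l i by rewrite subrr expr0n.
rewrite /P (eq_bigr (fun=> step l i * 1)) => [|j /eqP qji].
  by rewrite -mulr_sumr mulrCA mulVf ?mulr1 // gt_eqF.
rewrite mulr1 /step; congr (_%:R); congr nat_of_bool.
have hdiv (x y : 'I_n) : (x <= y)%N -> (q x <= q y)%N by move=> xy; exact: leq_div2r.
apply/idP/idP => h.
- rewrite leqNgt; apply/negP => /ltnW/hdiv; move: (hdiv _ _ h); rewrite qji => h1 h2.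
  by move: qil; rewrite eqn_leq h1 h2.
- rewrite leqNgt; apply/negP => /ltnW/hdiv; move: (hdiv _ _ h); rewrite qji => h1 h2.
  by move: qil; rewrite eqn_leq h1 h2.
Qed.

Let app a i := \sum_j K i j * v a j.
Let incr a (l : 'I_n) : R :=
  if [pick l' : 'I_n | l == l'.+1 :> nat] is Some l' then app a l - app a l' else 0.

Let incr_sq l : \sum_a incr a l ^+ 2 <= (C / n%:R ^+ 2 * Num.sqrt n%:R) ^+ 2.
Proof.
rewrite /incr; case: pickP => [l' /eqP ll'|_]; last first.
  by rewrite big1 ?sqr_ge0 // => a _; rewrite expr0n.
have -> : \sum_a (app a l - app a l') ^+ 2 = \sum_j (K l j - K l' j) ^+ 2.
  transitivity (\sum_j (K l j - K l' j) * (K l j - K l' j)); last first.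
    by apply: eq_bigr => j _; rewrite expr2.
  rewrite -(parseval v_orth (fun j => K l j - K l' j) (fun j => K l j - K l' j)).
  apply: eq_bigr => a _; rewrite -expr2; congr (_ ^+ 2).
  by rewrite /app -sumrB; apply: eq_bigr => j _; ring.
apply: le_trans (_ : \sum_(j < n) (C / n%:R ^+ 2) ^+ 2 <= _).
  apply: ler_sum => j _; rewrite -real_normK ?num_real //.
  by rewrite lerXn2r ?nnegrE ?K_lip // divr_ge0 // exprn_ge0 // ler0n.
by rewrite sumr_const card_ord [leRHS]exprMn sqr_sqrtr ?ler0n // mulr_natr.
Qed.

Let base a : R := if [pick l : 'I_n | l == 0 :> nat] is Some l then app a l else 0.

Let app_telescope a i : app a i = base a + \sum_l incr a l * step l i.
Proof.
suff h : forall m (mn : (m < n)%N), app a (Ordinal mn) =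
    base a + \sum_(l < n) incr a l * (l <= m)%N%:R.
  by rewrite /step -(h i (ltn_ord i)); congr (app a _); apply: val_inj.
elim=> [|m IH] mn.
  rewrite big1 ?addr0 => [|l _].
    rewrite /base; case: pickP => [l /eqP l0|/(_ (Ordinal mn))]; last by rewrite eqxx.
    by congr (app a _); apply: val_inj.
  rewrite /incr; case: pickP => [l' /eqP ->|]; first by rewrite mulr0.
  by rewrite mul0r.
have mn' := ltnW mn.
rewrite (bigD1 (Ordinal mn)) //= leqnn mulr1 {1}/incr.
case: pickP => [l' /eqP /= [ml]|/(_ (Ordinal mn'))]; last by rewrite eqxx.
have -> : l' = Ordinal mn' by apply: val_inj.
rewrite (IH mn') (bigD1 (Ordinal mn)) //= ltnn mulr0 add0r.
rewrite (eq_bigr (fun l : 'I_n => incr a l * (l <= m.+1)%N%:R)); first by ring.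
move=> l; rewrite -(inj_eq val_inj) /= => lm; congr (_ * _%:R); congr nat_of_bool.
by rewrite [in RHS]leq_eqVlt (negPf lm).
Qed.

(** Summation by parts: the constant [base a] drops out because [P] preserves sums, and the symmetry
    of [P] moves [1 - P] from [v a] onto the steps. *)
Let residual_pairing a : \sum_i (v a i - P (v a) i) * app a i =
  \sum_l incr a l * \sum_j v a j * (step l j - P (step l) j).
Proof.
under eq_bigr => i _ do rewrite app_telescope mulrDr.
have P1 i : P (fun=> 1) i = 1.
  by rewrite /P -/(cnt i) mulVf // gt_eqF.
have mean0 : \sum_i (v a i - P (v a) i) = 0.
  rewrite sumrB -[X in _ - X](eq_bigr _ (fun i _ => mulr1 (P (v a) i))) P_sym.
  rewrite -sumrB big1 // => i _; by rewrite P1 mulr1 subrr.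
rewrite big_split /= -mulr_suml mean0 mul0r add0r.
under eq_bigr => i _ do rewrite mulr_sumr.
rewrite exchange_big; apply: eq_bigr => l _ /=.
rewrite (eq_bigr (fun i => incr a l * ((v a i - P (v a) i) * step l i))) => [|i _]; last by ring.
rewrite -mulr_sumr; congr (_ * _).
transitivity (\sum_i (v a i * step l i - P (v a) i * step l i)).
  by apply: eq_bigr => i _; rewrite mulrBl.
by rewrite sumrB P_sym -sumrB; apply: eq_bigr => i _; rewrite mulrBr.
Qed.

(** Split [ka a], which is the value of the form of [K] at [v a], along [P] and [1 - P]. The first
    part is [ka a] times a nonnegative number, and these numbers sum to the trace of [P]. The second
    is a sum over [l]; for each [l], Cauchy-Schwarz over [a] bounds it by the square root of [b]
    times [C / n^(3/2)], and there are [n] values of [l]. *)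
Lemma trace_tail : \sum_(a | A a) `|ka a| <=
  ep * (n %/ b).+1%:R + C * Num.sqrt (b%:R / n%:R).
Proof.
have kaE a : ka a = ka a * \sum_i P (v a) i * v a i +
    \sum_i (v a i - P (v a) i) * app a i.
  rewrite mulr_sumr -big_split /= (eq_bigr (fun i => ka a * (v a i * v a i))).
    by rewrite -mulr_sumr v_orth eqxx mulr1.
  by move=> i _; rewrite /app v_eig; ring.
have bound a : A a -> `|ka a| <= ep * \sum_i P (v a) i * v a i +
    \sum_l `|(\sum_j v a j * (step l j - P (step l) j)) * incr a l|.
  move=> Aa; rewrite {1}kaE; apply: le_trans (ler_normD _ _) _; apply: lerD.
    by rewrite normrM (ger0_norm (P_ge0 _)) ler_wpM2r ?P_ge0 ?A_ep.
  rewrite residual_pairing; apply: le_trans (ler_norm_sum _ _ _) _.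
  by apply: ler_sum => l _; rewrite mulrC.
apply: le_trans (ler_sum _ bound) _.
rewrite big_split /= -mulr_sumr; apply: lerD.
  rewrite ler_wpM2l //; apply: le_trans trace_P.
  by rewrite big_mkcond; apply: ler_sum => a _; case: ifP => // _; exact: P_ge0.
rewrite exchange_big /=.
have [n0|n0] := posnP n.
  rewrite big1 ?mulr_ge0 ?sqrtr_ge0 // => l _.
  by exfalso; have := ltn_ord l; rewrite [X in (_ < X)%N]n0.
have n0' : 0 < n%:R :> R by rewrite ltr0n.
apply: le_trans (_ : \sum_(l < n) Num.sqrt b%:R * (C / n%:R ^+ 2 * Num.sqrt n%:R) <= _).
  apply: ler_sum => l _.
  apply: le_trans (_ : \sum_a `|(\sum_j v a j * (step l j - P (step l) j)) * incr a l| <= _).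
    by rewrite [leLHS]big_mkcond; apply: ler_sum => a _; case: ifP.
  apply: sum_norm_mul_le (incr_sq l); rewrite ?sqrtr_ge0 ?mulr_ge0 ?invr_ge0 ?exprn_ge0 ?ler0n //.
  rewrite sqr_sqrtr ?ler0n //.
  under eq_bigr do rewrite expr2.
  rewrite (parseval v_orth); under eq_bigr do rewrite -expr2.
  exact: step_residual.
rewrite sumr_const card_ord -[leLHS]mulr_natr sqrtrM ?ler0n // sqrtrV ?ler0n //.
have sn : Num.sqrt n%:R ^+ 2 = n%:R :> R by rewrite sqr_sqrtr ?ler0n.
have s0 : Num.sqrt n%:R != 0 :> R by rewrite gt_eqF // sqrtr_gt0.
move: (Num.sqrt n%:R) sn s0 => s sn s0.
by rewrite -sn le_eqVlt; apply/orP; left; apply/eqP; field.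
Qed.

End TraceTail.

(** * Riemann sums and smooth kernels *)

Definition lip01 (R : realType) (L : R) (f : R -> R) :=
  forall x y, 0 <= x <= 1 -> 0 <= y <= 1 -> `|f x - f y| <= L * `|x - y|.

Definition grid (R : realType) n (i : nat) : R := i.+1%:R / n%:R.

Definition int01 (R : realType) (f : R -> R) : R :=
  \int[@lebesgue_measure R]_(x in `[0, 1]) f x.

Section Lip.
Variable R : realType.
Implicit Types (f g : R -> R) (L : R).

Lemma grid01 n (i : 'I_n) : 0 <= grid R n i <= 1.
Proof.
have n0 : (0 < n)%N by rewrite (leq_ltn_trans _ (ltn_ord i)).
by rewrite /grid divr_ge0 ?ler0n //= ler_pdivrMr ?ltr0n // mul1r ler_nat.
Qed.

Lemma lip01_ge0 L f : lip01 L f -> 0 <= L.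
Proof.
move=> /(_ 0 1); rewrite !lexx !ler01 sub0r normrN normr1 mulr1 => /(_ isT isT).
by apply: le_trans.
Qed.

Lemma lip01_continuous L f : lip01 L f -> {within `[0, 1], continuous f}.
Proof.
move=> fL; apply/subspace_continuousP => x /= xI; apply/cvgrPdist_le => e e0.
have L1 : 0 < `|L| + 1 by rewrite ltr_wpDl.
rewrite near_withinE; near=> y => yI.
rewrite !in_itv /= in xI yI.
apply: le_trans (fL _ _ xI yI) _.
apply: le_trans (_ : (`|L| + 1) * `|x - y| <= e).
  by rewrite ler_wpM2r // (le_trans (ler_norm L)) // lerDl.
rewrite mulrC -ler_pdivlMr //; near: y.
apply: (@cvgr_dist_le _ _ _ (nbhs x) _ id x) => //; exact: divr_gt0.
Unshelve. all: end_near. Qed.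

Lemma lip01_continuous_at L f x : lip01 L f -> 0 < x < 1 -> {for x, continuous f}.
Proof.
move=> /lip01_continuous fc /andP[x0 x1].
have : {within `]0, 1[, continuous f}.
  apply: continuous_subspaceW fc; apply: subset_itv_oo_cc.
by rewrite continuous_open_subspace ?interval_open // => h; apply: h; rewrite inE /= in_itv /= x0.
Qed.

Lemma lip01_integrable L f : lip01 L f ->
  (@lebesgue_measure R).-integrable `[0, 1] (EFin \o f).
Proof.
by move=> /lip01_continuous fc; apply: continuous_compact_integrable => //; exact: segment_compact.
Qed.

(** On each cell the integral is [f c / n] for some [c] in the cell, by the mean value theorem for
    the primitive [F]. *)
Lemma riemann_sum_lip L f n : (0 < n)%N -> lip01 L f ->
  `|n%:R^-1 * (\sum_(i < n) f (grid R n i)) - int01 f| <= L / n%:R.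
Proof.
move=> n0 fL; have n0' : 0 < n%:R :> R by rewrite ltr0n.
pose F x : R := (\int[@lebesgue_measure R]_(t in `[0, x]) f t).
have Fc : {within `[0, 1], continuous F}.
  exact: (parameterized_integral_continuous ler01 (lip01_integrable fL)).
have Fd (x : R) : 0 < x < 1 -> is_derive x 1 F (f x).
  move=> x01; have /andP[x0 x1] := x01.
  have [] := @continuous_FTC1 R f (BLeft 0) x 1 x1 (lip01_integrable fL).
  - by rewrite lte_fin.
  - exact: lip01_continuous_at fL x01.
  by move=> dF <-; rewrite derive1E; exact: DeriveDef.
have F1 : F 1 = int01 f by [].
have F0 : F 0 = 0 by rewrite /F set_itv1 Rintegral_set1.
pose a i : R := i%:R / n%:R.
have aS i : a i.+1 - a i = n%:R^-1 by rewrite /a -natr1; field; rewrite gt_eqF.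
have a0 : a 0%N = 0 by rewrite /a mul0r.
have an : a n = 1 by rewrite /a divff // gt_eqF.
have a_ge0 i : 0 <= a i by rewrite /a divr_ge0.
have a_le1 i : (i <= n)%N -> a i <= 1 by move=> ?; rewrite /a ler_pdivrMr // mul1r ler_nat.
have tel : int01 f = \sum_(i < n) (F (a i.+1) - F (a i)).
  by rewrite -(big_mkord predT (fun i => F (a i.+1) - F (a i))) telescope_sumr // an a0 F1 F0 subr0.
rewrite tel mulr_sumr -sumrB; apply: le_trans (ler_norm_sum _ _ _) _.
have -> : L / n%:R = \sum_(i < n) L / n%:R ^+ 2.
  by rewrite sumr_const card_ord -mulr_natl; field; rewrite gt_eqF.
apply: ler_sum => i _.
have ai1 : a i.+1 <= 1 by exact: a_le1.
have ai : a i < a i.+1 by rewrite -subr_gt0 aS invr_gt0.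
have [||c] := @MVT R F f _ _ ai.
- move=> x; rewrite in_itv /= => /andP[x1 x2]; apply: Fd.
  by rewrite (le_lt_trans (a_ge0 i)) //= (lt_le_trans x2).
- apply: continuous_subspaceW Fc => x /=; rewrite !in_itv /= => /andP[x1 x2].
  by rewrite (le_trans (a_ge0 i)) //= (le_trans x2).
rewrite in_itv /= => /andP[c1 c2] ->; rewrite aS mulrC -mulrBl normrM.
rewrite (ger0_norm (_ : 0 <= n%:R^-1)) ?invr_ge0 ?ler0n //.
have -> : grid R n i = a i.+1 by [].
have L0 := lip01_ge0 fL.
have -> : L / n%:R ^+ 2 = L / n%:R / n%:R by field; rewrite gt_eqF.
rewrite ler_wpM2r ?invr_ge0 ?ler0n //.
apply: le_trans (fL _ _ _ _) _.
- by rewrite a_ge0 ai1.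
- by rewrite (le_trans (a_ge0 i) (ltW c1)) (le_trans (ltW c2) ai1).
rewrite ler_wpM2l // ger0_norm ?subr_ge0 ?(ltW c2) //.
by rewrite -(aS i) lerD2l lerN2 ltW.
Qed.

Lemma cvg_invn : (n%:R^-1 : R) @[n --> \oo] --> (0 : R).
Proof.
apply/cvgrPdist_le => e e0; near=> n.
have n0 : 0 < n%:R :> R by rewrite ltr0n; near: n; exists 1%N.
rewrite sub0r normrN ger0_norm ?invr_ge0 ?(ltW n0) //.
rewrite -[leRHS]invrK lef_pV2 ?posrE ?invr_gt0 //.
by near: n; exact: nbhs_infty_ger.
Unshelve. all: end_near. Qed.

Lemma riemann_cvg L f : lip01 L f ->
  n%:R^-1 * (\sum_(i < n) f (grid R n i)) @[n --> \oo] --> int01 f.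
Proof.
move=> fL; apply/cvgrPdist_le => e e0.
have L0 := lip01_ge0 fL.
near=> n; rewrite distrC.
have n0 : (0 < n)%N by near: n; exists 1%N.
apply: le_trans (riemann_sum_lip n0 fL) _.
rewrite ler_pdivrMr ?ltr0n // mulrC -ler_pdivrMr //.
by near: n; exact: nbhs_infty_ger.
Unshelve. all: end_near. Qed.

End Lip.

(** * Lipschitz and second-difference bounds from the derivatives *)

Section SmoothKernel.
Variable R : realType.
Implicit Types (f g : R * R -> R).

Lemma unit_squareE (p : R * R) : unit_square p <-> 0 <= p.1 <= 1 /\ 0 <= p.2 <= 1.
Proof. by rewrite /unit_square /setX /= !in_itv. Qed.

Lemma open_unit_squareE (p : R * R) : open_unit_square p <-> 0 < p.1 < 1 /\ 0 < p.2 < 1.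
Proof. by rewrite /open_unit_square /setX /= !in_itv. Qed.

Lemma unit_square_bounded f : {within @unit_square R, continuous f} ->
  exists2 M, 0 <= M & forall p, unit_square p -> `|f p| <= M.
Proof.
move=> fc.
have sc : compact (@unit_square R) by apply: compact_setX; exact: segment_compact.
have s0 : @unit_square R !=set0 by exists (0, 0); apply/unit_squareE; rewrite !lexx ler01.
have nc : {within @unit_square R, continuous (fun p => `|f p|)}.
  by move=> p; apply: (continuous_comp (fc p)); exact: norm_continuous.
have [p ps pm] := compact_EVT_max s0 sc nc.
exists `|f p| => // q qs; apply: pm; by rewrite inE.
Qed.

Lemma slice1_continuous f y : {within @unit_square R, continuous f} -> 0 <= y <= 1 ->
  {within `[0, 1], continuous (fun x => f (x, y))}.
Proof.
move=> /subspace_continuousP fc y01; apply/subspace_continuousP => x /= xI.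
have xy : unit_square (x, y) by apply/unit_squareE; rewrite in_itv /= in xI.
apply: cvg_comp (fc _ xy) => A /= [[U V] /= [Ux Vy] UVA].
suff : \forall x' \near x, `[0, 1]%classic x' -> A (x', y) by [].
near=> x' => /= x'I; apply: UVA => /=; last first.
  by apply/unit_squareE; rewrite in_itv /= in x'I.
by split => /=; [near: x'|exact: nbhs_singleton].
Unshelve. all: end_near. Qed.

Lemma slice2_continuous f x : {within @unit_square R, continuous f} -> 0 <= x <= 1 ->
  {within `[0, 1], continuous (fun y => f (x, y))}.
Proof.
move=> /subspace_continuousP fc x01; apply/subspace_continuousP => y /= yI.
have xy : unit_square (x, y) by apply/unit_squareE; rewrite in_itv /= in yI.
apply: cvg_comp (fc _ xy) => A /= [[U V] /= [Ux Vy] UVA].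
suff : \forall y' \near y, `[0, 1]%classic y' -> A (x, y') by [].
near=> y' => /= y'I; apply: UVA => /=; last first.
  by apply/unit_squareE; rewrite in_itv /= in y'I.
by split => /=; [exact: nbhs_singleton|near: y'].
Unshelve. all: end_near. Qed.

Lemma slice1_derive f d x y : is_derive (x, y) ((1, 0) : R * R) f d ->
  is_derive x 1 (fun x => f (x, y)) d.
Proof.
case=> df dfE.
have E : (fun h : R => h^-1 *: (((fun x => f (x, y)) \o shift x) (h *: 1) - f (x, y))) =
  (fun h : R => h^-1 *: ((f \o shift (x, y)) (h *: ((1, 0) : R * R)) - f (x, y))).
  apply/funext => h /=; congr (_ *: (f _ - _)).
  by congr pair => /=; rewrite ?scaler0 ?add0r.
by split; rewrite /derivable /derive E.
Qed.

(** Derivatives are available in the open square only; continuity carries the resulting estimates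
    over to its boundary. *)
Lemma closed_itv_le (g : R -> R) c : {within `[0, 1], continuous g} ->
  (forall y, 0 < y < 1 -> g y <= c) -> forall y, 0 <= y <= 1 -> g y <= c.
Proof.
move=> /subspace_continuousP gc gle y y01; rewrite leNgt; apply/negP => cy.
have yI : `[0, 1]%classic y by rewrite /= in_itv.
have /cvgrPdist_lt /(_ (g y - c)) := gc _ yI; rewrite subr_gt0 => /(_ cy).
rewrite near_withinE => -[d /= d0 dP].
pose t : R := Num.min d 1 / 2.
have m0 : 0 < Num.min d 1 by rewrite lt_min d0 ltr01.
have t0 : 0 < t by rewrite divr_gt0.
have t1 : t < 1 by rewrite ltr_pdivrMr // mul1r gt_min (ltr_nat _ 1 2) orbT.
have td : t < d.
  rewrite ltr_pdivrMr // (@le_lt_trans _ _ d) ?ge_min ?lexx //.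
  by rewrite ltr_pMr // ltrDl ltr01.
(* Moving [y] towards the midpoint by a distance less than [d] lands in the open interval. *)
pose z := y + t * (2^-1 - y).
have z01 : 0 < z < 1 by rewrite /z; nra.
have yz : `|y - z| < d.
  rewrite /z opprD addrA subrr sub0r normrN normrM gtr0_norm //.
  have h : `|2^-1 - y| <= 1 by rewrite ler_norml; lra.
  by apply: le_lt_trans td; rewrite ler_piMr // ltW.
have := dP z yz; rewrite /= in_itv /= !ltW ?(andP z01).1 ?(andP z01).2 // => /(_ isT).
have := gle z z01; rewrite ltr_norml => h /andP[_].
by rewrite /from_subspace; lra.
Qed.

Lemma slice1_lip f fx : Ck_unit_square 0 f -> Ck_unit_square 0 fx ->
  (forall p, open_unit_square p -> is_derive p ((1, 0) : R * R) f (fx p)) ->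
  exists2 L, 0 <= L & forall x x' y, 0 <= x <= 1 -> 0 <= x' <= 1 -> 0 <= y <= 1 ->
    `|f (x, y) - f (x', y)| <= L * `|x - x'|.
Proof.
move=> [fc _] [fxc _] fd.
have [L L0 fxL] := unit_square_bounded fxc; exists L => // x x' y x01 x'01 y01.
wlog xx' : x x' x01 x'01 / x < x'.
  move=> H; have [/H|/H|->] := ltgtP x x'; [exact| |by rewrite !subrr normr0 mulr0].
  by rewrite distrC [X in _ * X]distrC; exact.
rewrite distrC [X in _ * X]distrC.
apply: (closed_itv_le (g := fun y => `|f (x', y) - f (x, y)|)) y y01 => [|y y01].
  apply/subspace_continuousP => y yI; apply: cvg_norm; apply: cvgB.
    exact: ((subspace_continuousP _ _).1 (slice2_continuous fc x'01)).
  exact: ((subspace_continuousP _ _).1 (slice2_continuous fc x01)).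
have y01' : 0 <= y <= 1 by move: y01 => /andP[/ltW -> /ltW ->].
have [|| c] := @MVT R (fun x => f (x, y)) (fun x => fx (x, y)) x x' xx'.
- move=> z; rewrite in_itv /= => /andP[xz zx']; apply: slice1_derive; apply: fd.
  by apply/open_unit_squareE => /=; split => //; lra.
- apply: continuous_subspaceW (slice1_continuous fc y01') => z /=; rewrite !in_itv /=; lra.
rewrite in_itv /= => cI ->; rewrite normrM ler_wpM2r //.
by apply: fxL; apply/unit_squareE => /=; split => //; lra.
Qed.

(** The mean value theorem on both halves of the interval, and then for [fx] between the two
    intermediate points. *)
Lemma slice1_second_diff f : Ck_unit_square 2 f ->
  exists2 C, 0 <= C & forall a b y, 0 <= a -> a < b -> b <= 1 -> 0 <= y <= 1 ->
    `|f (a, y) + f (b, y) - 2 * f ((a + b) / 2, y)| <= C * (b - a) ^+ 2.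
Proof.
move=> [fc [fx [fy [[fxc [fxx [fxy [fxxc _ fxd]]]] _ fd]]]].
have [L L0 fxxL] := unit_square_bounded (proj1 fxxc).
exists L => // a b y a0 ab b1.
have m1 : a < (a + b) / 2 by lra.
have m2 : (a + b) / 2 < b by lra.
pose m := (a + b) / 2; rewrite -/m.
have a01 : 0 <= a <= 1 by lra.
have b01 : 0 <= b <= 1 by lra.
have m01 : 0 <= m <= 1 by rewrite /m; lra.
move: y; apply: (closed_itv_le (g := fun y => `|f (a, y) + f (b, y) - 2 * f (m, y)|)).
  apply/subspace_continuousP => y yI; apply: cvg_norm; apply: cvgB; first apply: cvgD.
  - exact: ((subspace_continuousP _ _).1 (slice2_continuous fc a01)).
  - exact: ((subspace_continuousP _ _).1 (slice2_continuous fc b01)).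
  apply: cvgM; first exact: cvg_cst.
  exact: ((subspace_continuousP _ _).1 (slice2_continuous fc m01)).
move=> y y01; have y01' : 0 <= y <= 1 by lra.
have mvt u w : 0 <= u -> u < w -> w <= 1 -> exists2 c, u < c < w &
    f (w, y) - f (u, y) = fx (c, y) * (w - u).
  move=> u0 uw w1; have [|| c] := @MVT R (fun x => f (x, y)) (fun x => fx (x, y)) u w uw.
  - move=> z; rewrite in_itv /= => zI; apply: slice1_derive; apply: (fd _ _).1.
    by apply/open_unit_squareE => /=; split => //; lra.
  - by apply: continuous_subspaceW (slice1_continuous fc y01') => z /=; rewrite !in_itv /=; lra.
  by rewrite in_itv /=; exists c.
have [c1 c1I e1] := mvt a m a0 m1 (andP m01).2.
have [c2 c2I e2] := mvt m b (andP m01).1 m2 b1.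
have c12 : c1 < c2 by lra.
have [|| c] := @MVT R (fun x => fx (x, y)) (fun x => fxx (x, y)) c1 c2 c12.
- move=> z; rewrite in_itv /= => zI; apply: slice1_derive; apply: (fxd _ _).1.
  by apply/open_unit_squareE => /=; split => //; lra.
- by apply: continuous_subspaceW (slice1_continuous fxc y01') => z /=; rewrite !in_itv /=; lra.
rewrite in_itv /= => cI e3.
have -> : f (a, y) + f (b, y) - 2 * f (m, y) =
   (fxx (c, y) * (c2 - c1)) * ((b - a) / 2).
  rewrite -e3; have h1 : m - a = (b - a) / 2 by rewrite /m; field.
  have h2 : b - m = (b - a) / 2 by rewrite /m; field.
  by rewrite h1 in e1; rewrite h2 in e2; lra.
have h : `|fxx (c, y)| <= L by apply: fxxL; apply/unit_squareE => /=; split => //; lra.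
rewrite normrM normrM (ger0_norm (_ : 0 <= c2 - c1)) ?subr_ge0 ?(ltW c12) //.
rewrite (ger0_norm (_ : 0 <= (b - a) / 2)); last by lra.
rewrite -mulrA; apply: ler_pM => //; first by rewrite mulr_ge0; lra.
have : (c2 - c1) * ((b - a) / 2) <= (b - a) * (b - a).
  by apply: ler_pM; lra.
by rewrite expr2.
Qed.

End SmoothKernel.

Section Trapezoid.
Variables (R : realType) (f : R -> R) (L C : R).
Hypotheses (fL : lip01 L f) (C0 : 0 <= C).
Hypothesis fC : forall a b, 0 <= a -> a < b -> b <= 1 ->
  `|f a + f b - 2 * f ((a + b) / 2)| <= C * (b - a) ^+ 2.

Let T n : R := n%:R^-1 * \sum_(i < n) (f (i%:R / n%:R) + f (i.+1%:R / n%:R)) / 2.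

Let TE n : (0 < n)%N ->
  T n = n%:R^-1 * (\sum_(i < n) f (grid R n i)) - (f 1 - f 0) / (2 * n%:R).
Proof.
move=> n0; have n0' : n%:R != 0 :> R by rewrite pnatr_eq0 -lt0n.
have tel : \sum_(i < n) (f (i.+1%:R / n%:R) - f (i%:R / n%:R)) = f 1 - f 0.
  rewrite -(big_mkord predT (fun i => f (i.+1%:R / n%:R) - f (i%:R / n%:R))).
  by rewrite (telescope_sumr (fun i => f (i%:R / n%:R))) // divff // mul0r.
rewrite -tel /T -mulr_suml.
rewrite (eq_bigr (fun i : 'I_n => 2 * f (grid R n i) - (f (i.+1%:R / n%:R) - f (i%:R / n%:R)))).
  by rewrite sumrB -mulr_sumr; field.
by move=> i _; rewrite /grid; ring.
Qed.

Let sum_double m (g : nat -> R) :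
  \sum_(i < m * 2) g i = \sum_(i < m) (g (i * 2)%N + g (i * 2).+1).
Proof.
elim: m => [|m IH]; first by rewrite mul0n !big_ord0.
by rewrite mulSn add2n !big_ord_recr /= IH addrA.
Qed.

Let T_double n : (0 < n)%N -> `|T n - T (n * 2)| <= C / (4 * n%:R ^+ 2).
Proof.
move=> n0; have n0' : 0 < n%:R :> R by rewrite ltr0n.
rewrite /T (sum_double n (fun i => (f (i%:R / (n * 2)%:R) + f (i.+1%:R / (n * 2)%:R)) / 2)).
pose a i : R := i%:R / n%:R.
have aS i : a i.+1 - a i = n%:R^-1 by rewrite /a -natr1; field; rewrite gt_eqF.
have -> : n%:R^-1 * \sum_(i < n) (f (i%:R / n%:R) + f (i.+1%:R / n%:R)) / 2 -
    (n * 2)%:R^-1 * \sum_(i < n) ((f ((i * 2)%:R / (n * 2)%:R) +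
        f ((i * 2).+1%:R / (n * 2)%:R)) / 2 +
      (f ((i * 2).+1%:R / (n * 2)%:R) + f ((i * 2).+2%:R / (n * 2)%:R)) / 2) =
    \sum_(i < n) (4 * n%:R)^-1 * (f (a i) + f (a i.+1) - 2 * f ((a i + a i.+1) / 2)).
  rewrite !mulr_sumr -sumrB; apply: eq_bigr => i _.
  have -> : (i * 2)%:R / (n * 2)%:R = a i by rewrite /a !natrM; field; rewrite gt_eqF.
  have -> : (i * 2).+1%:R / (n * 2)%:R = (a i + a i.+1) / 2.
    by rewrite /a -!natr1 !natrM; field; rewrite gt_eqF.
  have -> : (i * 2).+2%:R / (n * 2)%:R = a i.+1.
    by rewrite /a -!natr1 !natrM; field; rewrite gt_eqF.
  by rewrite -/(a i) -/(a i.+1) natrM; field; rewrite gt_eqF.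
apply: le_trans (ler_norm_sum _ _ _) _.
have -> : C / (4 * n%:R ^+ 2) = \sum_(i < n) (4 * n%:R)^-1 * (C * n%:R^-1 ^+ 2).
  by rewrite sumr_const card_ord -[RHS]mulr_natl; field; rewrite gt_eqF.
apply: ler_sum => i _; rewrite normrM ger0_norm ?invr_ge0 ?mulr_ge0 ?ler0n //.
rewrite ler_wpM2l ?invr_ge0 ?mulr_ge0 ?ler0n // -(aS i); apply: fC.
- by rewrite divr_ge0.
- by rewrite -subr_gt0 aS invr_gt0.
- by rewrite ler_pdivrMr // mul1r ler_nat.
Qed.

(** The errors of successive halvings form a geometric series; in the induction step, 1/4 + 1/12 =
    1/3. *)
Let T_dyadic j n : (0 < n)%N -> `|T n - T (n * 2 ^ j)| <= C / (3 * n%:R ^+ 2).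
Proof.
elim: j n => [|j IH] n n0; have n0' : 0 < n%:R :> R by rewrite ltr0n.
  by rewrite expn0 muln1 subrr normr0 divr_ge0 // mulr_ge0 // exprn_ge0 // ltW.
rewrite expnS mulnA; have -> : T n - T (n * 2 * 2 ^ j) =
   (T n - T (n * 2)%N) + (T (n * 2)%N - T (n * 2 * 2 ^ j)%N) by ring.
apply: le_trans (ler_normD _ _) _.
apply: le_trans (lerD (T_double n0) (IH (n * 2)%N _)) _; first by rewrite muln_gt0 n0.
by rewrite natrM le_eqVlt; apply/orP; left; apply/eqP; field; rewrite gt_eqF.
Qed.

(** The left side is the error of the trapezoidal rule [T n]. Halving the mesh repeatedly brings
    [T n] to a mesh so fine that the crude first-order bound [Tint] is already of order
    [1 / n^2]. *)
Lemma trapezoid_lip n : (0 < n)%N ->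
  `|n%:R^-1 * (\sum_(i < n) f (grid R n i)) - int01 f - (f 1 - f 0) / (2 * n%:R)| <=
  (C + 1) / n%:R ^+ 2.
Proof.
move=> n0; have n0' : 0 < n%:R :> R by rewrite ltr0n.
have L0 := lip01_ge0 fL.
have Tint N : (0 < N)%N -> `|T N - int01 f| <= 2 * L / N%:R.
  move=> N0; have N0' : 0 < N%:R :> R by rewrite ltr0n.
  rewrite TE // addrAC; apply: le_trans (ler_normB _ _) _.
  have h1 := riemann_sum_lip N0 fL.
  have h2 : `|(f 1 - f 0) / (2 * N%:R)| <= L / N%:R.
    have := fL (x := 1) (y := 0); rewrite !lexx !ler01 subr0 normr1 mulr1 => /(_ isT isT) h.
    rewrite normrM (ger0_norm (_ : 0 <= (2 * N%:R)^-1)) ?invr_ge0 ?mulr_ge0 ?ler0n //.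
    apply: ler_pM => //.
    by rewrite lef_pV2 ?posrE ?mulr_gt0 // ler_peMl ?ler0n // ler1n.
  by apply: le_trans (lerD h1 h2) _; rewrite -mulrDl mulr_natl mulr2n.
(* Then [2 L / (n 2^j)] is at most [1 / n^2], which accounts for the 1 in [C + 1]. *)
pose j := (Num.truncn (2 * L * n%:R)).+1.
have jL : 2 * L * n%:R <= (2 ^ j)%:R.
  apply: le_trans (ltW (truncnS_gt _)) _; rewrite ler_nat.
  by apply: ltnW; exact: ltn_expl.
have -> : n%:R^-1 * (\sum_(i < n) f (grid R n i)) - int01 f - (f 1 - f 0) / (2 * n%:R) =
    (T n - T (n * 2 ^ j)) + (T (n * 2 ^ j) - int01 f) by rewrite (TE n0); ring.
have nj : (0 < n * 2 ^ j)%N by rewrite muln_gt0 n0 expn_gt0.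
apply: le_trans (ler_normD _ _) _.
apply: le_trans (lerD (T_dyadic j n0) (Tint (n * 2 ^ j)%N nj)) _.
rewrite [leRHS]mulrDl; apply: lerD.
  rewrite ler_wpM2l // lef_pV2 ?posrE ?mulr_gt0 ?exprn_gt0 //.
  by rewrite ler_peMl ?exprn_ge0 ?ler1n // ltW.
rewrite ler_pdivrMr ?ltr0n // mul1r natrM mulrA -ler_pdivrMl ?mulr_gt0 ?invr_gt0 ?exprn_gt0 //.
apply: le_trans jL; rewrite le_eqVlt; apply/orP; left; apply/eqP; field; by rewrite gt_eqF.
Qed.

End Trapezoid.

(* What the limit theorem uses of the C^2 hypothesis: a Lipschitz bound, and the
   first-order Euler-Maclaurin expansion of the Riemann sums. *)
Record regular_kernel (R : realType) (rho : R * R -> R) (L C M : R) : Prop := {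
  rk_L : 0 <= L; rk_C : 0 <= C; rk_M : 0 <= M;
  rk_lip : forall y, 0 <= y <= 1 -> lip01 L (fun x => rho (x, y));
  rk_sym : forall x y, 0 <= x <= 1 -> 0 <= y <= 1 -> rho (x, y) = rho (y, x);
  rk_int : forall y, 0 <= y <= 1 -> int01 (fun x => rho (x, y)) = 1;
  rk_trap : forall n y, (0 < n)%N -> 0 <= y <= 1 ->
    `|n%:R^-1 * (\sum_(i < n) rho (grid R n i, y)) - 1 - (rho (1, y) - rho (0, y)) / (2 * n%:R)|
    <= C / n%:R ^+ 2;
  rk_bound : forall x y, 0 <= x <= 1 -> 0 <= y <= 1 -> `|rho (x, y)| <= M }.

Lemma C2_regular_kernel (R : realType) (rho : R * R -> R) :
  Ck_unit_square 2 rho ->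
  (forall x y, @unit_square R (x, y) -> rho (x, y) = rho (y, x)) ->
  (forall y, y \in `[0, 1] -> \int[@lebesgue_measure R]_(x in `[0, 1]) rho (x, y) = 1) ->
  exists L C M, regular_kernel rho L C M.
Proof.
move=> rho2 rsym rint.
have [fc [fx [fy [[fxc _] _ fd]]]] := rho2.
have [L L0 hL] := @slice1_lip R rho fx (conj fc I) (conj fxc I) (fun p ps => (fd p ps).1).
have [C C0 hC] := slice1_second_diff rho2.
have [M M0 hM] := unit_square_bounded fc.
have lip y : 0 <= y <= 1 -> lip01 L (fun x => rho (x, y)).
  by move=> y01 x x' x01 x'01; exact: hL.
exists L, (C + 1), M; split => //.
- by rewrite addr_ge0.
- by move=> x y x01 y01; apply: rsym; apply/unit_squareE.
- move=> n y n0 y01.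
  have := trapezoid_lip (lip _ y01) C0 _ n0.
  have -> : int01 (fun x => rho (x, y)) = 1 by exact: rint.
  by apply => a b a0 ab b1; exact: hC.
by move=> x y x01 y01; apply: hM; apply/unit_squareE.
Qed.

(** * The matrix of the kernel on the grid *)

Section KernelMatrix.
Variables (R : realType) (rho : R * R -> R) (L C M : R).
Hypothesis rk : regular_kernel rho L C M.

(* The rank-one part of the kernel on the grid is [kweight i * kweight j]; this
   choice of the weights makes [kmatrix] annihilate constants exactly. *)
Definition krow n (i : 'I_n) : R := n%:R^-1 * \sum_(j < n) rho (grid R n j, grid R n i).
Definition kmean n : R := n%:R^-1 * \sum_(i < n) krow i.
Definition kweight n (i : 'I_n) : R := krow i / Num.sqrt (kmean n).
Definition kmatrix n (i j : 'I_n) : R :=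
  n%:R^-1 * (rho (grid R n i, grid R n j) - kweight i * kweight j).

Let L0 := rk_L rk.
Let C0 := rk_C rk.
Let M0 := rk_M rk.

Lemma kmatrix_sym n (i j : 'I_n) : kmatrix i j = kmatrix j i.
Proof.
by rewrite /kmatrix (rk_sym rk) ?grid01 // [X in _ - X]mulrC.
Qed.

Lemma krow_sub1 n (i : 'I_n) : `|krow i - 1| <= L / n%:R.
Proof.
have n0 : (0 < n)%N by rewrite (leq_ltn_trans _ (ltn_ord i)).
have := riemann_sum_lip n0 (rk_lip rk (grid01 R i)).
by rewrite (rk_int rk (grid01 R i)).
Qed.

Lemma lip_fst x : 0 <= x <= 1 -> lip01 L (fun y => rho (x, y)).
Proof.
move=> x01 y y' y01 y'01; rewrite (rk_sym rk) // [X in _ - X](rk_sym rk) //.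
exact: (rk_lip rk).
Qed.

Lemma int_fst x : 0 <= x <= 1 -> int01 (fun y => rho (x, y)) = 1.
Proof.
move=> x01; rewrite -(rk_int rk x01); apply: eq_Rintegral => y.
by rewrite inE /= in_itv /= => y01; rewrite (rk_sym rk).
Qed.

(** The row means deviate from 1 by the boundary terms [(rho (1, y) - rho (0, y)) / (2 n)] up to
    [C / n^2]. Averaged over the grid, the boundary terms gain another [1 / n], because both
    boundary slices integrate to 1. *)
Lemma kmean_sub1 n : (0 < n)%N -> `|kmean n - 1| <= (L + C) / n%:R ^+ 2.
Proof.
move=> n0; have n0' : 0 < n%:R :> R by rewrite ltr0n.
have h i : (i < n)%N -> 0 <= grid R n i <= 1 by move=> li; exact: (grid01 R (Ordinal li)).
have I1 := riemann_sum_lip n0 (lip_fst (x := 1) _).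
have I0 := riemann_sum_lip n0 (lip_fst (x := 0) _).
have {}I1 := I1 _; have {}I0 := I0 _.
have e1 : 0 <= (1 : R) <= 1 by rewrite ler01 lexx.
have e0 : 0 <= (0 : R) <= 1 by rewrite lexx ler01.
have {}I1 := I1 e1; have {}I0 := I0 e0.
rewrite (int_fst e1) in I1; rewrite (int_fst e0) in I0.
set A1 := n%:R^-1 * _ in I1; set A0 := n%:R^-1 * _ in I0.
pose E (i : 'I_n) := krow i - 1 - (rho (1, grid R n i) - rho (0, grid R n i)) / (2 * n%:R) : R.
have -> : kmean n - 1 = n%:R^-1 * (\sum_(i < n) E i) + (A1 - 1 - (A0 - 1)) / (2 * n%:R).
  rewrite /E !sumrB -mulr_suml sumrB sumr_const card_ord -[1 *+ n]/(n%:R) /kmean /A1 /A0.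
  by field; rewrite gt_eqF.
apply: le_trans (ler_normD _ _) _; rewrite [leRHS]mulrDl [leLHS]addrC; apply: lerD; last first.
  rewrite normrM ger0_norm ?invr_ge0 ?ler0n // ler_pdivrMl //.
  apply: le_trans (ler_norm_sum _ _ _) _.
  apply: le_trans (_ : \sum_(i < n) C / n%:R ^+ 2 <= _).
    by apply: ler_sum => i _; exact: (rk_trap rk n0 (grid01 R i)).
  by rewrite sumr_const card_ord mulr_natl.
rewrite normrM (ger0_norm (_ : 0 <= (2 * n%:R)^-1)) ?invr_ge0 ?mulr_ge0 ?ler0n //.
rewrite ler_pdivrMr ?mulr_gt0 //.
apply: le_trans (ler_normB _ _) _; apply: le_trans (lerD I1 I0) _.
by rewrite le_eqVlt; apply/orP; left; apply/eqP; field; rewrite gt_eqF.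
Qed.

(** The row contributes [L] and the normalisation [L + C]; dividing by a square root that is at
    least 1/2 doubles their sum, and [2 (2 L + C) <= 4 (L + C)]. *)
Definition weight_const : R := 4 * (L + C) + 1.
Let c := weight_const.

Lemma weight_const_ge0 : 0 <= c.
Proof. by rewrite addr_ge0 // mulr_ge0 // addr_ge0. Qed.

Lemma kweight_bounds : \forall n \near \oo, [/\ (0 < n)%N, 1 / 4 <= kmean n,
   forall i : 'I_n, 0 < kweight i & forall i : 'I_n, `|kweight i - 1| <= c / n%:R].
Proof.
near=> n.
have n0 : (0 < n)%N by near: n; exists 1%N.
have n0' : 0 < n%:R :> R by rewrite ltr0n.
have n1 : 1 <= n%:R :> R by rewrite ler1n.
have nc : 4 * c <= n%:R by near: n; exact: nbhs_infty_ger.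
have LC0 : 0 <= L + C by rewrite addr_ge0.
have km : `|kmean n - 1| <= (L + C) / n%:R.
  apply: le_trans (kmean_sub1 n0) _; rewrite ler_wpM2l // lef_pV2 ?posrE ?exprn_gt0 //.
  by rewrite ler_eXnr.
have LCn : (L + C) / n%:R <= 1 / 16.
  by rewrite ler_pdivrMr //; move: nc; rewrite /c /weight_const; lra.
have km' : 1 / 4 <= kmean n by move: km; rewrite ler_norml; lra.
set s := Num.sqrt (kmean n).
have s2 : s ^+ 2 = kmean n by rewrite sqr_sqrtr //; lra.
have s0 : 0 <= s by exact: sqrtr_ge0.
have sh : 1 / 2 <= s.
  rewrite leNgt; apply/negP => sl; have : s ^+ 2 < 1 / 4 by rewrite expr2; nra.
  by rewrite s2; lra.
have s1 : `|s - 1| <= (L + C) / n%:R.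
  apply: le_trans km; rewrite -s2.
  have -> : s ^+ 2 - 1 = (s - 1) * (s + 1) by ring.
  by rewrite normrM ler_peMr // ger0_norm; lra.
have u1 (i : 'I_n) : `|kweight i - 1| <= c / n%:R.
  rewrite /kweight -/s.
  have -> : krow i / s - 1 = ((krow i - 1) - (s - 1)) / s by field; rewrite gt_eqF //; lra.
  rewrite normrM normfV (ger0_norm s0) ler_pdivrMr; last by lra.
  apply: le_trans (ler_normB _ _) _; apply: le_trans (lerD (krow_sub1 i) s1) _.
  apply: le_trans (_ : c / n%:R * (1 / 2) <= _); last first.
    by rewrite ler_wpM2l // divr_ge0 ?weight_const_ge0 // ltW.
  rewrite -mulrDl mulrAC ler_wpM2r ?invr_ge0 ?(ltW n0') // /c /weight_const.
  by have := C0; have := L0; lra.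
split => // i; have := u1 i.
have : c / n%:R <= 1 / 4 by rewrite ler_pdivrMr //; lra.
by rewrite ler_norml; lra.
Unshelve. all: end_near. Qed.

Lemma sum_kweight n : 0 < kmean n -> \sum_(i < n) kweight i = n%:R * Num.sqrt (kmean n).
Proof.
move=> k0; have [n0|n0] := posnP n.
  have -> : n%:R = 0 :> R by rewrite n0.
  rewrite mul0r big1 // => i _; exfalso.
  by have := ltn_ord i; rewrite [X in (_ < X)%N]n0.
have n0' : n%:R != 0 :> R by rewrite pnatr_eq0 -lt0n.
have s0 : Num.sqrt (kmean n) != 0 by rewrite gt_eqF // sqrtr_gt0.
rewrite /kweight -mulr_suml.
have -> : \sum_(i < n) krow i = n%:R * kmean n by rewrite /kmean mulrA divff ?mul1r.
by rewrite -{1}(sqr_sqrtr (ltW k0)) expr2; field.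
Qed.

Lemma kmatrix_sum0 n (i : 'I_n) : 0 < kmean n -> \sum_j kmatrix i j = 0.
Proof.
move=> k0; have n0 : (0 < n)%N by rewrite (leq_ltn_trans _ (ltn_ord i)).
have n0' : n%:R != 0 :> R by rewrite pnatr_eq0 -lt0n.
have s0 : Num.sqrt (kmean n) != 0 by rewrite gt_eqF // sqrtr_gt0.
rewrite -mulr_sumr sumrB -mulr_sumr sum_kweight //.
have -> : \sum_(j < n) rho (grid R n i, grid R n j) = n%:R * krow i.
  rewrite /krow mulrA divff // mul1r; apply: eq_bigr => j _.
  by rewrite (rk_sym rk) // grid01.
by rewrite /kweight; field; rewrite n0' s0.
Qed.

(** The logarithm of the product is the sum of the [kweight i - 1] up to [n] errors of order
    [1 / n^2], and that sum is [n] times the square root of the mean minus 1, hence of order [1 / n]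
    by [kmean_sub1]. *)
Lemma prod_kweight_cvg : \prod_(i < n) kweight i @[n --> \oo] --> (1 : R).
Proof.
pose S n : R := \sum_(i < n) ln (kweight i).
have Sb : \forall n \near \oo, `|S n| <= (2 * c ^+ 2 + (L + C)) / n%:R.
  near=> n.
  have [n0 km u0 u1] : [/\ (0 < n)%N, 1 / 4 <= kmean n,
     forall i : 'I_n, 0 < kweight i & forall i : 'I_n, `|kweight i - 1| <= c / n%:R].
    by near: n; exact: kweight_bounds.
  have n0' : 0 < n%:R :> R by rewrite ltr0n.
  have nc : 2 * c <= n%:R by near: n; exact: nbhs_infty_ger.
  have c0 := weight_const_ge0.
  have k0 : 0 < kmean n by lra.
  have cn : c / n%:R <= 1 / 2 by rewrite ler_pdivrMr //; lra.
  have lnb (x : R) : `|x - 1| <= c / n%:R -> `|ln x - (x - 1)| <= (x - 1) ^+ 2 * 2.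
    move=> xc; have x2 : 1 / 2 <= x by move: (le_trans xc cn); rewrite ler_norml; lra.
    have xp : 0 < x by lra.
    have h1 : ln x <= x - 1 by have := @le_ln1Dx R (x - 1); rewrite (_ : 1 + (x - 1) = x); [apply; lra|ring].
    have h2 : 1 - x^-1 <= ln x.
      rewrite -[x in ln x]invrK lnV ?posrE ?invr_gt0 //.
      have := @le_ln1Dx R (x^-1 - 1); rewrite (_ : 1 + (x^-1 - 1) = x^-1); last by ring.
      move=> h.
      by rewrite lerNr opprB; apply: h; have := invr_gt0 x; rewrite xp; lra.
    have h3 : 1 - x^-1 >= (x - 1) - (x - 1) ^+ 2 * 2.
      rewrite -subr_ge0.
      have -> : 1 - x^-1 - (x - 1 - (x - 1) ^+ 2 * 2) = (x - 1) ^+ 2 * (2 - x^-1).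
        by field; rewrite gt_eqF.
      rewrite mulr_ge0 ?sqr_ge0 // subr_ge0 -[leRHS]invrK lef_pV2 ?posrE ?invr_gt0 //.
      by move: x2; rewrite mul1r.
    by have := sqr_ge0 (x - 1); rewrite ler_norml; lra.
  have -> : S n = \sum_(i < n) (ln (kweight i) - (kweight i - 1)) + n%:R * (Num.sqrt (kmean n) - 1).
    rewrite sumrB sumrB sum_kweight // sumr_const card_ord -[1 *+ n]/(n%:R) /S.
    by ring.
  apply: le_trans (ler_normD _ _) _; rewrite [leRHS]mulrDl; apply: lerD.
    apply: le_trans (ler_norm_sum _ _ _) _.
    apply: le_trans (_ : \sum_(i < n) (c / n%:R) ^+ 2 * 2 <= _).
      apply: ler_sum => i _; apply: le_trans (lnb _ (u1 i)) _.
      by rewrite ler_wpM2r // -real_normK ?num_real // lerXn2r ?nnegrE ?divr_ge0 // ltW.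
    rewrite sumr_const card_ord -[leLHS]mulr_natl.
    by rewrite le_eqVlt; apply/orP; left; apply/eqP; field; rewrite gt_eqF.
  set s := Num.sqrt _.
  have s0 : 0 <= s by exact: sqrtr_ge0.
  have s1 : `|s - 1| <= (L + C) / n%:R ^+ 2.
    apply: le_trans (kmean_sub1 n0); rewrite -(sqr_sqrtr (ltW k0)) -/s.
    have -> : s ^+ 2 - 1 = (s - 1) * (s + 1) by ring.
    by rewrite normrM ler_peMr // ger0_norm; lra.
  rewrite normrM ger0_norm ?ler0n // -ler_pdivlMl //.
  apply: le_trans s1 _.
  by rewrite le_eqVlt; apply/orP; left; apply/eqP; field; rewrite gt_eqF.
have Sc : S n @[n --> \oo] --> (0 : R).
  apply/cvgrPdist_le => e e0; near=> n; rewrite sub0r normrN.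
  apply: le_trans (_ : (2 * c ^+ 2 + (L + C)) / n%:R <= _); first by near: n.
  have n0 : 0 < n%:R :> R by rewrite ltr0n; near: n; exists 1%N.
  rewrite ler_pdivrMr // [leRHS]mulrC -ler_pdivrMr //.
  by near: n; exact: nbhs_infty_ger.
have : expR (S n) @[n --> \oo] --> (1 : R).
  by rewrite -(expR0 R); apply: cvg_comp Sc _; exact: continuous_expR.
apply: cvg_trans; apply: near_eq_cvg; near=> n.
have [n0 km u0 u1] : [/\ (0 < n)%N, 1 / 4 <= kmean n,
   forall i : 'I_n, 0 < kweight i & forall i : 'I_n, `|kweight i - 1| <= c / n%:R].
  by near: n; exact: kweight_bounds.
by rewrite /S expR_sum; apply: eq_bigr => i _; rewrite lnK // posrE.
Unshelve. all: end_near. Qed.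

Lemma kweight_lip n (i j : 'I_n) : 1 / 4 <= kmean n ->
  `|kweight i - kweight j| <= 2 * L * `|grid R n i - grid R n j|.
Proof.
move=> km; have n0 : (0 < n)%N by rewrite (leq_ltn_trans _ (ltn_ord i)).
have n0' : 0 < n%:R :> R by rewrite ltr0n.
have sh : 1 / 2 <= Num.sqrt (kmean n).
  rewrite leNgt; apply/negP => sl; have : (Num.sqrt (kmean n)) ^+ 2 < 1 / 4.
    by have := sqrtr_ge0 (kmean n); rewrite expr2; nra.
  by rewrite sqr_sqrtr; lra.
rewrite /kweight -mulrBl normrM normfV (ger0_norm (sqrtr_ge0 _)) ler_pdivrMr; last by lra.
apply: le_trans (_ : L * `|grid R n i - grid R n j| <= _); last first.
  set x := `|_|; set t := Num.sqrt _; have -> : 2 * L * x * t = L * x * (2 * t) by ring.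
  rewrite ler_peMr //; first by rewrite mulr_ge0 // normr_ge0.
  by move: sh; rewrite -/t; lra.
rewrite /krow -mulrBr -sumrB normrM ger0_norm ?invr_ge0 ?ler0n // ler_pdivrMl //.
apply: le_trans (ler_norm_sum _ _ _) _.
have -> : n%:R * (L * `|grid R n i - grid R n j|) = \sum_(l < n) L * `|grid R n i - grid R n j|.
  by rewrite sumr_const card_ord mulr_natl.
apply: ler_sum => l _.
exact: (lip_fst (grid01 R l)) (grid01 R i) (grid01 R j).
Qed.

Definition kmatrix_lip_const : R := L + 2 * L * (1 + c).

Lemma kmatrix_lip n (i i' j : 'I_n) : 1 / 4 <= kmean n ->
  (forall i : 'I_n, `|kweight i - 1| <= c / n%:R) -> i' = i.+1 :> nat ->
  `|kmatrix i' j - kmatrix i j| <= kmatrix_lip_const / n%:R ^+ 2.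
Proof.
move=> km u1 ii'; have n0 : (0 < n)%N by rewrite (leq_ltn_trans _ (ltn_ord i)).
have n0' : 0 < n%:R :> R by rewrite ltr0n.
have n1 : 1 <= n%:R :> R by rewrite ler1n.
have gg : `|grid R n i' - grid R n i| = n%:R^-1.
  rewrite /grid ii'; have -> : i.+2%:R / n%:R - i.+1%:R / n%:R = n%:R^-1 :> R.
    by rewrite -!natr1; field; rewrite gt_eqF.
  by rewrite ger0_norm // invr_ge0 ler0n.
rewrite /kmatrix -mulrBr normrM ger0_norm ?invr_ge0 ?ler0n //.
have -> : kmatrix_lip_const / n%:R ^+ 2 = n%:R^-1 * (kmatrix_lip_const / n%:R).
  by field; rewrite gt_eqF.
rewrite ler_wpM2l ?invr_ge0 ?ler0n //.
have -> : rho (grid R n i', grid R n j) - kweight i' * kweight j -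
    (rho (grid R n i, grid R n j) - kweight i * kweight j) =
  (rho (grid R n i', grid R n j) - rho (grid R n i, grid R n j)) -
    (kweight i' - kweight i) * kweight j by ring.
apply: le_trans (ler_normB _ _) _; rewrite /kmatrix_lip_const [leRHS]mulrDl; apply: lerD.
  by rewrite -gg; exact: (rk_lip rk (grid01 R j)) (grid01 R i') (grid01 R i).
rewrite normrM mulrAC; apply: ler_pM => //; first by rewrite -gg; exact: kweight_lip.
have c0 := weight_const_ge0.
have : `|kweight j - 1| <= c.
  by apply: le_trans (u1 j) _; rewrite ler_pdivrMr // ler_peMr.
move=> h; have -> : kweight j = (kweight j - 1) + 1 by ring.
by apply: le_trans (ler_normD _ _) _; rewrite normr1 addrC lerD2l.
Qed.

Definition kmatrix_bound_const : R := M + (1 + c) ^+ 2.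

Lemma kmatrix_bound n (i j : 'I_n) :
  (forall i : 'I_n, `|kweight i - 1| <= c / n%:R) ->
  `|kmatrix i j| <= kmatrix_bound_const / n%:R.
Proof.
move=> u1; have n0 : (0 < n)%N by rewrite (leq_ltn_trans _ (ltn_ord i)).
have n0' : 0 < n%:R :> R by rewrite ltr0n.
have n1 : 1 <= n%:R :> R by rewrite ler1n.
have c0 := weight_const_ge0.
have ub (l : 'I_n) : `|kweight l| <= 1 + c.
  have h : `|kweight l - 1| <= c.
    by apply: le_trans (u1 l) _; rewrite ler_pdivrMr // ler_peMr.
  have -> : kweight l = (kweight l - 1) + 1 by ring.
  by apply: le_trans (ler_normD _ _) _; rewrite normr1 addrC lerD2l.
rewrite /kmatrix normrM ger0_norm ?invr_ge0 ?ler0n // mulrC ler_wpM2r ?invr_ge0 ?ler0n //.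
apply: le_trans (ler_normB _ _) _; apply: lerD; first exact: (rk_bound rk) (grid01 R i) (grid01 R j).
by rewrite normrM expr2; apply: ler_pM.
Qed.

End KernelMatrix.

(** * Limits along an ultrafilter *)

Lemma ultra_fmap (T U : Type) (f : T -> U) (F : set_system T) :
  UltraFilter F -> UltraFilter (f @ F).
Proof.
move=> FU; apply: Build_UltraFilter => G GP sG.
apply/seteqP; split => [A GA|]; last exact: sG.
rewrite /fmap /=; have [//|nA] := in_ultra_setVsetC (f @^-1` A) FU.
have : G (~` A) by apply: sG; rewrite /fmap /=; exact: nA.
move=> GnA; exfalso; apply: (@filter_not_empty _ G GP).
by rewrite -(setICr A); exact: (@filterI _ G _ _ _ GA GnA).
Qed.

Lemma ultra_cvg (R : realType) (T : Type) (F : set_system T) (f : T -> R) (B : R) :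
  UltraFilter F -> (\forall x \near F, `|f x| <= B) ->
  f x @[x --> F] --> lim (f x @[x --> F]).
Proof.
move=> FU fB.
have cB : compact `[- B, B]%classic := @segment_compact R _ _.
have UfF := ultra_fmap f FU.
rewrite compact_ultra in cB.
have [|l [_ fl]] := cB (f x @[x --> F]) UfF.
  apply: filterS fB => x; rewrite /= in_itv /= ler_norml; by [].
by apply: cvgP fl.
Qed.

(** If a neighbourhood [A] of [l] were not reached eventually, the indices outside it would generate
    a proper filter finer than [\oo], and an ultrafilter above that filter would contradict the
    hypothesis. *)
Lemma cvg_ultra_all (R : realType) (u : nat -> R) (l : R) :
  (forall U : set_system nat, UltraFilter U -> \oo `<=` U -> u n @[n --> U] --> l) ->
  u n @[n --> \oo] --> l.
Proof.
move=> H A lA; rewrite /fmap /=; apply: contrapT => nA.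
pose B := u @^-1` A.
have PB : ProperFilter (within (~` B) \oo).
  split; last exact: within_filter.
  rewrite /within /= => h; apply: nA; apply: filterS h => n /=.
  by move=> h; apply: contrapT.
have [U [UU sU]] := ultraFilterLemma PB.
have oU : \oo `<=` U.
  move=> C oC; apply: sU; rewrite /within /=; apply: filterS oC => n; by [].
have := H U UU oU A lA; rewrite /fmap /= => UB.
have : U (~` B) by apply: sU; rewrite /within /=; exact: filterE.
move=> UnB; apply: (@filter_not_empty _ U ultra_proper).
by rewrite -(setICr B); exact: (@filterI _ U _ _ _ UB UnB).
Qed.

(** * Uniform bounds on the eigenvalues of the grid matrices *)

Section EigenLimit.
Variables (R : realType) (rho : R * R -> R) (L C M : R).
Hypothesis rk : regular_kernel rho L C M.
Local Notation c := (weight_const L C).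
Local Notation KL := (kmatrix_lip_const L C).
Local Notation KM := (kmatrix_bound_const L C M).

(** Letters are numbered by natural numbers, so that one letter can be followed as [n] varies; past
    the size of the matrix its eigenvalue is set to 0. *)
Record eigen_family (v : forall n, nat -> 'I_n -> R) (ka : nat -> nat -> R) : Prop := {
  ef_orth : forall n a b, (a < n)%N -> (b < n)%N ->
    \sum_j v n a j * v n b j = (a == b)%:R;
  ef_eig : forall n a (i : 'I_n), (a < n)%N ->
    \sum_j kmatrix rho i j * v n a j = ka n a * v n a i;
  ef_sorted : forall n a b, (a <= b)%N -> `|ka n b| <= `|ka n a|;
  ef_out : forall n a, (n <= a)%N -> ka n a = 0 }.

Lemma eigen_family_exists : exists v ka, eigen_family v ka.
Proof.
have H0 n := symmetric_eigenbasis (@kmatrix_sym R rho L C M rk n).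
pose v0 n := projT1 (cid (H0 n)).
pose k0 n := projT1 (cid (projT2 (cid (H0 n)))).
have H n := projT2 (cid (projT2 (cid (H0 n)))); rewrite -/(k0 _) -/(v0 _) in H.
exists (fun n a j => if insub a is Some i then v0 n i j else 0).
exists (fun n a => if insub a is Some i then k0 n i else 0); split.
- move=> n a b an bn; rewrite (insubT (fun i => i < n)%N an) (insubT (fun i => i < n)%N bn) /=.
  by have [-> _ _] := H n.
- move=> n a i an; rewrite (insubT (fun i => i < n)%N an) /=.
  by have [_ -> _] := H n.
- move=> n a b ab; case: insubP => [j bn jb|]; last by rewrite normr0.
  have an : (a < n)%N by rewrite (leq_ltn_trans ab).
  rewrite (insubT (fun i => i < n)%N an) /=; have [_ _] := H n; apply.
  by rewrite /= jb.
by move=> n a na; rewrite insubF // ltnNge na.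
Qed.

Variables (v : forall n, nat -> 'I_n -> R) (ka : nat -> nat -> R).
Arguments v : clear implicits.
Hypothesis ef : eigen_family v ka.

Definition good n := [/\ (0 < n)%N, 1 / 4 <= kmean rho n,
   forall i : 'I_n, 0 < kweight rho i & forall i : 'I_n, `|kweight rho i - 1| <= c / n%:R].

Lemma near_good : \forall n \near \oo, good n.
Proof. exact: kweight_bounds rk. Qed.

Let orth n (a b : 'I_n) : \sum_j v n a j * v n b j = (a == b)%:R.
Proof. by rewrite (ef_orth ef). Qed.

Let eig n (a i : 'I_n) : \sum_j kmatrix rho i j * v n a j = ka n a * v n a i.
Proof. by rewrite (ef_eig ef). Qed.

Lemma ev_norm1 n a : (a < n)%N -> \sum_j v n a j ^+ 2 = 1.
Proof.
move=> an; under eq_bigr do rewrite expr2.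
by rewrite (ef_orth ef) // eqxx.
Qed.

(** The symmetric matrix annihilates constants, so eigenvectors for other eigenvalues are orthogonal
    to them. *)
Lemma ev_sum0 n a : good n -> ka n a != 0 -> \sum_j v n a j = 0.
Proof.
move=> [n0 km _ _] ka0.
have an : (a < n)%N by rewrite ltnNge; apply: contraNN ka0 => /(ef_out ef) ->.
apply: (mulfI ka0); rewrite mulr0 mulr_sumr.
under eq_bigr => i _ do rewrite -(ef_eig ef) //.
rewrite exchange_big big1 //= => j _; rewrite -mulr_suml.
under eq_bigr => i _ do rewrite (kmatrix_sym rk).
by rewrite (kmatrix_sum0 rk) ?mul0r //; lra.
Qed.

Lemma KM_ge0 : 0 <= KM.
Proof. by rewrite /kmatrix_bound_const addr_ge0 ?sqr_ge0 // (rk_M rk). Qed.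

Lemma KL_ge0 : 0 <= KL.
Proof.
have L0 := rk_L rk; have c0 := weight_const_ge0 rk.
by rewrite addr_ge0 // mulr_ge0 ?mulr_ge0 // addr_ge0.
Qed.

Lemma ka_le n a : good n -> `|ka n a| <= KM.
Proof.
move=> [n0 km u0 u1].
have n0' : 0 < n%:R :> R by rewrite ltr0n.
have [an|na] := ltnP a n; last by rewrite (ef_out ef) // normr0 KM_ge0.
rewrite -(@ler_pXn2r _ 2) ?nnegrE ?KM_ge0 // real_normK ?num_real //.
have -> : ka n a ^+ 2 = \sum_i (\sum_j kmatrix rho i j * v n a j) ^+ 2.
  under eq_bigr => i _ do rewrite (ef_eig ef) // exprMn.
  by rewrite -mulr_sumr ev_norm1 ?mulr1.
apply: le_trans (_ : \sum_(i < n) (KM ^+ 2 / n%:R) <= _); last first.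
  by rewrite sumr_const card_ord -[leLHS]mulr_natl mulrCA divff ?mulr1 // gt_eqF.
apply: ler_sum => i _; apply: le_trans (cauchy_schwarz_sum _ _) _.
rewrite ev_norm1 // mulr1.
apply: le_trans (_ : \sum_(j < n) (KM / n%:R) ^+ 2 <= _).
  apply: ler_sum => j _; rewrite -real_normK ?num_real // lerXn2r ?nnegrE //.
    by rewrite divr_ge0 ?KM_ge0 // ltW.
  exact: (kmatrix_bound rk).
rewrite sumr_const card_ord -[leLHS]mulr_natl.
by rewrite le_eqVlt; apply/orP; left; apply/eqP; field; rewrite gt_eqF.
Qed.

(** The right side is made small by first taking [m] large, which settles the second term, and then
    [d] large in terms of [m]. *)
Lemma ka_tail n d m : good n -> (0 < m)%N -> (m <= n)%N ->
  \sum_(a < n | (d <= a)%N) `|ka n a| <=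
  `|ka n d| * m.+1%:R + KL * Num.sqrt (2 / m%:R).
Proof.
move=> [n0 km u0 u1] m0 mn.
have n0' : 0 < n%:R :> R by rewrite ltr0n.
have m0' : 0 < m%:R :> R by rewrite ltr0n.
(* This gives at most [m + 1] blocks, of length at most [2 n / m]. *)
pose b := (n %/ m).+1.
have := @trace_tail R n b (@kmatrix R rho n) KL `|ka n d| (fun a j => v n a j)
  (fun a => ka n a) (fun a => d <= a)%N isT KL_ge0 (normr_ge0 _) (@orth n) (@eig n) _ _.
move=> /(_ _ _)/le_trans; apply.
- by move=> i i' j ii'; apply: (kmatrix_lip rk).
- by move=> a da; exact: (ef_sorted ef).
apply: lerD.
  rewrite ler_wpM2l // ler_nat ltnS.
  have := leq_divM n m; have := ltn_ceil n m0; rewrite -/b => h1 h2.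
  by rewrite -ltnS ltn_divLR //; nia.
rewrite ler_wpM2l ?KL_ge0 // ler_sqrt ?divr_ge0 ?ler0n //.
rewrite ler_pdivlMr // mulrAC ler_pdivrMr // -natrM -(natrM _ 2) ler_nat.
by have := leq_divM n m; rewrite /b; nia.
Qed.

(** The bound of [ka_tail] at [d = 0] and [m = 1]. *)
Definition trace_const : R := 2 * KM + KL * Num.sqrt 2.

Lemma sum_ka_le n : good n -> \sum_(a < n) `|ka n a| <= trace_const.
Proof.
move=> gn; have [n0 _ _ _] := gn.
have := ka_tail 0 gn (ltn0Sn 0) n0; rewrite divr1 => /le_trans; apply.
by rewrite lerD2r mulrC ler_wpM2l // ka_le.
Qed.

Lemma trace_const_ge0 : 0 <= trace_const.
Proof. by rewrite addr_ge0 ?mulr_ge0 ?KM_ge0 ?KL_ge0 ?sqrtr_ge0. Qed.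

Lemma ka_decay n a : good n -> `|ka n a| * a.+1%:R <= trace_const.
Proof.
move=> gn; have [an|na] := ltnP a n; last first.
  by rewrite (ef_out ef) // normr0 mul0r trace_const_ge0.
apply: le_trans (sum_ka_le gn).
rewrite mulr_natr -[a.+1]card_ord -sumr_const.
rewrite -(big_mkord predT (fun b => `|ka n b|)) (big_cat_nat (leq0n a.+1) an) /=.
rewrite big_mkord -[leLHS]addr0; apply: lerD; last by apply: sumr_ge0.
by apply: ler_sum => b _; apply: (ef_sorted ef); rewrite -ltnS.
Qed.

End EigenLimit.

(** * Riemann sums and uniform convergence on the grid along an ultrafilter *)

Section UltraRiemann.
Variables (R : realType) (U : set_system nat).
Hypotheses (UU : UltraFilter U) (oU : \oo `<=` U).

Let PU : ProperFilter U. Proof. exact: ultra_proper. Qed.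
#[local] Existing Instance PU.

Lemma ultra_gt m : \forall n \near U, (m < n)%N.
Proof. by apply: oU; exists m.+1 => // n /=. Qed.

Lemma ultra_invn : (n%:R^-1 : R) @[n --> U] --> (0 : R).
Proof. by apply: cvg_trans (@cvg_invn R) => A; exact: oU. Qed.

Lemma ultra_O_invn (f : nat -> R) (B : R) :
  (\forall n \near U, `|f n| <= B / n%:R) -> f n @[n --> U] --> (0 : R).
Proof.
move=> fB; have Bc : B / n%:R @[n --> U] --> (0 : R).
  by rewrite -[X in _ --> X](mulr0 B); apply: cvgM ultra_invn; exact: cvg_cst.
apply/cvgrPdist_le => e e0; move/cvgrPdist_le : Bc => /(_ e e0) Be.
near=> n; rewrite sub0r normrN.
apply: le_trans (_ : B / n%:R <= _); first by near: n.
by apply: le_trans (ler_norm _) _; rewrite -normrN -sub0r; near: n.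
Unshelve. all: end_near. Qed.

Definition unif01 (g : nat -> R -> R) (h : R -> R) :=
  forall e, 0 < e -> \forall n \near U, forall x, 0 <= x <= 1 -> `|g n x - h x| <= e.

(** As in the Arzela-Ascoli theorem: for functions with a common Lipschitz constant, closeness at
    the finitely many points [i / m] implies closeness everywhere. *)
Lemma ptws_unif01 (g : nat -> R -> R) (h : R -> R) (B : R) :
  (\forall n \near U, lip01 B (g n)) -> lip01 B h ->
  (forall x, 0 <= x <= 1 -> g n x @[n --> U] --> h x) -> unif01 g h.
Proof.
move=> gB hB gh e e0.
have B0 := lip01_ge0 hB.
(* The two Lipschitz errors over one cell of this net add up to at most [e / 2]. *)
pose m := (Num.truncn (4 * B / e)).+1.
have m0 : 0 < m%:R :> R by rewrite ltr0n.
have mB : 2 * B / m%:R <= e / 2.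
  have : 4 * B / e <= m%:R by apply: ltW; exact: truncnS_gt.
  by rewrite ler_pdivrMr // => h1; rewrite ler_pdivrMr //; lra.
have Sc : \sum_(i < m.+1) `|g n (i%:R / m%:R) - h (i%:R / m%:R)| @[n --> U] --> (0 : R).
  rewrite -[X in _ --> X](_ : \sum_(i < m.+1) (0 : R) = 0); last by rewrite big1.
  apply: cvg_sumr => i; rewrite -(normr0 R); apply: cvg_norm.
  rewrite -(subrr (h (i%:R / m%:R))); apply: cvgB; last exact: cvg_cst.
  by apply: gh; rewrite divr_ge0 //= ler_pdivrMr // mul1r ler_nat -ltnS.
move/cvgrPdist_le : Sc => /(_ (e / 2)); rewrite divr_gt0 // => /(_ isT) Sc.
near=> n => x x01.
have gn : lip01 B (g n) by near: n.
have : `|0 - \sum_(i < m.+1) `|g n (i%:R / m%:R) - h (i%:R / m%:R)| | <= e / 2 by near: n.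
rewrite sub0r normrN ger0_norm; last by apply: sumr_ge0.
move=> Sn; have /andP[x0 x1] := x01.
pose i := Num.truncn (x * m%:R).
have xm0 : 0 <= x * m%:R by rewrite mulr_ge0 // ltW.
have ix : i%:R <= x * m%:R by rewrite truncn_le.
have xi : x * m%:R < i.+1%:R by exact: truncnS_gt.
have im : (i < m.+1)%N.
  rewrite ltnS -(ler_nat R) (le_trans ix) // ler_piMl // ltW //.
pose t : R := i%:R / m%:R.
have t01 : 0 <= t <= 1 by rewrite /t divr_ge0 ?(ltW m0) //= ler_pdivrMr // mul1r ler_nat -ltnS.
have xt : `|x - t| <= m%:R^-1.
  have tm : t * m%:R = i%:R by rewrite /t mulfVK // gt_eqF.
  rewrite ger0_norm; last by rewrite subr_ge0 /t ler_pdivrMr.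
  by rewrite -(ler_pM2r m0) mulrBl tm mulVf ?gt_eqF //; rewrite -natr1 in xi; lra.
have ht : `|g n t - h t| <= e / 2.
  apply: le_trans Sn; rewrite (bigD1 (Ordinal im)) //= lerDl.
  by apply: sumr_ge0.
have -> : g n x - h x = (g n x - g n t) - (h x - h t) + (g n t - h t) by ring.
apply: le_trans (ler_normD _ _) _.
have h1 : `|g n x - g n t| <= B / m%:R by apply: le_trans (gn _ _ x01 t01) _; rewrite ler_wpM2l.
have h2 : `|h x - h t| <= B / m%:R by apply: le_trans (hB _ _ x01 t01) _; rewrite ler_wpM2l.
have := ler_normB (g n x - g n t) (h x - h t).
by move: mB; have -> : 2 * B / m%:R = B / m%:R + B / m%:R by [field; rewrite gt_eqF|]; lra.
Unshelve. all: end_near. Qed.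

Definition grid_unif (H : forall n, 'I_n -> R) (h : R -> R) :=
  forall e, 0 < e -> \forall n \near U, forall i : 'I_n, `|H n i - h (grid R n i)| <= e.

Lemma grid_unif_cvg (H : forall n, 'I_n -> R) (h : R -> R) (B : R) :
  lip01 B h -> grid_unif H h ->
  n%:R^-1 * (\sum_(i < n) H n i) @[n --> U] --> int01 h.
Proof.
move=> hB Hh.
have h1 : n%:R^-1 * (\sum_(i < n) h (grid R n i)) @[n --> U] --> int01 h.
  by apply: cvg_trans (riemann_cvg hB) => A; exact: oU.
have h2 : n%:R^-1 * (\sum_(i < n) (H n i - h (grid R n i))) @[n --> U] --> (0 : R).
  apply/cvgrPdist_le => e e0; have Hn := Hh e e0; near=> n.
  have n0 : 0 < n%:R :> R by rewrite ltr0n; near: n; apply: oU; exists 1%N.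
  rewrite sub0r normrN normrM ger0_norm ?invr_ge0 ?(ltW n0) // ler_pdivrMl //.
  apply: le_trans (ler_norm_sum _ _ _) _.
  apply: le_trans (_ : \sum_(i < n) e <= _).
    by apply: ler_sum => i _; move: i; near: n.
  by rewrite sumr_const card_ord mulr_natl.
have hc : (n%:R^-1 * (\sum_(i < n) (H n i - h (grid R n i))) +
    n%:R^-1 * (\sum_(i < n) h (grid R n i))) @[n --> U] --> 0 + int01 h by apply: cvgD.
rewrite add0r in hc; apply: cvg_near_eq hc; near=> n.
by rewrite /= -mulrDr -big_split; congr (_ * _); apply: eq_bigr => i _ /=; rewrite subrK.
Unshelve. all: end_near. Qed.

Lemma lip01_bounded (B : R) (h : R -> R) x : lip01 B h -> 0 <= x <= 1 ->
  `|h x| <= `|h 0| + B.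
Proof.
move=> hB x01; have -> : h x = h 0 + (h x - h 0) by ring.
apply: le_trans (ler_normD _ _) _; rewrite lerD2l.
apply: le_trans (hB _ _ x01 _) _; first by rewrite lexx ler01.
have B0 := lip01_ge0 hB.
by rewrite subr0 ler_piMr //; have /andP[x0 x1] := x01; rewrite ger0_norm.
Qed.

Lemma lip01M (B B' : R) (f g : R -> R) : lip01 B f -> lip01 B' g ->
  lip01 (B * (`|g 0| + B') + (`|f 0| + B) * B') (fun x => f x * g x).
Proof.
move=> fB gB x y x01 y01.
have -> : f x * g x - f y * g y = (f x - f y) * g x + f y * (g x - g y) by ring.
apply: le_trans (ler_normD _ _) _; rewrite [leRHS]mulrDl; apply: lerD; rewrite normrM.
  by rewrite mulrAC; apply: ler_pM => //; [exact: fB|exact: lip01_bounded gB x01].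
by rewrite -mulrA; apply: ler_pM => //; [exact: lip01_bounded fB y01|exact: gB].
Qed.

Lemma grid_unifM (H H' : forall n, 'I_n -> R) (h h' : R -> R) (B B' : R) :
  lip01 B h -> lip01 B' h' -> grid_unif H h -> grid_unif H' h' ->
  grid_unif (fun n i => H n i * H' n i) (fun x => h x * h' x).
Proof.
move=> hB hB' Hh Hh' e e0.
pose b := `|h 0| + `|B| + 1; pose b' := `|h' 0| + `|B'| + 1.
have b0 : 0 < b by rewrite /b ltr_wpDl ?addr_ge0.
have b'0 : 0 < b' by rewrite /b' ltr_wpDl ?addr_ge0.
pose d := Num.min 1 (e / (b + b' + 1)).
have s0 : 0 < b + b' + 1 by rewrite ltr_wpDl // ltW // addr_gt0.
have d0 : 0 < d by rewrite lt_min ltr01 divr_gt0.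
near=> n.
have H1 : forall i, `|H n i - h (grid R n i)| <= d by near: n; exact: Hh.
have H2 : forall i, `|H' n i - h' (grid R n i)| <= d by near: n; exact: Hh'.
move=> i; have h1 := H1 i; have h2 := H2 i.
have h3 : `|h (grid R n i)| <= b.
  apply: le_trans (lip01_bounded hB (grid01 R i)) _.
  by rewrite /b -addrA lerD2l (le_trans (ler_norm B)) // lerDl.
have h4 : `|h' (grid R n i)| <= b'.
  apply: le_trans (lip01_bounded hB' (grid01 R i)) _.
  by rewrite /b' -addrA lerD2l (le_trans (ler_norm B')) // lerDl.
have d1 : d <= 1 by rewrite ge_min lexx.
have de : d * (b + b' + 1) <= e.
  rewrite -ler_pdivlMr //.
  by rewrite ge_min lexx orbT.
set a := h (grid R n i); set a' := h' (grid R n i).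
have -> : H n i * H' n i - a * a' =
  (H n i - a) * (H' n i - a') + (H n i - a) * a' + a * (H' n i - a') by ring.
apply: le_trans (ler_normD _ _) _; apply: le_trans (lerD (ler_normD _ _) (lexx _)) _.
rewrite !normrM; apply: le_trans de.
have -> : d * (b + b' + 1) = d * 1 + d * b' + b * d by ring.
apply: lerD; [apply: lerD|]; apply: ler_pM => //.
by apply: le_trans d1.
Unshelve. all: end_near. Qed.

End UltraRiemann.

Lemma cvgr_unique (R : realType) (T : Type) (F : set_system T) (FF : ProperFilter F)
    (f : T -> R) (a b : R) :
  f x @[x --> F] --> a -> f x @[x --> F] --> b -> a = b.
Proof. by move=> fa fb; apply: (cvg_unique _ fa fb). Qed.

(** * Limits of eigenvalues and eigenvectors *)

Section EigenFunctions.
Variables (R : realType) (rho : R * R -> R) (L C M : R).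
Hypothesis rk : regular_kernel rho L C M.
Local Notation c := (weight_const L C).
Local Notation S := (trace_const L C M).
Variables (v : forall n, nat -> 'I_n -> R) (ka : nat -> nat -> R).
Arguments v : clear implicits.
Hypothesis ef : eigen_family rho v ka.
Variable U : set_system nat.
Hypotheses (UU : UltraFilter U) (oU : \oo `<=` U).

Let PU : ProperFilter U. Proof. exact: ultra_proper. Qed.
#[local] Existing Instance PU.

Let U_good : \forall n \near U, good rho L C n.
Proof. by apply: oU; exact: near_good rk. Qed.

Definition lam a : R := lim (ka n a @[n --> U]).

Lemma lam_cvg a : ka n a @[n --> U] --> lam a.
Proof.
apply: ultra_cvg (kmatrix_bound_const L C M) UU _.
by near=> n; apply: (ka_le rk ef); near: n.
Unshelve. all: end_near. Qed.

Lemma lam_decay a : `|lam a| * a.+1%:R <= S.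
Proof.
have h : `|ka n a| * a.+1%:R @[n --> U] --> `|lam a| * a.+1%:R.
  by apply: cvgM; [apply: cvg_norm; exact: lam_cvg|exact: cvg_cst].
apply: (cvgr_to_le h).
by near=> n; apply: (ka_decay rk ef); near: n.
Unshelve. all: end_near. Qed.

Lemma lam_sorted a b : (a <= b)%N -> `|lam b| <= `|lam a|.
Proof.
move=> ab; rewrite -subr_ge0.
have h : `|ka n a| - `|ka n b| @[n --> U] --> `|lam a| - `|lam b|.
  by apply: cvgB; apply: cvg_norm; exact: lam_cvg.
apply: (cvgr_to_ge h).
by near=> n; rewrite subr_ge0; exact: (ef_sorted ef).
Unshelve. all: end_near. Qed.

(** Nystrom's extension of [sqrt n] times the eigenvector from the grid to the interval, read off
    the eigenvalue equation. It is Lipschitz in [x] because [rho] is. The rank-one part of the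
    kernel is left out, which costs only [O(1/n)] on the grid; see [phi_grid]. *)
Definition efun n a x : R :=
  (ka n a * Num.sqrt n%:R)^-1 * \sum_(j < n) rho (x, grid R n j) * v n a j.

Definition phi a x : R := lim (efun n a x @[n --> U]).

Lemma sum_norm_ev_le n a (x : 'I_n -> R) B : (a < n)%N -> 0 <= B ->
  (forall j, `|x j| <= B) -> `|\sum_j x j * v n a j| <= B * Num.sqrt n%:R.
Proof.
move=> an B0 xB; apply: le_trans (ler_norm_sum _ _ _) _.
rewrite -[leRHS]mulr1; apply: sum_norm_mul_le => //; rewrite ?mulr_ge0 ?sqrtr_ge0 //.
  rewrite exprMn sqr_sqrtr ?ler0n // mulr_natr -[n in leRHS]card_ord -sumr_const.
  apply: ler_sum => j _; rewrite -real_normK ?num_real //.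
  by rewrite lerXn2r ?nnegrE.
by rewrite expr1n (ev_norm1 ef).
Qed.

Section NonzeroEigenvalue.
Variable a : nat.
Hypothesis lam0 : lam a != 0.

Lemma near_ka : \forall n \near U, `|lam a| / 2 <= `|ka n a|.
Proof.
have l0 : 0 < `|lam a| by rewrite normr_gt0.
have /cvgrPdist_le/(_ (`|lam a| / 2)) := @lam_cvg a; rewrite divr_gt0 // => /(_ isT) h.
near=> n.
have : `|lam a - ka n a| <= `|lam a| / 2 by near: n.
have := ler_normD (lam a - ka n a) (ka n a); rewrite subrK; lra.
Unshelve. all: end_near. Qed.

Lemma near_efun (x : nat -> nat -> R) B : 0 <= B ->
  (\forall n \near U, forall j : 'I_n, `|x n j| <= B) ->
  \forall n \near U, `|(ka n a * Num.sqrt n%:R)^-1 * \sum_(j < n) x n j * v n a j| <=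
    2 * B / `|lam a|.
Proof.
move=> B0 xB; have l0 : 0 < `|lam a| by rewrite normr_gt0.
near=> n.
have an : (a < n)%N by near: n; exact: ultra_gt.
have n0 : 0 < n%:R :> R by rewrite ltr0n (leq_ltn_trans _ an).
have s0 : 0 < Num.sqrt n%:R :> R by rewrite sqrtr_gt0.
have kn : `|lam a| / 2 <= `|ka n a| by near: n; exact: near_ka.
have k0 : 0 < `|ka n a| by apply: lt_le_trans kn; rewrite divr_gt0.
have h : `|\sum_(j < n) x n j * v n a j| <= B * Num.sqrt n%:R.
  by apply: (@sum_norm_ev_le n a (fun j => x n j)) => //; near: n.
rewrite normrM normfV normrM (gtr0_norm s0).
apply: le_trans (ler_wpM2l _ h) _; first by rewrite invr_ge0 mulr_ge0 // ltW.
rewrite ler_pdivlMr //.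
have -> : (`|ka n a| * Num.sqrt n%:R)^-1 * (B * Num.sqrt n%:R) * `|lam a| =
   B * (`|lam a| / `|ka n a|) by field; rewrite !gt_eqF.
rewrite [leRHS]mulrC ler_wpM2l // ler_pdivrMr //; lra.
Unshelve. all: end_near. Qed.

Lemma efun_bound x : 0 <= x <= 1 ->
  \forall n \near U, `|efun n a x| <= 2 * M / `|lam a|.
Proof.
move=> x01; apply: (near_efun (x := fun n j => rho (x, grid R n j))); first exact: (rk_M rk).
by near=> n => j; apply: (rk_bound rk) => //; exact: grid01.
Unshelve. all: end_near. Qed.

Definition phi_lip_const : R := 2 * L / `|lam a|.

Lemma efun_lip : \forall n \near U, lip01 phi_lip_const (efun n a).
Proof.
have l0 : 0 < `|lam a| by rewrite normr_gt0.
near=> n => x y x01 y01.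
have an : (a < n)%N by near: n; exact: ultra_gt.
have n0 : 0 < n%:R :> R by rewrite ltr0n (leq_ltn_trans _ an).
have s0 : 0 < Num.sqrt n%:R :> R by rewrite sqrtr_gt0.
have kn : `|lam a| / 2 <= `|ka n a| by near: n; exact: near_ka.
have k0 : 0 < `|ka n a| by apply: lt_le_trans kn; rewrite divr_gt0.
rewrite /efun -mulrBr -sumrB.
rewrite (eq_bigr (fun j : 'I_n => (rho (x, grid R n j) - rho (y, grid R n j)) * v n a j)); last first.
  by move=> j _; rewrite mulrBl.
have L0 := rk_L rk.
have h := @sum_norm_ev_le n a (fun j => rho (x, grid R n j) - rho (y, grid R n j))
  (L * `|x - y|) an (mulr_ge0 L0 (normr_ge0 _))
  (fun j => rk_lip rk (grid01 R j) x01 y01).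
rewrite normrM normfV normrM (gtr0_norm s0).
apply: le_trans (ler_wpM2l _ h) _; first by rewrite invr_ge0 mulr_ge0 // ltW.
rewrite /phi_lip_const [leRHS]mulrAC ler_pdivlMr //.
have -> : (`|ka n a| * Num.sqrt n%:R)^-1 * (L * `|x - y| * Num.sqrt n%:R) * `|lam a| =
   L * `|x - y| * (`|lam a| / `|ka n a|) by field; rewrite !gt_eqF.
have -> : 2 * L * `|x - y| = L * `|x - y| * 2 by ring.
by rewrite ler_wpM2l ?mulr_ge0 // ler_pdivrMr //; lra.
Unshelve. all: end_near. Qed.

Lemma phi_cvg x : 0 <= x <= 1 -> efun n a x @[n --> U] --> phi a x.
Proof. by move=> x01; apply: ultra_cvg UU _; exact: efun_bound. Qed.

Lemma phi_lip : lip01 phi_lip_const (phi a).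
Proof.
move=> x y x01 y01.
have h : `|efun n a x - efun n a y| @[n --> U] --> `|phi a x - phi a y|.
  by apply: cvg_norm; apply: cvgB; exact: phi_cvg.
apply: (cvgr_to_le h).
have hn := efun_lip; near=> n.
have : lip01 phi_lip_const (efun n a) by near: n.
exact.
Unshelve. all: end_near. Qed.

(** On the grid, [efun] and the scaled eigenvector differ by the rank-one part applied to the
    eigenvector, a multiple of [w]. As the eigenvector sums to 0, [w] only involves [kweight j - 1],
    and the difference has order [1 / n]. The convergence of [efun] is uniform by [ptws_unif01]. *)
Lemma phi_grid : grid_unif U (fun n i => Num.sqrt n%:R * v n a i) (phi a).
Proof.
move=> e e0; have l0 : 0 < `|lam a| by rewrite normr_gt0.
have e2 : 0 < e / 2 by rewrite divr_gt0.
have hu := ptws_unif01 UU efun_lip phi_lip (fun x => @phi_cvg x) e2.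
have h0 := @ultra_O_invn R U UU oU (fun n => 4 * c / `|lam a| / n%:R) (4 * c / `|lam a|).
have c0 := weight_const_ge0 rk.
have {h0} : 4 * c / `|lam a| / n%:R @[n --> U] --> (0 : R).
  apply: h0; near=> n; rewrite ger0_norm //.
  by rewrite divr_ge0 ?ler0n // divr_ge0 // mulr_ge0.
move=> /cvgrPdist_le/(_ (e / 2)); rewrite divr_gt0 // => /(_ isT) hO.
near=> n => i.
have hn : forall x, 0 <= x <= 1 -> `|efun n a x - phi a x| <= e / 2 by near: n.
have gn : good rho L C n by near: n.
have [n0 km u0 u1] := gn.
have an : (a < n)%N by near: n; exact: ultra_gt.
have kn : `|lam a| / 2 <= `|ka n a| by near: n; exact: near_ka.
have k0 : 0 < `|ka n a| by apply: lt_le_trans kn; rewrite divr_gt0.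
have k0' : ka n a != 0 by rewrite -normr_gt0.
have n0' : 0 < n%:R :> R by rewrite ltr0n.
have n1 : 1 <= n%:R :> R by rewrite ler1n.
have s0 : 0 < Num.sqrt n%:R :> R by rewrite sqrtr_gt0.
have s2 : Num.sqrt n%:R ^+ 2 = n%:R :> R by rewrite sqr_sqrtr // ltW.
pose w := \sum_j (kweight rho j - 1) * v n a j.
have wE : \sum_j kweight rho j * v n a j = w.
  rewrite /w; under [RHS]eq_bigr => j _ do rewrite mulrBl mul1r.
  by rewrite sumrB (ev_sum0 rk ef gn k0') subr0.
have wle : `|w| <= c / n%:R * Num.sqrt n%:R.
  by apply: sum_norm_ev_le => //; rewrite divr_ge0 // ltW.
have E : efun n a (grid R n i) - Num.sqrt n%:R * v n a i =
    (ka n a * Num.sqrt n%:R)^-1 * (kweight rho i * w).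
  have := ef_eig ef i an.
  rewrite /kmatrix; under eq_bigr => j _ do rewrite -mulrA mulrBl.
  rewrite -mulr_sumr sumrB.
  under [X in _ - X]eq_bigr => j _ do rewrite -mulrA.
  rewrite -mulr_sumr wE => h.
  have -> : efun n a (grid R n i) = (ka n a * Num.sqrt n%:R)^-1 *
     (n%:R * (ka n a * v n a i) + kweight rho i * w).
    rewrite -h /efun mulrA divff ?gt_eqF // mul1r subrK //.
  move: (Num.sqrt n%:R) s0 s2 {h wle} => s s0 s2.
  by rewrite -s2; field; rewrite k0' gt_eqF.
have Eb : `|efun n a (grid R n i) - Num.sqrt n%:R * v n a i| <= e / 2.
  have : `|0 - 4 * c / `|lam a| / n%:R| <= e / 2 by near: n.
  rewrite sub0r normrN => /(le_trans (ler_norm _)); apply: le_trans.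
  rewrite E normrM normfV normrM (gtr0_norm s0) normrM.
  have ui : `|kweight rho i| <= 2.
    have := u0 i; have := u1 i.
    have : c / n%:R <= 1.
      rewrite ler_pdivrMr // mul1r; near: n; apply: oU; exact: nbhs_infty_ger.
    by move=> h1 h2 h3; rewrite gtr0_norm //; move: h2; rewrite ler_norml; lra.
  apply: le_trans (_ : (`|ka n a| * Num.sqrt n%:R)^-1 * (2 * (c / n%:R * Num.sqrt n%:R)) <= _).
    rewrite ler_wpM2l ?invr_ge0 ?mulr_ge0 ?(ltW s0) //; exact: ler_pM.
  have -> : (`|ka n a| * Num.sqrt n%:R)^-1 * (2 * (c / n%:R * Num.sqrt n%:R)) =
     2 * c / n%:R * `|ka n a|^-1 by field; rewrite !gt_eqF.
  have -> : 4 * c / `|lam a| / n%:R = 2 * c / n%:R * (`|lam a| / 2)^-1 by field; rewrite !gt_eqF.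
  rewrite ler_wpM2l ?divr_ge0 ?mulr_ge0 ?(ltW n0') //.
  by rewrite lef_pV2 ?posrE ?divr_gt0.
have h1 := hn _ (grid01 R i).
have -> : Num.sqrt n%:R * v n a i - phi a (grid R n i) =
    (efun n a (grid R n i) - phi a (grid R n i)) -
    (efun n a (grid R n i) - Num.sqrt n%:R * v n a i) by ring.
apply: le_trans (ler_normB _ _) _; apply: le_trans (lerD h1 Eb) _; lra.
Unshelve. all: end_near. Qed.

End NonzeroEigenvalue.
Lemma grid_unif_refl (g : R -> R) : grid_unif U (fun n i => g (grid R n i)) g.
Proof. by move=> e e0; near=> n => i; rewrite subrr normr0 ltW. Unshelve. all: end_near. Qed.

Let sqrt_n n : (0 < n)%N -> n%:R^-1 * Num.sqrt n%:R = (Num.sqrt n%:R)^-1 :> R.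
Proof.
move=> n0; have s0 : Num.sqrt n%:R != 0 :> R by rewrite gt_eqF // sqrtr_gt0 ltr0n.
have s2 : Num.sqrt n%:R ^+ 2 = n%:R :> R by rewrite sqr_sqrtr // ler0n.
by move: (Num.sqrt n%:R) s0 s2 => s s0 <-; field.
Qed.

Lemma phi_coef_cvg a g B : lam a != 0 -> lip01 B g ->
  (Num.sqrt n%:R)^-1 * (\sum_(i < n) g (grid R n i) * v n a i) @[n --> U] -->
  int01 (fun x => g x * phi a x).
Proof.
move=> la gB; have hM := grid_unifM UU gB (phi_lip la) (@grid_unif_refl g) (phi_grid la).
have h := grid_unif_cvg UU oU (lip01M gB (phi_lip la)) hM.
apply: cvg_near_eq h; near=> n.
have n0 : (0 < n)%N by near: n; exact: ultra_gt.
rewrite -sqrt_n // -mulrA; congr (_ * _); rewrite mulr_sumr.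
by apply: eq_bigr => i _; ring.
Unshelve. all: end_near. Qed.

Lemma near_lam_neq0 a : lam a != 0 -> \forall n \near U, ka n a != 0.
Proof.
move=> la; have h := near_ka la; near=> n.
have kn : `|lam a| / 2 <= `|ka n a| by near: n.
by rewrite -normr_gt0; apply: lt_le_trans kn; rewrite divr_gt0 // normr_gt0.
Unshelve. all: end_near. Qed.

Lemma phi_mean0 a : lam a != 0 -> int01 (phi a) = 0.
Proof.
move=> la; have h := grid_unif_cvg UU oU (phi_lip la) (phi_grid la).
have hk := near_lam_neq0 la.
have h0 : (fun=> (0 : R)) n @[n --> U] --> int01 (phi a).
  apply: cvg_near_eq h; near=> n; rewrite -mulr_sumr.
  by rewrite (ev_sum0 rk ef) ?mulr0 //; near: n.
exact: cvgr_unique h0 (cvg_cst _).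
Unshelve. all: end_near. Qed.

Lemma phi_orth a b : lam a != 0 -> lam b != 0 ->
  int01 (fun x => phi a x * phi b x) = (a == b)%:R.
Proof.
move=> la lb; have hM := grid_unifM UU (phi_lip la) (phi_lip lb) (phi_grid la) (phi_grid lb).
have h := grid_unif_cvg UU oU (lip01M (phi_lip la) (phi_lip lb)) hM.
have h0 : (fun=> (a == b)%:R : R) n @[n --> U] --> int01 (fun x => phi a x * phi b x).
  apply: cvg_near_eq h; near=> n.
  have an : (a < n)%N by near: n; exact: ultra_gt.
  have bn : (b < n)%N by near: n; exact: ultra_gt.
  rewrite -(ef_orth ef an bn) mulr_sumr; apply: eq_bigr => i _.
  have n0 : 0 < n%:R :> R by rewrite ltr0n (leq_ltn_trans _ an).
  rewrite (_ : n%:R^-1 * _ = n%:R^-1 * Num.sqrt n%:R ^+ 2 * (v n a i * v n b i)); last by ring.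
  by rewrite sqr_sqrtr ?(ltW n0) // mulVf ?mul1r // gt_eqF.
exact: cvgr_unique h0 (cvg_cst _).
Unshelve. all: end_near. Qed.

Lemma phi_eigen a x : lam a != 0 -> 0 <= x <= 1 ->
  int01 (fun y => rho (x, y) * phi a y) = lam a * phi a x.
Proof.
move=> la x01; have h := phi_coef_cvg la (lip_fst rk x01).
have h0 : ka n a * efun n a x @[n --> U] --> lam a * phi a x.
  by apply: cvgM; [exact: lam_cvg|exact: phi_cvg].
apply: (cvgr_unique _ h); apply: cvg_near_eq h0; have hk := near_lam_neq0 la; near=> n.
have k0 : ka n a != 0 by near: n.
have n0 : (0 < n)%N by near: n; exact: ultra_gt.
have s0 : Num.sqrt n%:R != 0 :> R by rewrite gt_eqF // sqrtr_gt0 ltr0n.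
by rewrite /efun; field; rewrite k0 s0.
Unshelve. all: end_near. Qed.

(* Expand the grid values of [g] in the eigenvectors
   of the matrix; the eigenvalues of index at least [d] are at most [S/(d+1)],
   and the first [d] coefficients tend to 0. *)
Lemma phi_complete g B m : lip01 B g -> m != 0 ->
  (forall x, 0 <= x <= 1 -> int01 (fun y => rho (x, y) * g y) = m * g x) ->
  int01 g = 0 -> (forall a, lam a != 0 -> int01 (fun x => g x * phi a x) = 0) ->
  int01 (fun x => g x * g x) = 0.
Proof.
move=> gB m0 gm g0 gphi.
have B0 := lip01_ge0 gB.
set I2 := int01 (fun x => g x * g x).
pose ga n (i : 'I_n) : R := (Num.sqrt n%:R)^-1 * g (grid R n i).
pose Kg n (i : 'I_n) : R := \sum_j kmatrix rho i j * ga n j.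
pose H n (i : 'I_n) : R := Num.sqrt n%:R * Kg n i.
pose b := `|g 0| + B.
have gb x : 0 <= x <= 1 -> `|g x| <= b by move=> x01; exact: lip01_bounded gB x01.
have b0 : 0 <= b by rewrite addr_ge0.
have c0 := weight_const_ge0 rk.
have HE n (i : 'I_n) : (0 < n)%N -> H n i = n%:R^-1 * (\sum_(j < n) rho (grid R n i, grid R n j) * g (grid R n j))
    - kweight rho i * (n%:R^-1 * \sum_(j < n) kweight rho j * g (grid R n j)).
  move=> n0; have s0 : Num.sqrt n%:R != 0 :> R by rewrite gt_eqF // sqrtr_gt0 ltr0n.
  rewrite /H /Kg !mulr_sumr -sumrB; apply: eq_bigr => j _.
  by rewrite /kmatrix /ga; field; rewrite s0 pnatr_eq0 -lt0n n0.
pose B1 := L * (`|g 0| + B) + (M + L) * B.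
have rg x : 0 <= x <= 1 -> lip01 B1 (fun y => rho (x, y) * g y).
  move=> x01 y z y01 z01; apply: le_trans (lip01M (lip_fst rk x01) gB y01 z01) _.
  rewrite ler_wpM2r // /B1 lerD2l ler_wpM2r // lerD2r.
  by apply: (rk_bound rk) => //; rewrite lexx ler01.
(* The rank-one part of the kernel is negligible here because [g] has mean 0. *)
have Hg : grid_unif U H (fun x => m * g x).
  have hO : (B1 + 2 * (B + c * b)) / n%:R @[n --> U] --> (0 : R).
    rewrite -[X in _ --> X](mulr0 (B1 + 2 * (B + c * b))).
    by apply: cvgM; [exact: cvg_cst|exact: ultra_invn oU].
  move=> e e0; move/cvgrPdist_le: hO => /(_ e e0) hO.
  near=> n => i.
  have gn : good rho L C n by near: n.
  have [n0 km u0 u1] := gn.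
  have n0' : 0 < n%:R :> R by rewrite ltr0n.
  have : `|0 - (B1 + 2 * (B + c * b)) / n%:R| <= e by near: n.
  rewrite sub0r normrN => /(le_trans (ler_norm _)); apply: le_trans.
  rewrite (HE n i n0) -(gm _ (grid01 R i)).
  have h1 := riemann_sum_lip n0 (rg _ (grid01 R i)).
  have h2 := riemann_sum_lip n0 gB; rewrite g0 subr0 in h2.
  have h3 : `|n%:R^-1 * \sum_(j < n) kweight rho j * g (grid R n j)| <= (B + c * b) / n%:R.
    have -> : n%:R^-1 * (\sum_(j < n) kweight rho j * g (grid R n j)) =
      n%:R^-1 * (\sum_(j < n) g (grid R n j)) +
      n%:R^-1 * (\sum_(j < n) (kweight rho j - 1) * g (grid R n j)).
      rewrite -mulrDr -big_split; congr (_ * _); apply: eq_bigr => j _ /=; ring.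
    apply: le_trans (ler_normD _ _) _; rewrite [leRHS]mulrDl; apply: lerD => //.
    rewrite normrM ger0_norm ?invr_ge0 ?ler0n // ler_pdivrMl //.
    apply: le_trans (ler_norm_sum _ _ _) _.
    apply: le_trans (_ : \sum_(j < n) (c / n%:R * b) <= _).
      apply: ler_sum => j _; rewrite normrM; apply: ler_pM => //.
      by apply: gb; exact: grid01.
    by rewrite sumr_const card_ord -[leLHS]mulr_natl (mulrAC c).
  have ui : `|kweight rho i| <= 2.
    have := u0 i; have := u1 i.
    have : c / n%:R <= 1.
      rewrite ler_pdivrMr // mul1r; near: n; apply: oU; exact: nbhs_infty_ger.
    by move=> z1 z2 z3; rewrite gtr0_norm //; move: z2; rewrite ler_norml; lra.
  rewrite addrAC; apply: le_trans (ler_normB _ _) _.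
  rewrite [leRHS]mulrDl; apply: lerD => //.
  by rewrite normrM -mulrA; apply: ler_pM.
have mg : lip01 (`|m| * B) (fun x => m * g x).
  by move=> x y x01 y01; rewrite -mulrBr normrM -mulrA ler_wpM2l //; exact: gB.
have K2 : \sum_(i < n) Kg n i ^+ 2 @[n --> U] --> m ^+ 2 * I2.
  have h := grid_unif_cvg UU oU (lip01M mg mg) (grid_unifM UU mg mg Hg Hg).
  have E : int01 (fun x => m * g x * (m * g x)) = m ^+ 2 * I2.
    have -> : (fun x => m * g x * (m * g x)) = (fun x => m ^+ 2 * (g x * g x)).
      by apply/funext => x; ring.
    rewrite /int01 RintegralZl //; exact: lip01_integrable (lip01M gB gB).
  rewrite E in h; apply: cvg_near_eq h; near=> n.
  have n0 : 0 < n%:R :> R by rewrite ltr0n; near: n; exact: ultra_gt.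
  rewrite mulr_sumr; apply: eq_bigr => i _.
  rewrite /H (_ : n%:R^-1 * _ = n%:R^-1 * Num.sqrt n%:R ^+ 2 * Kg n i ^+ 2); last by ring.
  by rewrite sqr_sqrtr ?(ltW n0) // mulVf ?mul1r // gt_eqF.
have G2 : \sum_(i < n) ga n i ^+ 2 @[n --> U] --> I2.
  have h := grid_unif_cvg UU oU (lip01M gB gB)
    (grid_unifM UU gB gB (@grid_unif_refl g) (@grid_unif_refl g)).
  apply: cvg_near_eq h; near=> n.
  have n0 : 0 < n%:R :> R by rewrite ltr0n; near: n; exact: ultra_gt.
  rewrite mulr_sumr; apply: eq_bigr => i _; rewrite /ga exprMn exprVn.
  by rewrite sqr_sqrtr ?(ltW n0) // expr2.
pose co n a : R := \sum_(i < n) v n a i * ga n i.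
have cobound n (a : 'I_n) : co n a ^+ 2 <= \sum_(i < n) ga n i ^+ 2.
  under [leRHS]eq_bigr => i _ do rewrite expr2.
  rewrite -(parseval (v := fun (a : 'I_n) j => v n a j)); last first.
    by move=> x y; rewrite (ef_orth ef).
  rewrite (bigD1 a) //= -expr2 lerDl; apply: sumr_ge0 => x _; rewrite -expr2; exact: sqr_ge0.
have Kexp n : \sum_(i < n) Kg n i ^+ 2 = \sum_(a < n) (ka n a * co n a) ^+ 2.
  under eq_bigr => i _ do rewrite expr2.
  rewrite -(parseval (v := fun (a : 'I_n) j => v n a j)); last first.
    by move=> x y; rewrite (ef_orth ef).
  apply: eq_bigr => a _; rewrite -expr2; congr (_ ^+ 2).
  rewrite /Kg; under eq_bigr => i _ do rewrite mulr_sumr.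
  rewrite exchange_big /co mulr_sumr; apply: eq_bigr => j _ /=.
  rewrite mulrA -(ef_eig ef) // mulr_suml; apply: eq_bigr => i _.
  by rewrite (kmatrix_sym rk i j); ring.
(* If [lam a] vanishes, boundedness of the coefficient is enough; otherwise the coefficient tends to
   the integral of [g] against [phi a], which is 0. *)
have head a : (ka n a * co n a) ^+ 2 @[n --> U] --> (0 : R).
  have [la|la] := eqVneq (lam a) 0.
    have h : ka n a * ka n a * \sum_(i < n) ga n i ^+ 2 @[n --> U] --> (0 : R).
      rewrite -[X in _ --> X](_ : lam a * lam a * I2 = 0); last by rewrite la !mul0r.
      by apply: cvgM G2; apply: cvgM; exact: (@lam_cvg a).
    apply: (squeeze_cvgr _ (cvg_cst 0) h); near=> n; rewrite sqr_ge0 exprMn /=.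
    have an : (a < n)%N by near: n; exact: ultra_gt.
    by rewrite -expr2 ler_wpM2l ?sqr_ge0 // (cobound n (Ordinal an)).
  have h := phi_coef_cvg la gB; rewrite gphi // in h.
  have h2 : ka n a * co n a @[n --> U] --> (0 : R).
    rewrite -(mulr0 (lam a)); apply: cvgM; first exact: lam_cvg.
    apply: cvg_near_eq h; near=> n; rewrite /co mulr_sumr; apply: eq_bigr => i _.
    by rewrite /ga; ring.
  rewrite -[X in _ --> X](mulr0 (0 : R)).
  have h3 : (ka n a * co n a) * (ka n a * co n a) @[n --> U] --> 0 * (0 : R) by apply: cvgM.
  by apply: cvg_near_eq h3; near=> n; rewrite expr2.
have I20 : 0 <= I2.
  apply: (cvgr_to_ge G2); near=> n; apply: sumr_ge0 => i _; exact: sqr_ge0.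
have key d : m ^+ 2 * I2 <= (S / d.+1%:R) ^+ 2 * I2.
  have h1 : \sum_(a < d) (ka n a * co n a) ^+ 2 +
     (S / d.+1%:R) ^+ 2 * \sum_(i < n) ga n i ^+ 2 @[n --> U] -->
     0 + (S / d.+1%:R) ^+ 2 * I2.
    apply: cvgD; last by apply: cvgM => //; exact: cvg_cst.
    rewrite -[X in _ --> X](_ : \sum_(a < d) (0 : R) = 0); last by rewrite big1.
    by apply: cvg_sumr => a; exact: head.
  rewrite add0r in h1; rewrite -subr_ge0; apply: (cvgr_to_ge (cvgB h1 K2)).
  near=> n; rewrite /= subr_ge0 Kexp.
  have dn : (d <= n)%N by near: n; apply: filterS (ultra_gt oU d) => ? /ltnW.
  have gn : good rho L C n by near: n.
  rewrite -(big_mkord predT (fun a => (ka n a * co n a) ^+ 2)).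
  rewrite (big_cat_nat (leq0n d) dn) /= big_mkord lerD2l.
  have -> : \sum_(i < n) ga n i ^+ 2 = \sum_(a < n) co n a ^+ 2.
    under eq_bigr => i _ do rewrite expr2.
    rewrite -(parseval (v := fun (a : 'I_n) j => v n a j)); last first.
      by move=> x y; rewrite (ef_orth ef).
    by apply: eq_bigr => a _; rewrite -expr2.
  rewrite mulr_sumr -(big_mkord predT (fun a => (S / d.+1%:R) ^+ 2 * co n a ^+ 2)).
  rewrite [leRHS](big_cat_nat (leq0n d) dn) /= -[leLHS]add0r; apply: lerD.
    by apply: sumr_ge0 => a _; rewrite mulr_ge0 ?sqr_ge0.
  rewrite big_nat [leRHS]big_nat; apply: ler_sum => a /andP[da an].
  rewrite exprMn ler_wpM2r ?sqr_ge0 // -real_normK ?num_real //.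
  rewrite lerXn2r ?nnegrE ?divr_ge0 ?ler0n ?(trace_const_ge0 rk) //.
  rewrite ler_pdivlMr ?ltr0n //; apply: le_trans (ka_decay rk ef a gn).
  by rewrite ler_wpM2l // ler_nat ltnS.
apply/eqP; rewrite eq_le I20 andbT leNgt; apply/negP => Ip.
have m2 : 0 < m ^+ 2 by rewrite lt_neqAle eq_sym sqrf_eq0 m0 sqr_ge0.
have S0 := trace_const_ge0 rk.
(* For this [d] the bound [S / d.+1%:R] drops below the modulus of [m], which is incompatible with
   [key] unless [I2 = 0]. *)
pose d := Num.truncn (S / `|m|).
have mp : 0 < `|m| by rewrite normr_gt0.
have : S / d.+1%:R < `|m|.
  rewrite ltr_pdivrMr ?ltr0n // mulrC -ltr_pdivrMr //; exact: truncnS_gt.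
move=> hd; have := key d; rewrite ler_pM2r // leNgt => /negP; apply.
rewrite -[ltRHS]real_normK ?num_real // ltrXn2r ?nnegrE //.
by rewrite divr_ge0 // ler0n.
Unshelve. all: end_near. Qed.

End EigenFunctions.

(** * The generating series of one letter *)

(* The value at 0 of the Hermite polynomial [He_m]. *)
Fixpoint hermite0 (R : pzRingType) (m : nat) : R :=
  match m with
  | 0 => 1
  | 1 => 0
  | m'.+2 => - (m'.+1)%:R * hermite0 R m'
  end.

(** At [m = 0] the factor [m%:R] cancels the truncated predecessor. *)
Lemma hermite0S (R : comPzRingType) m : hermite0 R m.+1 = - (m%:R * hermite0 R m.-1).
Proof. by case: m => [|m] /=; rewrite ?mul0r ?oppr0 // mulNr. Qed.

Section Series.
Variable R : realType.
Implicit Types (l : R) (m N : nat).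

(** The Taylor coefficients of [(1 - x^2)^(-1/2)]: 0 in odd degree, and ['C(2 j, j) / 4^j] in degree
    [2 j]. *)
Definition series_coef m : R := hermite0 R m ^+ 2 / m`!%:R.

Lemma series_coef_ge0 m : 0 <= series_coef m.
Proof. by rewrite divr_ge0 ?sqr_ge0. Qed.

Lemma series_coef0 : series_coef 0 = 1.
Proof. by rewrite /series_coef /= fact0 expr1n divr1. Qed.

Lemma series_coefSS m : m.+2%:R * series_coef m.+2 = m.+1%:R * series_coef m.
Proof.
rewrite /series_coef /= !factS !natrM.
have f0 : m`!%:R != 0 :> R by rewrite pnatr_eq0 -lt0n fact_gt0.
by field; rewrite f0 nat1r -(natrD _ 2) !pnatr_eq0.
Qed.

Lemma series_coef_le1 m : series_coef m <= 1.
Proof.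
suff : series_coef m <= 1 /\ series_coef m.+1 <= 1 by case.
elim: m => [|m [h1 h2]]; first by rewrite series_coef0 /series_coef /= expr0n mul0r ler01.
split=> //; rewrite -(@ler_pM2l _ m.+2%:R) ?ltr0n // series_coefSS mulr1.
by apply: le_trans (ler_wpM2l _ h1) _; rewrite ?ler0n // mulr1 ler_nat.
Qed.

Definition series_poly N : {poly R} := \poly_(m < N) series_coef m.

(** For the full series this product is 1; for the truncation it differs from 1 only in degrees at
    least [N]. *)
Let defect N : {poly R} := series_poly N ^+ 2 * (1 - 'X^2).

(* The full series satisfies [(1 - x^2) f' = x f]; truncation leaves only two
   boundary terms. *)
Lemma deriv_defect N : (defect N.+2)^`() =
  - (series_poly N.+2 * ((2 * N.+1%:R * series_coef N) *: 'X^(N.+1) +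
       (2 * N.+2%:R * series_coef N.+1) *: 'X^(N.+2))).
Proof.
set p := series_poly N.+2.
have key : (1 - 'X^2) * p^`() - 'X * p =
   - ((N.+1%:R * series_coef N) *: 'X^(N.+1) + (N.+2%:R * series_coef N.+1) *: 'X^(N.+2)).
  apply/polyP => -[|[|m]].
  - rewrite mulrBl mul1r !coefB coefXnM coefXM coef_deriv coefN coefD !coefZ !coefXn /= coef_poly /=.
    by rewrite /series_coef /= expr0n /= !mul0r mul0rn !mulr0 !subr0 addr0 oppr0.
  - rewrite mulrBl mul1r !coefB coefXnM coefXM coef_deriv coefN coefD !coefZ !coefXn /= !coef_poly /=.
    rewrite series_coef0 !eqSS.
    have := series_coefSS 0; rewrite series_coef0 mulr1 => h.
    case: N {p} => [|N] /=; rewrite ?mulr0 ?mulr1 ?addr0 ?series_coef0.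
      by rewrite /series_coef /=; ring.
    by rewrite -mulr_natl h; ring.
  rewrite mulrBl mul1r !coefB coefXnM coefXM !coef_deriv coefN coefD !coefZ !coefXn !coef_poly.
  rewrite /= !subSS subn0 !eqSS.
  have := series_coefSS m.+1.
  rewrite !ltnS.
  have [mN|Nm] := ltnP m.+1 N.
    rewrite (leq_trans (leqnSn m) (ltnW mN)).
    rewrite -[X in X - _ - _]mulr_natl -[X in _ - X - _]mulr_natl => ->.
    rewrite (ltn_eqF mN) (ltn_eqF (ltnW mN)).
    by rewrite !mulr0 -!natr1; ring.
  have [E|E] := eqVneq m.+1 N.
    subst N; rewrite leqnSn ltn_eqF // => _.
    by rewrite mul0rn /= -[X in _ - X - _]mulr_natl -!natr1; ring.
  have [E'|E'] := eqVneq m N.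
    subst N; rewrite leqnn => _.
    by rewrite mul0rn /= -[X in _ - X - _]mulr_natl -!natr1; ring.
  have Nm' : (N < m)%N by rewrite ltn_neqAle eq_sym E' -ltnS ltn_neqAle eq_sym E.
  rewrite leqNgt Nm' /=.
  by move=> _; rewrite !mul0rn !mulr0 !subr0 addr0 oppr0.
rewrite /defect derivM derivB -/p.
have -> : (1 : {poly R})^`() = 0 by rewrite -polyC1 derivC.
have -> : (p ^+ 2)^`() * (1 - 'X^2) + p ^+ 2 * (0 - ('X^2)^`()) =
   2%:R * p * ((1 - 'X^2) * p^`() - 'X * p).
  by rewrite expr2 derivM derivXn /=; ring.
have two (a b : R) (s : {poly R}) : (2 * a * b) *: s = 2%:R * ((a * b) *: s).
  by rewrite -mulrA -scalerA scaler_nat mulr_natl.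
by rewrite key !two; ring.
Qed.

Lemma coef_deriv_defect N k : (defect N.+2)`_k.+1 *+ k.+1 =
  - (2 * N.+1%:R * series_coef N * (if (k < N.+1)%N then 0 else (series_poly N.+2)`_(k - N.+1)) +
     2 * N.+2%:R * series_coef N.+1 * (if (k < N.+2)%N then 0 else (series_poly N.+2)`_(k - N.+2))).
Proof.
have := congr1 (fun s : {poly R} => s`_k) (deriv_defect N).
set A := 2 * N.+1%:R * _; set B := 2 * N.+2%:R * _.
by rewrite coef_deriv coefN mulrDr -2!scalerAr coefD 2!coefZ 2!coefMXn.
Qed.

Lemma coef_defect_small N k : (0 < k < N.+2)%N -> (defect N.+2)`_k = 0.
Proof.
case: k => // k; rewrite /= ltnS => kN; have := coef_deriv_defect N k.
rewrite kN (leqW kN) !mulr0 addr0 oppr0 => /eqP.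
by rewrite mulrn_eq0 /= => /eqP.
Qed.

Lemma coef_defect0 N : (defect N.+2)`_0 = 1.
Proof.
rewrite /defect mulrBr mulr1 coefB coefMXn /= subr0 expr2 coefM big_ord1 subn0 coef_poly /=.
by rewrite series_coef0 mulr1.
Qed.

(** In the derivative, each of the two boundary terms contributes at most [2 k] to the coefficient
    that [k] divides. *)
Lemma coef_defect_le N k : `|(defect N.+2)`_k| <= 4.
Proof.
have [/coef_defect_small ->|] := boolP (0 < k < N.+2)%N; first by rewrite normr0.
case: k => [_|k]; first by rewrite coef_defect0 normr1; lra.
rewrite /= -leqNgt ltnS => kN.
have k0 : 0 < k.+1%:R :> R by rewrite ltr0n.
rewrite -(ler_pM2l k0) -[k.+1%:R in leLHS]normr_nat -normrM mulr_natl coef_deriv_defect normrN.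
have c01 m b : 0 <= (if b : bool then 0 else (series_poly N.+2)`_m) <= 1.
  case: b; first by rewrite lexx ler01.
  by rewrite coef_poly; case: ifP => _; rewrite ?lexx ?ler01 // series_coef_ge0 series_coef_le1.
have h m x : (m <= k.+1)%N -> 0 <= x <= 1 ->
    forall j, `|2 * m%:R * series_coef j * x| <= k.+1%:R * 2.
  move=> mk /andP[x0 x1] j; have := series_coef_ge0 j; have := series_coef_le1 j.
  move: (series_coef j) => w w1 w0; rewrite ger0_norm ?mulr_ge0 //.
  have -> : 2 * m%:R * w * x = 2 * (m%:R * (w * x)) by ring.
  rewrite [leRHS]mulrC ler_wpM2l // -[leRHS]mulr1; apply: ler_pM => //; first exact: mulr_ge0.
    by rewrite ler_nat.
  by rewrite -[leRHS]mulr1; apply: ler_pM.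
apply: le_trans (ler_normD _ _) _.
have -> : k.+1%:R * 4 = k.+1%:R * 2 + k.+1%:R * 2 :> R by ring.
apply: lerD; first by apply: h => //; rewrite ltnS ltnW.
have [kN'|Nk] := ltnP k N.+2; first by rewrite mulr0 normr0 mulr_ge0.
by apply: h; [rewrite ltnW|exact: (c01 _ false)].
Qed.

(** Odd coefficients vanish, so negative [l] is harmless. *)
Lemma series_coefX_ge0 l m : 0 <= series_coef m * l ^+ m.
Proof.
have [m_odd|m_even] := boolP (odd m).
  rewrite (_ : series_coef m = 0) ?mul0r //.
  rewrite -(odd_double_half m) m_odd add1n /series_coef.
  suff -> : hermite0 R (m./2).*2.+1 = 0 by rewrite expr0n mul0r.
  by elim: (m./2) => // k IH; rewrite doubleS hermite0S [_.-1]/= IH mulr0 oppr0.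
by rewrite mulr_ge0 ?series_coef_ge0 // exprn_even_ge0.
Qed.

Lemma series_poly_ge0 l N : 0 <= (series_poly N).[l].
Proof. by rewrite horner_poly; apply: sumr_ge0 => m _; exact: series_coefX_ge0. Qed.

Lemma series_poly_sqr l N : `|l| < 1 ->
  `|(series_poly N.+2).[l] ^+ 2 * (1 - l ^+ 2) - 1| <= 4 / (1 - `|l|) * `|l| ^+ N.+2.
Proof.
move=> l1; have d0 : 0 < 1 - `|l| by rewrite subr_gt0.
have -> : (series_poly N.+2).[l] ^+ 2 * (1 - l ^+ 2) = (defect N.+2).[l].
  by rewrite /defect hornerM horner_exp hornerD hornerN hornerXn hornerC.
pose m := (N.+2 + size (defect N.+2))%N.
have sm : (size (defect N.+2) <= m)%N by rewrite leq_addl.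
rewrite (horner_coef_wide _ sm) -(big_mkord predT (fun i => (defect N.+2)`_i * l ^+ i)).
rewrite (big_cat_nat (leq0n N.+2)) ?leq_addr //= big_nat_recl // coef_defect0 mulr1.
rewrite big_nat big1 ?addr0 => [|i /andP[_ iN]]; last by rewrite coef_defect_small ?mul0r.
rewrite addrAC subrr add0r; apply: le_trans (ler_norm_sum _ _ _) _.
apply: le_trans (_ : \sum_(N.+2 <= i < m) 4 * `|l| ^+ i <= _).
  by apply: ler_sum => i _; rewrite normrM normrX ler_wpM2r ?exprn_ge0 // coef_defect_le.
rewrite -mulr_sumr -mulrA ler_wpM2l // [leRHS]mulrC ler_pdivlMr //.
have -> : (\sum_(N.+2 <= i < m) `|l| ^+ i) * (1 - `|l|) = `|l| ^+ N.+2 - `|l| ^+ m.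
  rewrite mulr_suml (telescope_sumr_eq (fun i => - `|l| ^+ i) _ (leq_addr _ _)).
    by rewrite opprK addrC.
  by move=> i _ /=; rewrite exprS; ring.
by rewrite gerBl exprn_ge0.
Qed.

(** The squares converge by [series_poly_sqr], and nonnegativity of the partial sums selects the
    positive root. *)
Lemma series_poly_cvg l : `|l| < 1 ->
  (series_poly N).[l] @[N --> \oo] --> (1 - l ^+ 2) `^ (- 2^-1).
Proof.
move=> l1; have d0 : 0 < 1 - `|l| by rewrite subr_gt0.
have l2 : 0 < 1 - l ^+ 2.
  by rewrite subr_gt0 -real_normK ?num_real // expr_lt1.
rewrite -(cvg_shiftn 2).
have hl : 4 / (1 - `|l|) * `|l| ^+ (N + 2) @[N --> \oo] --> (0 : R).
  rewrite -[X in _ --> X](mulr0 (4 / (1 - `|l|))); apply: cvgM; first exact: cvg_cst.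
  by rewrite (cvg_shiftn 2); apply: cvg_expr; rewrite normr_id.
have h1 : (series_poly (N + 2)).[l] ^+ 2 * (1 - l ^+ 2) @[N --> \oo] --> (1 : R).
  apply/cvgrPdist_le => e e0; move/cvgrPdist_le: hl => /(_ e e0) hl; near=> N.
  have : `|0 - 4 / (1 - `|l|) * `|l| ^+ (N + 2)| <= e by near: N.
  rewrite sub0r normrN => /(le_trans (ler_norm _)); apply: le_trans.
  by rewrite distrC addn2; exact: series_poly_sqr.
have h2 : Num.sqrt ((series_poly (N + 2)).[l] ^+ 2 * (1 - l ^+ 2) / (1 - l ^+ 2)) @[N --> \oo] -->
    Num.sqrt (1 / (1 - l ^+ 2)).
  apply: (continuous_cvg _ (@sqrt_continuous R _)).
  by apply: cvgM h1 _; exact: cvg_cst.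
have -> : (1 - l ^+ 2) `^ (- 2^-1) = Num.sqrt (1 / (1 - l ^+ 2)).
  by rewrite div1r sqrtrV ?(ltW l2) // powRN powR12_sqrt // ltW.
apply: cvg_near_eq h2; near=> N.
rewrite mulfK ?gt_eqF // sqrtr_sqr ger0_norm //.
exact: series_poly_ge0.
Unshelve. all: end_near. Qed.

End Series.

Lemma coef_prod_eq (R : comNzRingType) (I : finType) (p q : I -> {poly R}) k :
  (forall a j, (j <= k)%N -> (p a)`_j = (q a)`_j) ->
  (\prod_a p a)`_k = (\prod_a q a)`_k.
Proof.
move=> pq; pose P (s t : {poly R}) := forall j, (j <= k)%N -> s`_j = t`_j.
apply: (big_ind2 P) (leqnn k) => [//|s s' t t' h h' j jk|a _ j]; last exact: pq.
rewrite !coefM; apply: eq_bigr => i _.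
rewrite h ?h' ?(leq_trans (leq_subr _ _) jk) //.
by rewrite (leq_trans _ jk) // -ltnS.
Qed.

Lemma coef_prod_le (R : numDomainType) (I : finType) (p q : I -> {poly R}) k :
  (forall a j, 0 <= (p a)`_j <= (q a)`_j) ->
  (\prod_a p a)`_k <= (\prod_a q a)`_k.
Proof.
move=> pq; pose P (s t : {poly R}) := forall j, 0 <= s`_j <= t`_j.
suff : P (\prod_a p a) (\prod_a q a) by move=> /(_ k) /andP[].
apply: (big_ind2 P) => [j|s s' t t' h h' j|a _ j]; last exact: pq.
  by rewrite lexx coef1 ler0n.
rewrite !coefM; apply/andP; split.
  apply: sumr_ge0 => i _; have /andP[h0 _] := h i; have /andP[h1 _] := h' (j - i)%N.
  exact: mulr_ge0.
apply: ler_sum => i _; have /andP[h0 h2] := h i; have /andP[h1 h3] := h' (j - i)%N.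
exact: ler_pM.
Qed.

Section LimitProduct.
Variables (R : realType) (d : nat) (l : 'I_d -> R).
Hypothesis l1 : forall a, `|l a| < 1.

Definition limit_letter N a : {poly R} := \poly_(m < N) (series_coef R m * l a ^+ m).
(** A coefficient of the Cauchy product of the series; truncating the factors at [k.+1] leaves it
    unchanged. *)
Definition limit_coef k : R := (\prod_a limit_letter k.+1 a)`_k.

Let coef_ge0 N a j : 0 <= (limit_letter N a)`_j.
Proof. by rewrite coef_poly; case: ifP => _ //; exact: series_coefX_ge0. Qed.

Let prod_ge0 N j : 0 <= (\prod_a limit_letter N a)`_j.
Proof. exact: coef_prod_ge0. Qed.

Lemma limit_coefE N k : (k < N)%N -> limit_coef k = (\prod_a limit_letter N a)`_k.
Proof.
move=> kN; apply: coef_prod_eq => a j jk; rewrite !coef_poly ltnS jk.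
by rewrite (leq_ltn_trans jk kN).
Qed.

Let le_limit_coef N k : (\prod_a limit_letter N a)`_k <= limit_coef k.
Proof.
have [kN|Nk] := ltnP k N; first by rewrite (limit_coefE kN).
apply: coef_prod_le => a j; rewrite coef_ge0 !coef_poly /= ltnS.
case: ltnP => jN; last by case: ifP => _ //; exact: series_coefX_ge0.
by rewrite (leq_trans (ltnW jN) Nk).
Qed.

Let prodE N : (\prod_a limit_letter N a).[1] = \prod_a (series_poly R N).[l a].
Proof.
rewrite horner_prod; apply: eq_bigr => a _; rewrite !horner_poly.
by apply: eq_bigr => m _; rewrite expr1n mulr1.
Qed.

(** All coefficients are nonnegative, so a partial sum of the Cauchy product lies below the product
    of the partial sums of the same order, and above the product of shorter partial sums once it
    exceeds their total degree. *)
Lemma sum_limit_coef_cvg :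
  \sum_(k < K) limit_coef k @[K --> \oo] --> \prod_a (1 - l a ^+ 2) `^ (- 2^-1).
Proof.
have hP : \prod_a (series_poly R N).[l a] @[N --> \oo] --> \prod_a (1 - l a ^+ 2) `^ (- 2^-1).
  by apply: cvg_prodr => a; exact: series_poly_cvg.
have up K : \sum_(k < K) limit_coef k <= \prod_a (series_poly R K).[l a].
  rewrite -prodE; apply: le_trans (sum_coef_le K ler01 (@prod_ge0 K)).
  by apply: ler_sum => k _; rewrite expr1n mulr1 (limit_coefE (ltn_ord k)).
have low N K : (size (\prod_a limit_letter N a)%R <= K)%N ->
    \prod_a (series_poly R N).[l a] <= \sum_(k < K) limit_coef k.
  move=> sK; rewrite -prodE (horner_coef_wide _ sK); apply: ler_sum => k _.
  by rewrite expr1n mulr1.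
apply/cvgrPdist_le => e e0; move/cvgrPdist_le: hP => /(_ e e0) hP.
have [N _ hN] := hP; near=> K.
have sK : (size (\prod_a limit_letter N a)%R <= K)%N by near: K; exact: nbhs_infty_ge.
have h1 := hN N (leqnn N).
have h2 : `|\prod_a (1 - l a ^+ 2) `^ (- 2^-1) - \prod_a (series_poly R K).[l a]| <= e by near: K.
have := low N K sK; have := up K; move: h1 h2; rewrite !ler_norml; lra.
Unshelve. all: end_near. Qed.

End LimitProduct.

(** * Limits of permutation averages *)

Section PermutationAverages.
Variables (R : realType) (U : set_system nat).
Hypotheses (UU : UltraFilter U) (oU : \oo `<=` U).

Let PU : ProperFilter U. Proof. exact: ultra_proper. Qed.
#[local] Existing Instance PU.

Lemma ratio_sub_cvg k : n%:R / (n - k)%:R @[n --> U] --> (1 : R).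
Proof.
have h : n%:R / (n - k)%:R - 1 @[n --> U] --> (0 : R).
  apply: (@ultra_O_invn R U UU oU _ (2 * k%:R)); near=> n.
  have kn : (2 * k < n)%N by near: n; exact: ultra_gt.
  have kn' : (k < n)%N by lia.
  have n0 : 0 < n%:R :> R by rewrite ltr0n; lia.
  have d0 : 0 < (n - k)%:R :> R by rewrite ltr0n subn_gt0.
  have -> : n%:R / (n - k)%:R - 1 = k%:R / (n - k)%:R :> R.
    by rewrite -{1}(subnK (ltnW kn')) natrD mulrDl divff ?gt_eqF // addrAC subrr add0r.
  rewrite ger0_norm ?divr_ge0 ?ler0n // ler_pdivrMr // mulrAC ler_pdivlMr // -!natrM ler_nat; nia.
have h1 : (n%:R / (n - k)%:R - 1) + 1 @[n --> U] --> (0 + 1 : R) by apply: cvgD h _; exact: cvg_cst.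
by rewrite add0r in h1; apply: cvg_near_eq h1; near=> n; rewrite subrK.
Unshelve. all: end_near. Qed.

(** Merging two flagged positions in [pavg_rec] releases two factors [sqrt n], which balance the
    denominator; one factor or none is not enough, and the term vanishes in the limit. *)
Lemma sqrt_ratio_cvg (b b' : bool) k :
  Num.sqrt n%:R ^+ (b + b') / (n - k)%:R @[n --> U] --> ((b && b')%:R : R).
Proof.
have h0 : Num.sqrt n%:R^-1 @[n --> U] --> (0 : R).
  rewrite -[X in _ --> X]sqrtr0; apply: (continuous_cvg _ (@sqrt_continuous R _)).
  exact: ultra_invn oU.
have h1 : Num.sqrt n%:R ^+ (b + b') / n%:R @[n --> U] --> ((b && b')%:R : R).
  case: b b' => [] [] /=.
  - apply: cvg_near_eq (cvg_cst (1 : R)); near=> n.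
    have n0 : 0 < n%:R :> R by rewrite ltr0n; near: n; exact: ultra_gt.
    by rewrite sqr_sqrtr ?(ltW n0) // divff // gt_eqF.
  - apply: cvg_near_eq h0; near=> n.
    have n0 : 0 < n%:R :> R by rewrite ltr0n; near: n; exact: ultra_gt.
    have s0 : 0 < Num.sqrt n%:R :> R by rewrite sqrtr_gt0.
    rewrite sqrtrV ?(ltW n0) // -[in RHS](sqr_sqrtr (ltW n0)) expr1.
    by rewrite sqr_sqrtr ?(ltW n0) // -{3}(sqr_sqrtr (ltW n0)); field; rewrite gt_eqF.
  - apply: cvg_near_eq h0; near=> n.
    have n0 : 0 < n%:R :> R by rewrite ltr0n; near: n; exact: ultra_gt.
    have s0 : 0 < Num.sqrt n%:R :> R by rewrite sqrtr_gt0.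
    rewrite sqrtrV ?(ltW n0) // expr1.
    by rewrite -{3}(sqr_sqrtr (ltW n0)); field; rewrite gt_eqF.
  apply: cvg_near_eq (ultra_invn oU); near=> n.
  by rewrite expr0 div1r.
have h2 : Num.sqrt n%:R ^+ (b + b') / n%:R * (n%:R / (n - k)%:R) @[n --> U] --> ((b && b')%:R * 1 : R).
  by apply: cvgM h1 (ratio_sub_cvg k).
rewrite mulr1 in h2; apply: cvg_near_eq h2; near=> n.
have n0 : n%:R != 0 :> R by rewrite pnatr_eq0 -lt0n; near: n; exact: ultra_gt.
by rewrite mulrA mulfVK.
Unshelve. all: end_near. Qed.

Variables (d : nat) (psi : forall n, nat -> 'I_n -> R).
Arguments psi : clear implicits.
Hypothesis psi_sum : forall a, (a < d)%N ->
  exists B : R, \forall n \near U, `|\sum_i psi n a i| <= B.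
Hypothesis psi_orth : forall a b, (a < d)%N -> (b < d)%N ->
  n%:R^-1 * (\sum_i psi n a i * psi n b i) @[n --> U] --> ((a == b)%:R : R).

Definition letter_count (z : nat -> bool) (t : nat -> nat) k a : nat :=
  (\sum_(l < k) (z l && (t l == a)))%N.

Local Notation cnt := letter_count.

Let U_bounded_cvg (f : nat -> R) (B : R) : (\forall n \near U, `|f n| <= B) ->
  exists l : R, f n @[n --> U] --> l.
Proof. by move=> fB; eexists; exact: ultra_cvg fB. Qed.

Let mean_bound (p : forall n, 'I_n -> R) (B : R) :
  (\forall n \near U, forall i, `|p n i| <= B) ->
  \forall n \near U, `|n%:R^-1 * \sum_i p n i| <= B.
Proof.
move=> pB; near=> n.
have n0 : 0 < n%:R :> R by rewrite ltr0n; near: n; exact: ultra_gt.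
rewrite normrM ger0_norm ?invr_ge0 ?(ltW n0) // ler_pdivrMl //.
apply: le_trans (ler_norm_sum _ _ _) _.
apply: le_trans (_ : \sum_(i < n) B <= _).
  by apply: ler_sum => i _; move: i; near: n.
by rewrite sumr_const card_ord mulr_natl.
Unshelve. all: end_near. Qed.

Let countS z t k a : cnt z t k.+1 a = (cnt z t k a + (z k && (t k == a)))%N.
Proof. by rewrite /cnt big_ord_recr. Qed.

Let count_clear z t k m a : (m < k)%N ->
  cnt z t k a = ((z m && (t m == a)) + cnt (fun l => z l && (l != m)) t k a)%N.
Proof.
move=> mk; rewrite /cnt (bigD1 (Ordinal mk)) //=; congr addn.
rewrite [RHS](bigD1 (Ordinal mk)) //= eqxx andbF add0n.
apply: eq_bigr => l lm; suff -> : (l : nat) != m by rewrite andbT.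
by apply: contraNneq lm => E; apply/eqP/val_inj.
Qed.

Let flags_clear (z : nat -> bool) k m : (m < k)%N ->
  (\sum_(l < k) z l = z m + \sum_(l < k) (z l && (l != m :> nat)))%N.
Proof.
move=> mk; rewrite (bigD1 (Ordinal mk)) //=; congr addn.
rewrite [RHS](bigD1 (Ordinal mk)) //= eqxx andbF add0n.
apply: eq_bigr => l lm; suff -> : (l : nat) != m by rewrite andbT.
by apply: contraNneq lm => E; apply/eqP/val_inj.
Qed.

(** The recursion [He_(m+1)(0) = - m He_(m-1)(0)] for the letter of position [k]: its [m] earlier
    flagged occurrences are the possible partners of [k], and each pairing removes both. *)
Let sum_pairings (z : nat -> bool) (t : nat -> nat) k : (t k < d)%N -> z k ->
  - \sum_(m < k) (z m)%:R * ((t m == t k)%:R *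
     \prod_(a < d) hermite0 R (cnt (fun l => z l && (l != m :> nat)) t k a)) =
  \prod_(a < d) hermite0 R (cnt z t k.+1 a).
Proof.
move=> tk zk; pose a0 := Ordinal tk.
pose P := \prod_(a < d | a != a0) hermite0 R (cnt z t k a).
rewrite [RHS](bigD1 a0) //= countS zk eqxx addn1 hermite0S.
have -> : \prod_(a < d | a != a0) hermite0 R (cnt z t k.+1 a) = P.
  apply: eq_bigr => a aa0; rewrite countS; suff -> : (t k == a) = false by rewrite andbF addn0.
  by apply/negbTE; apply: contraNneq aa0 => E; apply/eqP/val_inj.
have -> : (cnt z t k a0)%:R = \sum_(m < k) (z m && (t m == t k))%:R :> R by rewrite -natr_sum.
rewrite mulNr -mulrA; congr (- _); rewrite mulr_suml; apply: eq_bigr => m _.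
case zm : (z m); rewrite ?mul0r //= mul1r.
case: (t m =P t k) => [E|_]; rewrite ?mul0r // !mul1r.
rewrite (bigD1 a0) //=; congr (_ * _).
  by rewrite (count_clear z t a0 (ltn_ord m)) zm E eqxx.
apply: eq_bigr => a aa0; rewrite (count_clear z t a (ltn_ord m)) zm E /=.
suff -> : (t k == a) = false by [].
by apply/negbTE; apply: contraNneq aa0 => E'; apply/eqP/val_inj.
Qed.

(* Positions [l < k] flagged by [z] carry one of the vectors [psi], whose sum is
   bounded; they each contribute a factor [sqrt n]. The others carry arbitrary
   bounded vectors of mean tending to [mu l]. Merging position [k] with a flagged
   position [m] as in [pavg_rec] clears the flag of [m]. *)
Lemma pavg_cvg k : forall (z : nat -> bool) (t : nat -> nat)
    (p : forall n, nat -> 'I_n -> R) (mu : nat -> R),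
  (forall l, (l < k)%N -> exists B : R, \forall n \near U, forall i, `|p n l i| <= B) ->
  (forall l, (l < k)%N -> z l -> (t l < d)%N /\ forall n i, p n l i = psi n (t l) i) ->
  (forall l, (l < k)%N -> ~~ z l -> n%:R^-1 * (\sum_i p n l i) @[n --> U] --> mu l) ->
  Num.sqrt n%:R ^+ (\sum_(l < k) z l) * pavg k (p n) @[n --> U] -->
    (\prod_(l < k) (if z l then 1 else mu l)) * \prod_(a < d) hermite0 R (cnt z t k a).
Proof.
elim: k => [|k IH] z t p mu pB pz pmu.
  apply: cvg_near_eq (cvg_cst _); near=> n.
  rewrite !big_ord0 expr0 mul1r big1 => [|a _]; last by rewrite /cnt big_ord0.
  have nf : n`!%:R != 0 :> R by rewrite pnatr_eq0 -lt0n fact_gt0.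
  rewrite mul1r /pavg; under eq_bigr => s _ do rewrite big_pred0 //.
  transitivity ((n`!%:R)^-1 * \sum_(s in [set: 'S_n]%SET) (1 : R)).
    by rewrite sumr_const cardsT card_Sn mulVf.
  by congr (_ * _); apply: eq_bigl => s; rewrite inE.
pose pm m n l j := if l == m then p n l j * p n k j else p n l j.
pose zm m l := z l && (l != m).
pose nu m : R := lim (n%:R^-1 * (\sum_i p n m i * p n k i) @[n --> U]).
have mergeB m : (m < k)%N ->
    exists B : R, \forall n \near U, forall i, `|p n m i * p n k i| <= B.
  move=> mk; have [B hB] := pB m (leqW mk); have [B' hB'] := pB k (ltnSn k).
  exists (B * B'); near=> n => i.
  have h1 : forall i, `|p n m i| <= B by near: n.
  have h2 : forall i, `|p n k i| <= B' by near: n.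
  by rewrite normrM; apply: ler_pM.
have nu_cvg m : (m < k)%N -> n%:R^-1 * (\sum_i p n m i * p n k i) @[n --> U] --> nu m.
  move=> mk; have [B hB] := mergeB m mk.
  exact: (ultra_cvg UU (mean_bound hB)).
(* A merged pair of flagged vectors has limiting mean 1 or 0, by orthonormality. *)
have nuE m : (m < k)%N -> z k -> z m -> nu m = (t m == t k)%:R.
  move=> mk zk zm'; have [tk pk] := pz k (ltnSn k) zk; have [tm pm'] := pz m (leqW mk) zm'.
  apply: (cvgr_unique _ (nu_cvg m mk)); apply: cvg_near_eq (psi_orth tm tk).
  by near=> n; congr (_ * _); apply: eq_bigr => i _; rewrite pk pm'.
have IHp := IH z t p mu (fun l lk => pB l (leqW lk)) (fun l lk => pz l (leqW lk))
  (fun l lk => pmu l (leqW lk)).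
pose Wm m := (\prod_(l < k) (if zm m l then 1 else if l == m :> nat then nu m else mu l)) *
  \prod_(a < d) hermite0 R (cnt (zm m) t k a).
have IHm m : (m < k)%N ->
    Num.sqrt n%:R ^+ (\sum_(l < k) zm m l) * pavg k (pm m n) @[n --> U] --> Wm m.
  move=> mk; apply: (IH (zm m) t (pm m) (fun l => if l == m then nu m else mu l)).
  - move=> l lk; have [->|lm] := eqVneq l m.
      by have [B hB] := mergeB m mk; exists B; near=> n => i; rewrite /pm eqxx; move: i; near: n.
    have [B hB] := pB l (leqW lk); exists B.
    by near=> n => i; rewrite /pm (negbTE lm); move: i; near: n.
  - move=> l lk /andP[zl lm]; have [tl pl] := pz l (leqW lk) zl; split=> // n i.
    by rewrite /pm (negbTE lm) pl.
  move=> l lk; rewrite negb_and negbK; have [->|lm] := eqVneq l m.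
    by move=> _; under eq_fun do rewrite /pm eqxx; exact: nu_cvg.
  rewrite orbF => zl; have h := pmu l (leqW lk) zl.
  by apply: cvg_near_eq h; near=> n; congr (_ * _); apply: eq_bigr => i _; rewrite /pm (negbTE lm).
(* For a flagged position the sum is bounded while the prefactor has order [n^(-1/2)], so only
   pairings survive. *)
have Acvg : Num.sqrt n%:R ^+ z k / (n - k)%:R * (\sum_i p n k i) @[n --> U] -->
    (if z k then 0 else mu k).
  case zk : (z k); last first.
    have h : n%:R^-1 * (\sum_i p n k i) * (n%:R / (n - k)%:R) @[n --> U] --> mu k * 1.
      by apply: cvgM (ratio_sub_cvg k); apply: pmu => //; rewrite zk.
    rewrite mulr1 in h; apply: cvg_near_eq h; near=> n.
    have kn : (k < n)%N by near: n; exact: ultra_gt.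
    have n0 : n%:R != 0 :> R by rewrite pnatr_eq0 -lt0n (leq_ltn_trans _ kn).
    have d0 : (n - k)%:R != 0 :> R by rewrite pnatr_eq0 -lt0n subn_gt0.
    by rewrite expr0; field; rewrite n0 d0.
  have [tk pk] := pz k (ltnSn k) zk; have [B hB] := psi_sum tk.
  have [l hl] := U_bounded_cvg hB.
  rewrite -[X in _ --> X](mul0r l).
  have h : Num.sqrt n%:R ^+ (true + false) / (n - k)%:R * (\sum_i psi n (t k) i) @[n --> U] --> 0 * l.
    by apply: cvgM hl; exact: sqrt_ratio_cvg.
  by apply: cvg_near_eq h; near=> n; congr (_ * _); apply: eq_bigr => i _; rewrite pk.
(* The right side of [pavg_rec], with the powers of [sqrt n] distributed over its terms. *)
have main : (Num.sqrt n%:R ^+ z k / (n - k)%:R * (\sum_i p n k i)) *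
     (Num.sqrt n%:R ^+ (\sum_(l < k) z l) * pavg k (p n)) -
   \sum_(m < k) (Num.sqrt n%:R ^+ (z k + z m) / (n - k)%:R *
     (Num.sqrt n%:R ^+ (\sum_(l < k) zm m l) * pavg k (pm m n))) @[n --> U] -->
   (if z k then 0 else mu k) * ((\prod_(l < k) (if z l then 1 else mu l)) *
      \prod_(a < d) hermite0 R (cnt z t k a)) -
   \sum_(m < k) (z k && z m)%:R * Wm m.
  apply: cvgB; first exact: cvgM Acvg IHp.
  apply: cvg_sumr => m; apply: cvgM (IHm m (ltn_ord m)); exact: sqrt_ratio_cvg.
have -> : (\prod_(l < k.+1) (if z l then 1 else mu l)) * \prod_(a < d) hermite0 R (cnt z t k.+1 a) =
   (if z k then 0 else mu k) * ((\prod_(l < k) (if z l then 1 else mu l)) *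
      \prod_(a < d) hermite0 R (cnt z t k a)) -
   \sum_(m < k) (z k && z m)%:R * Wm m.
  rewrite big_ord_recr /=; case zk : (z k); last first.
    rewrite [X in _ - X]big1 => [|m _]; last by rewrite mul0r.
    rewrite subr0 mulrCA mulrA [_ * mu k]mulrC; congr (_ * _); apply: eq_bigr => a _.
    by rewrite countS zk addn0.
  have [tk _] := pz k (ltnSn k) zk.
  rewrite mulr1 mul0r sub0r -(sum_pairings tk zk) mulrN mulr_sumr; congr (- _).
  apply: eq_bigr => m _; rewrite /=; case zm' : (z m); rewrite ?mul0r ?mulr0 // !mul1r.
  rewrite /Wm mulrA; congr (_ * _).
  rewrite (bigD1 m) //= zm' mul1r [RHS](bigD1 m) //= {1}/zm eqxx andbF.
  rewrite (nuE m (ltn_ord m) zk zm') mulrC; congr (_ * _); apply: eq_bigr => l lm.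
  have h : (l == m :> nat) = false.
    by apply/negbTE; apply: contraNneq lm => E; apply/eqP/val_inj.
  by rewrite /zm h andbT.
apply: cvg_near_eq main; near=> n.
have kn : (k < n)%N by near: n; exact: ultra_gt.
have d0 : (n - k)%:R != 0 :> R by rewrite pnatr_eq0 -lt0n subn_gt0.
apply: (mulfI d0); rewrite [RHS]mulrCA (pavg_rec (p n) kn) big_ord_recr /= exprD.
rewrite mulrBr [RHS]mulrBr; congr (_ - _); first by field.
rewrite !mulr_sumr; apply: eq_bigr => m _; rewrite (flags_clear z (ltn_ord m)) !exprD.
by rewrite -/(pm m n); field.
Unshelve. all: end_near. Qed.

End PermutationAverages.

Lemma tuple_sum_widen (R : realType) n d (dn : (d <= n)%N) (u : 'I_n -> R)
    (v : 'I_n -> 'I_n -> R) (ka : 'I_n -> R) k :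
  tuple_sum u v ka (fun a => a < d)%N k =
  'C(n, k)%:R * \sum_(t : {ffun 'I_k -> 'I_d}) (\prod_l ka (widen_ord dn (t l))) *
    tavg (fun a => scaled u v (widen_ord dn a)) t ^+ 2.
Proof.
rewrite /tuple_sum; congr (_ * _).
pose h (t : {ffun 'I_k -> 'I_d}) : {ffun 'I_k -> 'I_n} := [ffun l => widen_ord dn (t l)].
have hi : injective h.
  move=> t t' /ffunP E; apply/ffunP => l; have := E l; rewrite !ffunE => /(congr1 val) /= e.
  exact/val_inj.
rewrite (eq_bigl (fun t => t \in [set h x | x in [set: {ffun 'I_k -> 'I_d}]]%SET)); last first.
  move=> t; apply/forallP/imsetP => [td|[x _ ->] l]; last by rewrite ffunE /=.
  exists [ffun l => Ordinal (td l)]; rewrite ?inE //.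
  by apply/ffunP => l; rewrite !ffunE; apply/val_inj.
rewrite big_imset /=; last by move=> x y _ _; exact: hi.
rewrite (eq_bigl predT) => [|t]; last by rewrite inE.
apply: eq_bigr => t _; congr (_ * _ ^+ 2); first by apply: eq_bigr => l _; rewrite ffunE.
rewrite !unlock; congr (_ * _); apply: eq_bigr => s _; apply: eq_bigr => i _.
by rewrite /tseq; case: insubP => //= l _ _; rewrite ffunE.
Qed.

(** * Limits of the sums over words of fixed length *)

Section TupleSumLimit.
Variables (R : realType) (rho : R * R -> R) (L C M : R).
Hypothesis rk : regular_kernel rho L C M.
Local Notation c := (weight_const L C).
Variables (v : forall n, nat -> 'I_n -> R) (ka : nat -> nat -> R).
Arguments v : clear implicits.
Hypothesis ef : eigen_family rho v ka.
Variable U : set_system nat.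
Hypotheses (UU : UltraFilter U) (oU : \oo `<=` U).

Let PU : ProperFilter U. Proof. exact: ultra_proper. Qed.
#[local] Existing Instance PU.

Let U_good : \forall n \near U, good rho L C n.
Proof. by apply: oU; exact: near_good rk. Qed.

Local Notation lam := (lam ka U).
Local Notation phi := (phi rho v ka U).

Lemma binomial_ratio_cvg k : 'C(n, k)%:R / n%:R ^+ k @[n --> U] --> (k`!%:R^-1 : R).
Proof.
have f0 : k`!%:R != 0 :> R by rewrite pnatr_eq0 -lt0n fact_gt0.
have h : k`!%:R^-1 * \prod_(i < k) ((n - i)%:R / n%:R) @[n --> U] --> (k`!%:R^-1 * \prod_(i < k) 1 : R).
  apply: cvgM; first exact: cvg_cst.
  apply: cvg_prodr => i; have h := @ratio_sub_cvg R U UU oU i.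
  have h' : (n%:R / (n - i)%:R)^-1 @[n --> U] --> (1^-1 : R) by apply: cvgV => //; exact: oner_neq0.
  by rewrite invr1 in h'; apply: cvg_near_eq h'; near=> n; rewrite /= invf_div.
rewrite big1 // mulr1 in h; apply: cvg_near_eq h; near=> n.
rewrite big_split /= prodr_const card_ord -natr_prod -ffact_prod -bin_ffact natrM exprVn.
by field; rewrite f0 expf_neq0 // pnatr_eq0 -lt0n; near: n; exact: ultra_gt.
Unshelve. all: end_near. Qed.

Definition psi n a (j : 'I_n) : R := Num.sqrt n%:R * v n a j / kweight rho j.

Section Letter.
Variable a : nat.
Hypothesis la : lam a != 0.

Let near_half : \forall n \near U, forall j : 'I_n, 1 / 2 <= kweight rho j.
Proof.
near=> n => j; have gn : good rho L C n by near: n.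
have [n0 _ u0 u1] := gn; have := u1 j.
have : c / n%:R <= 1 / 2.
  rewrite ler_pdivrMr ?ltr0n // mulrC mulrA mulr1 ler_pdivlMr //.
  by near: n; apply: oU; exact: nbhs_infty_ger.
by rewrite ler_norml; lra.
Unshelve. all: end_near. Qed.

Let near_inv : \forall n \near U, forall j : 'I_n, `|(kweight rho j)^-1 - 1| <= 2 * c / n%:R.
Proof.
near=> n => j; have gn : good rho L C n by near: n.
have [n0 _ u0 u1] := gn; have u0j := u0 j.
have hj : 1 / 2 <= kweight rho j by move: j {u0j}; near: n.
have -> : (kweight rho j)^-1 - 1 = - (kweight rho j - 1) / kweight rho j by field; rewrite gt_eqF.
rewrite normrM normrN normfV (gtr0_norm u0j) ler_pdivrMr //.
apply: le_trans (u1 j) _.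
have c0 := weight_const_ge0 rk.
have : 0 <= c / n%:R by rewrite divr_ge0.
have -> : 2 * c / n%:R * kweight rho j = c / n%:R * (2 * kweight rho j) by ring.
by move=> h; rewrite ler_peMr //; lra.
Unshelve. all: end_near. Qed.

Lemma phi_bounded : exists2 B : R, 0 <= B & forall x, 0 <= x <= 1 -> `|phi a x| <= B.
Proof.
exists (`|phi a 0| + phi_lip_const L ka U a) => [|x x01].
  rewrite addr_ge0 // divr_ge0 // mulr_ge0 //; exact: (rk_L rk).
exact: lip01_bounded (phi_lip rk ef UU oU la) x01.
Qed.

Let near_v_bound : exists2 B : R, 0 <= B &
  \forall n \near U, forall j : 'I_n, `|Num.sqrt n%:R * v n a j| <= B.
Proof.
have [B B0 hB] := phi_bounded; exists (B + 1); first by rewrite addr_ge0.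
have h := phi_grid rk ef UU oU la ltr01.
near=> n => j.
have h1 : forall j, `|Num.sqrt n%:R * v n a j - phi a (grid R n j)| <= 1 by near: n.
have := h1 j; have := hB _ (grid01 R j).
have := ler_normD (Num.sqrt n%:R * v n a j - phi a (grid R n j)) (phi a (grid R n j)).
by rewrite subrK; lra.
Unshelve. all: end_near. Qed.

Let near_psi_diff : exists2 B : R, 0 <= B &
  \forall n \near U, forall j : 'I_n, `|psi a j - Num.sqrt n%:R * v n a j| <= B / n%:R.
Proof.
have [B B0 hB] := near_v_bound; have c0 := weight_const_ge0 rk.
exists (B * (2 * c)); first by rewrite !mulr_ge0.
near=> n => j.
have -> : psi a j - Num.sqrt n%:R * v n a j =
  (Num.sqrt n%:R * v n a j) * ((kweight rho j)^-1 - 1) by rewrite /psi; ring.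
rewrite normrM -mulrA; apply: ler_pM => //; move: j; near: n => //.
Unshelve. all: end_near. Qed.

Lemma psi_grid : grid_unif U (fun n i => @psi n a i) (phi a).
Proof.
move=> e e0; have [B B0 hB] := near_psi_diff.
have e2 : 0 < e / 2 by rewrite divr_gt0.
have h := phi_grid rk ef UU oU la e2.
have hO : B / n%:R @[n --> U] --> (0 : R).
  by rewrite -[X in _ --> X](mulr0 B); apply: cvgM (ultra_invn oU); exact: cvg_cst.
move/cvgrPdist_le: hO => /(_ _ e2) hO.
near=> n => i.
have h1 : forall i, `|Num.sqrt n%:R * v n a i - phi a (grid R n i)| <= e / 2 by near: n.
have h2 : forall i : 'I_n, `|psi a i - Num.sqrt n%:R * v n a i| <= B / n%:R by near: n.
have : `|0 - B / n%:R| <= e / 2 by near: n.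
rewrite sub0r normrN => /(le_trans (ler_norm _)) h3.
have -> : psi a i - phi a (grid R n i) = (psi a i - Num.sqrt n%:R * v n a i) +
  (Num.sqrt n%:R * v n a i - phi a (grid R n i)) by ring.
apply: le_trans (ler_normD _ _) _; have := h1 i; have := h2 i; lra.
Unshelve. all: end_near. Qed.

Lemma psi_bound : exists B : R, \forall n \near U, forall i : 'I_n, `|psi a i| <= B.
Proof.
have [B B0 hB] := phi_bounded; exists (B + 1); have h := psi_grid ltr01.
near=> n => j.
have h1 : forall j : 'I_n, `|psi a j - phi a (grid R n j)| <= 1 by near: n.
have := h1 j; have := hB _ (grid01 R j).
have := ler_normD (psi a j - phi a (grid R n j)) (phi a (grid R n j)).
by rewrite subrK; lra.
Unshelve. all: end_near. Qed.

(** The eigenvector sums to 0 exactly, and division by the weights changes each of the [n] scaled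
    entries by [O(1/n)]. *)
Lemma psi_sum : exists B : R, \forall n \near U, `|\sum_(i < n) psi a i| <= B.
Proof.
have [B B0 hB] := near_psi_diff; exists B; have hk := near_lam_neq0 rk ef UU oU la.
near=> n; have gn : good rho L C n by near: n.
have n0 : 0 < n%:R :> R by have [] := gn; rewrite ltr0n.
have -> : \sum_(i < n) psi a i = \sum_(i < n) (psi a i - Num.sqrt n%:R * v n a i).
  by rewrite sumrB -mulr_sumr (ev_sum0 rk ef gn) ?mulr0 ?subr0 //; near: n.
apply: le_trans (ler_norm_sum _ _ _) _.
apply: le_trans (_ : \sum_(i < n) B / n%:R <= _).
  by apply: ler_sum => i _; move: i; near: n.
by rewrite sumr_const card_ord -[leLHS]mulr_natr mulfVK // gt_eqF.
Unshelve. all: end_near. Qed.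

End Letter.

Lemma psi_orth a b : lam a != 0 -> lam b != 0 ->
  n%:R^-1 * (\sum_(i < n) psi a i * psi b i) @[n --> U] --> ((a == b)%:R : R).
Proof.
move=> la lb; rewrite -(phi_orth rk ef UU oU la lb).
have pa := phi_lip rk ef UU oU la; have pb := phi_lip rk ef UU oU lb.
exact: (grid_unif_cvg UU oU (lip01M pa pb) (grid_unifM UU pa pb (psi_grid la) (psi_grid lb))).
Qed.

Variable d : nat.
Hypothesis lam_d : forall a, (a < d)%N -> lam a != 0.

Let letter_count_true (k : nat) (t : {ffun 'I_k -> 'I_d}) (a : 'I_d) :
  letter_count xpredT (fun l => oapp (fun i => val (t i)) 0%N (insub l)) k a = mult t a.
Proof. by apply: eq_bigr => l _; rewrite valK /=. Qed.

(** The case of [pavg_cvg] in which every position is flagged. *)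
Lemma tavg_psi_cvg k (t : {ffun 'I_k -> 'I_d}) :
  Num.sqrt n%:R ^+ k * tavg (fun (a : 'I_d) (j : 'I_n) => psi a j) t @[n --> U] -->
    \prod_a hermite0 R (mult t a).
Proof.
pose tn l := oapp (fun i => val (t i)) 0%N (insub l).
pose p n := tseq (fun (a : 'I_d) (j : 'I_n) => psi a j) t.
have pE l n i : (l < k)%N -> (tn l < d)%N /\ p n l i = psi (tn l) i.
  by move=> lk; rewrite /tn /p /tseq (insubT (fun l => l < k)%N lk) /=.
have H1 l : (l < k)%N -> exists B : R, \forall n \near U, forall i, `|p n l i| <= B.
  move=> lk; have [B hB] := psi_bound (lam_d (proj1 (pE l 1%N ord0 lk))); exists B.
  near=> n => i; have [_ ->] := pE l n i lk; move: i; near: n.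
  exact: hB.
have H2 l : (l < k)%N -> xpredT l -> (tn l < d)%N /\ forall n i, p n l i = psi (tn l) i.
  move=> lk _; split; first exact: (proj1 (pE l 1%N ord0 lk)).
  by move=> n i; exact: (proj2 (pE l n i lk)).
have H3 l : (l < k)%N -> ~~ xpredT l -> n%:R^-1 * (\sum_i p n l i) @[n --> U] --> (0 : R) by [].
have := pavg_cvg UU oU (fun a ad => psi_sum (lam_d ad))
  (fun a b ad bd => psi_orth (lam_d ad) (lam_d bd)) H1 H2 H3.
rewrite [\prod_(l < k) _]big1 // mul1r [(\sum_(l < k) _)%N](_ : _ = k); last first.
  by rewrite -[RHS]card_ord -sum1_card.
move=> h.
rewrite -[X in _ --> X](_ : \prod_(a < d) hermite0 R (letter_count xpredT tn k a) = _).
  by apply: cvg_near_eq h; near=> n; rewrite unlock.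
by apply: eq_bigr => a _; rewrite letter_count_true.
Unshelve. all: end_near. Qed.

Lemma limit_coefE_tuples k (l : 'I_d -> R) : limit_coef l k =
  (k`!%:R)^-1 * \sum_(t : {ffun 'I_k -> 'I_d}) \prod_i l (t i) *
    (\prod_a hermite0 R (mult t a)) ^+ 2.
Proof.
have f0 m : m`!%:R != 0 :> R by rewrite pnatr_eq0 -lt0n fact_gt0.
apply: (mulfI (f0 k)); rewrite mulrA mulfV // mul1r mulr_natl -sum_mult_coef.
apply: eq_bigr => t _; rewrite (prod_mult t l) -prodrXl -big_split; apply: eq_bigr => a _ /=.
rewrite coef_poly ltnS mult_le -[LHS]mulr_natr /series_coef; field; exact: f0.
Qed.

(** The binomial coefficient grows like [n^k / k!], and [n^k] is absorbed by the squares of the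
    averages. *)
Lemma tuple_sum_cvg k :
  tuple_sum (fun i : 'I_n => kweight rho i) (fun (a : 'I_n) j => v n a j)
    (fun a : 'I_n => ka n a) (fun a => a < d)%N k @[n --> U] -->
  limit_coef (fun a : 'I_d => lam a) k.
Proof.
have h : 'C(n, k)%:R / n%:R ^+ k * \sum_(t : {ffun 'I_k -> 'I_d}) (\prod_l ka n (t l)) *
    (Num.sqrt n%:R ^+ k * tavg (fun (a : 'I_d) (j : 'I_n) => psi a j) t) ^+ 2 @[n --> U] -->
    limit_coef (fun a : 'I_d => lam a) k.
  rewrite limit_coefE_tuples; apply: cvgM; first exact: binomial_ratio_cvg.
  apply: cvg_sumr => t; apply: cvgM; first by apply: cvg_prodr => i; exact: (lam_cvg rk ef UU oU).
  by rewrite expr2; under eq_fun do rewrite expr2; apply: cvgM; exact: tavg_psi_cvg.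
apply: cvg_near_eq h; near=> n.
have n0 : 0 < n%:R :> R by rewrite ltr0n; near: n; exact: ultra_gt.
have dn : (d <= n)%N by near: n; apply: filterS (ultra_gt oU d) => ? /ltnW.
rewrite (tuple_sum_widen dn) -mulrA; congr (_ * _); rewrite mulr_sumr.
apply: eq_bigr => t _; rewrite mulrCA; congr (_ * _).
rewrite exprMn mulrA -exprM mulnC exprM sqr_sqrtr ?(ltW n0) // mulVf ?mul1r //.
by rewrite expf_neq0 // gt_eqF.
Unshelve. all: end_near. Qed.

End TupleSumLimit.

(** * The limit of [perm_average] along an ultrafilter *)

Lemma perm_average_expand (R : realType) (rho : R * R -> R) n (v : 'I_n -> 'I_n -> R)
    (ka : 'I_n -> R) : (0 < n)%N -> (forall i : 'I_n, kweight rho i != 0) ->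
  (forall a b, \sum_j v a j * v b j = (a == b)%:R) ->
  (forall a i, \sum_j kmatrix rho i j * v a j = ka a * v a i) ->
  perm_average rho n = (\prod_(i < n) kweight rho i) ^+ 2 *
    \sum_(k < n.+1) tuple_sum (fun i : 'I_n => kweight rho i) v ka predT k.
Proof.
move=> n0 u0 vo ve.
have n0' : n%:R != 0 :> R by rewrite pnatr_eq0 -lt0n.
have s2 : Num.sqrt n%:R ^+ 2 = n%:R :> R by rewrite sqr_sqrtr.
pose f := scaled (fun i : 'I_n => kweight rho i) v.
have E (i j : 'I_n) : rho (grid R n i, grid R n j) =
    kweight rho i * kweight rho j * (1 + \sum_a ka a * f a i * f a j).
  have h : n%:R^-1 * (rho (grid R n i, grid R n j) - kweight rho i * kweight rho j) =
      \sum_a ka a * v a i * v a j by exact: (spectral_decomposition vo ve i j).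
  have -> : rho (grid R n i, grid R n j) = kweight rho i * kweight rho j +
      n%:R * (n%:R^-1 * (rho (grid R n i, grid R n j) - kweight rho i * kweight rho j)).
    by rewrite mulrA divff // mul1r; ring.
  rewrite h [RHS]mulrDr mulr1; congr (_ + _); rewrite !mulr_sumr; apply: eq_bigr => a _.
  rewrite /f /scaled; move: s2; move: (Num.sqrt n%:R) => s <-; field.
  by rewrite !u0.
transitivity ((n`!%:R)^-1 * \sum_(s : 'S_n) ((\prod_(i < n) kweight rho i) ^+ 2 *
    \prod_i (1 + \sum_a ka a * f a i * f a (s i)))).
  congr (_ * _); apply: eq_bigr => s _; rewrite (eq_bigr _ (fun i _ => E i (s i))).
  rewrite big_split /=; congr (_ * _); rewrite big_split /= expr2; congr (_ * _).
  by rewrite [RHS](reindex_inj (@perm_inj _ s)).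
rewrite -mulr_sumr mulrCA; congr (_ * _); rewrite permanent_expand.
apply: eq_bigr => k _; congr (_ * _); apply: eq_bigl => t.
by apply/esym/forallP.
Qed.

Lemma perturb_const_le (R : realType) n (u : 'I_n -> R) (c : R) : (0 < n)%N -> 0 <= c ->
  1 / 2 <= \prod_i u i -> perturb_const u c <= 4 * expR (3 * c + c ^+ 2).
Proof.
move=> n0 c0 u2; have n0' : 0 < n%:R :> R by rewrite ltr0n.
have u0 : 0 < \prod_i u i by apply: lt_le_trans u2; rewrite divr_gt0.
rewrite /perturb_const; set x := 3 * c + c ^+ 2.
have x0 : 0 <= x by rewrite /x addr_ge0 ?mulr_ge0 ?exprn_ge0.
rewrite ler_pdivrMr ?exprn_gt0 //.
have h : (1 + x / n%:R) ^+ n <= expR x.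
  have -> : expR x = expR (x / n%:R) ^+ n.
    by rewrite -expRM_natr mulfVK // gt_eqF.
  rewrite lerXn2r ?nnegrE ?expR_ge0 ?addr_ge0 ?divr_ge0 ?(ltW n0') //.
  exact: expR_ge1Dx.
apply: le_trans h _; rewrite mulrAC ler_peMl ?expR_ge0 //.
have : (1 / 2) ^+ 2 <= (\prod_i u i) ^+ 2 by rewrite lerXn2r ?nnegrE ?(ltW u0) ?divr_ge0.
by rewrite expr2; lra.
Qed.

Section PermAverageLimit.
Variables (R : realType) (rho : R * R -> R) (L C M : R).
Hypothesis rk : regular_kernel rho L C M.
Local Notation c := (weight_const L C).
Local Notation S := (trace_const L C M).
Local Notation KL := (kmatrix_lip_const L C).
Variables (v : forall n, nat -> 'I_n -> R) (ka : nat -> nat -> R).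
Arguments v : clear implicits.
Hypothesis ef : eigen_family rho v ka.
Variable U : set_system nat.
Hypotheses (UU : UltraFilter U) (oU : \oo `<=` U).

Let PU : ProperFilter U. Proof. exact: ultra_proper. Qed.
#[local] Existing Instance PU.

Local Notation lam := (lam ka U).
Hypothesis lam0_lt1 : `|lam 0| < 1.

Let U_good : \forall n \near U, good rho L C n.
Proof. by apply: oU; exact: near_good rk. Qed.

Local Notation TS := (fun n A k =>
  tuple_sum (fun i : 'I_n => kweight rho i) (fun (a : 'I_n) j => v n a j)
    (fun a : 'I_n => ka n a) A k).

Lemma lam_lt1 a : `|lam a| < 1.
Proof. by apply: le_lt_trans lam0_lt1; exact: (lam_sorted rk ef UU oU). Qed.

(** [q0] lies strictly between [|lam 0|] and 1 and eventually bounds all eigenvalues; the larger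
    [q], still below 1, leaves room for the ratio [q / q0 > 1] used in the tail estimate. *)
Let q0 : R := (1 + `|lam 0|) / 2.
Let q : R := (1 + q0) / 2.
Let q0_gt0 : 0 < q0.
Proof. by rewrite divr_gt0 // ltr_pwDl. Qed.
Let q01 : q0 < q. Proof. by rewrite /q /q0; have := lam0_lt1; lra. Qed.
Let q1 : q < 1. Proof. by rewrite /q /q0; have := lam0_lt1; lra. Qed.

Let near_q0 : \forall n \near U, forall a, `|ka n a| <= q0.
Proof.
have h : ka n 0%N @[n --> U] --> lam 0 := @lam_cvg R rho L C M rk v ka ef U UU oU 0%N.
have e0 : 0 < (1 - `|lam 0|) / 2 by rewrite divr_gt0 // subr_gt0.
move/cvgrPdist_le: h => /(_ _ e0) h; near=> n => a.
apply: le_trans (ef_sorted ef n (leq0n a)) _.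
have : `|lam 0 - ka n 0%N| <= (1 - `|lam 0|) / 2 by near: n.
have := ler_normB (lam 0) (lam 0 - ka n 0%N); rewrite opprB addrC subrK /q0; lra.
Unshelve. all: end_near. Qed.

Let E0 : R := 4 * expR (3 * c + c ^+ 2).
Let cq : R := expR 1 / (1 - q) ^+ 2.

Let cq_ge0 : 0 <= cq.
Proof. by rewrite divr_ge0 ?expR_ge0 // sqr_ge0. Qed.

Let near_E0 : \forall n \near U, perturb_const (fun i : 'I_n => kweight rho i) c <= E0.
Proof.
have h := prod_kweight_cvg rk; have e2 : 0 < 1 / 2 :> R by rewrite divr_gt0.
move/cvgrPdist_le: h => /(_ _ e2) /oU h.
near=> n; have gn : good rho L C n by near: n.
have [n0 _ _ _] := gn; apply: perturb_const_le => //; first exact: weight_const_ge0 rk.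
have : `|1 - \prod_(i < n) kweight rho i| <= 1 / 2 by near: n.
by rewrite ler_norml; lra.
Unshelve. all: end_near. Qed.

Let vo n (a b : 'I_n) : \sum_j v n a j * v n b j = (a == b)%:R.
Proof. by rewrite (ef_orth ef). Qed.

Let vm n (gn : good rho L C n) (a : 'I_n) : ka n a != 0 -> \sum_j v n a j = 0.
Proof. exact: (ev_sum0 rk ef gn). Qed.

Lemma near_tail K : \forall n \near U, forall A,
  \sum_(k < n.+1 | (K <= k)%N) `|TS n A k| <= E0 * (q / q0) ^- K * expR (cq * (q / q0) * S).
Proof.
near=> n => A; have gn : good rho L C n by near: n.
have [n0 _ u0 u1] := gn.
have kq : forall a, `|ka n a| <= q0 by near: n.
have En : perturb_const (fun i : 'I_n => kweight rho i) c <= E0 by near: n.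
have r1 : 1 < q / q0 by rewrite ltr_pdivlMr // mul1r.
have r0 : 0 < q / q0 by apply: lt_trans r1.
have rq (a : 'I_n) : q / q0 * `|ka n a| <= q.
  by rewrite mulrAC ler_pdivrMr // ler_wpM2l // ltW // (lt_trans q0_gt0).
have c0 := weight_const_ge0 rk.
apply: le_trans (sum_tuple_sum_tail n0 c0 u0 u1 (@vo n) (@vm n gn) q1 A K r1 rq) _.
have X0 : 0 <= (q / q0) ^- K by rewrite invr_ge0 exprn_ge0 // ltW.
apply: ler_pM.
- rewrite mulr_ge0 // /perturb_const divr_ge0 ?sqr_ge0 // exprn_ge0 // addr_ge0 // divr_ge0 //.
  by rewrite addr_ge0 ?mulr_ge0 ?sqr_ge0.
- exact: expR_ge0.
- by rewrite ler_wpM2r.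
rewrite ler_expR ler_wpM2l ?(mulr_ge0 cq_ge0 (ltW r0)) //.
apply: (le_trans _ (sum_ka_le rk ef gn)).
by rewrite [leRHS](bigID A) /= lerDl sumr_ge0.
Unshelve. all: end_near. Qed.

Section Truncation.
Variable d : nat.
Hypothesis lam_d : forall a, (a < d)%N -> lam a != 0.

(** Dominated convergence over word lengths: [near_tail] makes the lengths beyond some fixed [K]
    negligible uniformly in [n], and the finitely many others converge termwise. *)
Lemma truncated_cvg :
  \sum_(k < n.+1) TS n (fun a => a < d)%N k @[n --> U] -->
  \prod_(a < d) (1 - lam a ^+ 2) `^ (- 2^-1).
Proof.
set P := \prod_(a < d) _.
have hl := sum_limit_coef_cvg (fun a : 'I_d => lam_lt1 a).
apply/cvgrPdist_le => e e0.
have e3 : 0 < e / 3 by rewrite divr_gt0.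
have tc : E0 * (q / q0) ^- K * expR (cq * (q / q0) * S) @[K --> \oo] --> (0 : R).
  rewrite -[X in _ --> X](mul0r (expR (cq * (q / q0) * S))); apply: cvgM; last exact: cvg_cst.
  rewrite -[X in _ --> X](mulr0 E0); apply: cvgM; first exact: cvg_cst.
  under eq_fun do rewrite -exprVn; apply: cvg_expr.
  have q_gt0 : 0 < q by exact: lt_trans q01.
  rewrite invf_div ger0_norm; last by apply: divr_ge0; apply: ltW.
  by rewrite ltr_pdivrMr // mul1r.
move/cvgrPdist_le: hl => /(_ _ e3) hl; move/cvgrPdist_le: tc => /(_ _ e3) tc.
have [K [hK1 hK2]] : exists K, `|P - \sum_(k < K) limit_coef (fun a : 'I_d => lam a) k| <= e / 3 /\
    E0 * (q / q0) ^- K * expR (cq * (q / q0) * S) <= e / 3.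
  have [K _ hK] := filterI hl tc; exists K; have [h1 h2] := hK K (leqnn K); split=> //.
  by move: h2; rewrite sub0r normrN => /(le_trans (ler_norm _)).
have hf : \sum_(k < K) TS n (fun a => a < d)%N k @[n --> U] -->
    \sum_(k < K) limit_coef (fun a : 'I_d => lam a) k.
  by apply: cvg_sumr => k; exact: (tuple_sum_cvg rk ef UU oU lam_d).
move/cvgrPdist_le: hf => /(_ _ e3) hf; have ht := near_tail K.
near=> n.
have h1 : `|\sum_(k < K) limit_coef (fun a : 'I_d => lam a) k - \sum_(k < K) TS n (fun a => a < d)%N k| <= e / 3.
  by near: n.
have h2 : forall A, \sum_(k < n.+1 | (K <= k)%N) `|TS n A k| <= E0 * (q / q0) ^- K * expR (cq * (q / q0) * S).
  by near: n.
have Kn : (K <= n.+1)%N by near: n; apply: filterS (ultra_gt oU K) => ? /ltnW/leqW.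
have {}h2 := le_trans (h2 (fun a => a < d)%N) hK2.
have E : \sum_(k < n.+1) TS n (fun a => a < d)%N k = \sum_(k < K) TS n (fun a => a < d)%N k +
   \sum_(k < n.+1 | (K <= k)%N) TS n (fun a => a < d)%N k.
  rewrite (bigID (fun k : 'I_n.+1 => k < K)%N) /=; congr (_ + _).
    by rewrite (big_ord_widen _ (fun k => TS n (fun a => a < d)%N k) Kn).
  by apply: eq_bigl => k /=; rewrite -leqNgt.
have h3 := le_trans (ler_norm_sum _ _ _) h2.
rewrite E; move: hK1 h1 h3; rewrite !ler_norml; lra.
Unshelve. all: end_near. Qed.

(** The bound of [ka_tail] on the discarded eigenvalues converges along [U] to the quantity assumed
    smaller than [eta], so it is eventually smaller too. *)
Lemma near_truncation eta : 0 < eta ->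
  (exists2 m, (0 < m)%N & `|lam d| * m.+1%:R + KL * Num.sqrt (2 / m%:R) < eta) ->
  \forall n \near U, `|\sum_(k < n.+1) TS n predT k - \sum_(k < n.+1) TS n (fun a => a < d)%N k| <=
    E0 * expR (cq * S) * (expR (cq * eta) - 1).
Proof.
move=> eta0 [m m0 hm].
have hc : `|ka n d| * m.+1%:R + KL * Num.sqrt (2 / m%:R) @[n --> U] -->
    `|lam d| * m.+1%:R + KL * Num.sqrt (2 / m%:R).
  apply: cvgD; last exact: cvg_cst.
  by apply: cvgM; [apply: cvg_norm; exact: (lam_cvg rk ef UU oU)|exact: cvg_cst].
have hlt := cvgr_lt _ hc _ hm.
near=> n; have gn : good rho L C n by near: n.
have [n0 _ u0 u1] := gn.
have kq : forall a, `|ka n a| <= q0 by near: n.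
have En : perturb_const (fun i : 'I_n => kweight rho i) c <= E0 by near: n.
have kq' (a : 'I_n) : `|ka n a| <= q by apply: le_trans (kq a) _; exact: ltW.
have c0 := weight_const_ge0 rk.
apply: le_trans (sum_tuple_sum_diff n0 c0 u0 u1 (@vo n) (@vm n gn) q1 _ kq') _.
have P0 : 0 <= perturb_const (fun i : 'I_n => kweight rho i) c.
  rewrite /perturb_const divr_ge0 ?sqr_ge0 // exprn_ge0 // addr_ge0 // divr_ge0 //.
  by rewrite addr_ge0 ?mulr_ge0 ?sqr_ge0.
apply: ler_pM.
- by rewrite mulr_ge0 ?expR_ge0.
- by rewrite subr_ge0 -[leLHS]expR0 ler_expR (mulr_ge0 cq_ge0) // sumr_ge0.
- by apply: ler_pM; rewrite ?expR_ge0 // ler_expR ler_wpM2l // (sum_ka_le rk ef gn).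
rewrite lerD2r ler_expR ler_wpM2l //.
have mn : (m <= n)%N by near: n; apply: filterS (ultra_gt oU m) => ? /ltnW.
have := ka_tail rk ef d gn m0 mn.
under eq_bigl => a do rewrite leqNgt.
move=> /le_trans; apply; apply: ltW; near: n; exact: hlt.
Unshelve. all: end_near. Qed.

End Truncation.

Let factor_gt0 a : 0 < 1 - lam a ^+ 2.
Proof. by rewrite subr_gt0 -real_normK ?num_real // expr_lt1 // lam_lt1. Qed.

Lemma prod_powR d : \prod_(a < d) (1 - lam a ^+ 2) `^ (- 2^-1) =
  (Num.sqrt (\prod_(a < d) (1 - lam a ^+ 2)))^-1.
Proof.
elim: d => [|d IH]; first by rewrite !big_ord0 sqrtr1 invr1.
have f0 := ltW (factor_gt0 d).
rewrite !big_ord_recr /= IH sqrtrM; last first.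
  by apply: prodr_ge0 => a _; exact: ltW.
by rewrite powRN powR12_sqrt // invfM mulrC.
Qed.

Variable D : R.
Hypothesis D_gt0 : 0 < D.
Hypothesis D_cvg : \prod_(a < d) (1 - lam a ^+ 2) @[d --> \oo] --> D.

(** Retained letters need a nonzero limit eigenvalue, as only these have a limit eigenfunction. If
    some [lam a] with [a < m] vanishes, the cut is made at the first zero: all later ones vanish by
    sortedness and contribute factors 1. *)
Lemma exists_truncation e delta : 0 < e -> 0 < delta -> exists d,
  [/\ forall a, (a < d)%N -> lam a != 0, `|lam d| < delta &
    `|D `^ (- 2^-1) - \prod_(a < d) (1 - lam a ^+ 2) `^ (- 2^-1)| <= e].
Proof.
move=> e0 delta0.
have hP : \prod_(a < d) (1 - lam a ^+ 2) `^ (- 2^-1) @[d --> \oo] --> D `^ (- 2^-1).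
  rewrite powRN (powR12_sqrt (ltW D_gt0)); under eq_fun do rewrite prod_powR.
  apply: cvgV; first by rewrite gt_eqF // sqrtr_gt0.
  exact: (continuous_cvg _ (@sqrt_continuous R _) D_cvg).
have [N _ hN] : \forall d \near \oo, `|D `^ (- 2^-1) - \prod_(a < d) (1 - lam a ^+ 2) `^ (- 2^-1)| <= e.
  by move/cvgrPdist_le: hP; apply.
pose m := maxn N (Num.truncn (S / delta)).
have lm : `|lam m| < delta.
  have h := @lam_decay R rho L C M rk v ka ef U UU oU m.
  have m0 : 0 < m.+1%:R :> R by rewrite ltr0n.
  rewrite -(ltr_pM2r m0); apply: le_lt_trans h _; rewrite mulrC -ltr_pdivrMr //.
  apply: lt_le_trans (truncnS_gt _) _; rewrite ler_nat ltnS; exact: leq_maxr.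
have hm := hN m (leq_maxl _ _).
have [h|] := boolP [forall a : 'I_m, lam a != 0].
  by exists m; split=> // a am; exact: (forallP h (Ordinal am)).
rewrite negb_forall => /existsP[a]; rewrite negbK => /eqP la.
have ex : exists b, lam b == 0 by exists a; rewrite la.
case: (ex_minnP ex) => b /eqP lb bmin.
have bm : (b <= m)%N by rewrite (leq_trans (bmin a _)) ?la // ltnW.
exists b; split => [x xb||]; [|by rewrite lb normr0|].
  by apply: contraTneq xb => lx; rewrite -leqNgt bmin // lx.
suff -> : \prod_(a < b) (1 - lam a ^+ 2) `^ (- 2^-1) = \prod_(a < m) (1 - lam a ^+ 2) `^ (- 2^-1) by [].
rewrite -!(big_mkord predT (fun a => (1 - lam a ^+ 2) `^ (- 2^-1))).
rewrite [RHS](big_cat_nat (leq0n b) bm) /= [X in _ = _ * X]big_nat [X in _ = _ * X]big1 ?mulr1 // => x /andP[bx _].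
suff -> : lam x = 0 by rewrite expr0n subr0 powR1.
apply/normr0_eq0/eqP; rewrite eq_le normr_ge0 andbT -(normr0 R) -lb.
exact: (lam_sorted rk ef UU oU).
Qed.

(** The order of choices is: [eta] from the error of truncation, [m] from [eta], the threshold for
    [|lam d|] from [eta] and [m], then the alphabet size [d], and [n] last. *)
Lemma perm_average_ultra : perm_average rho n @[n --> U] --> D `^ (- 2^-1).
Proof.
set T := D `^ _.
have hX : \sum_(k < n.+1) TS n predT k @[n --> U] --> T.
  apply/cvgrPdist_le => e e0.
  have e3 : 0 < e / 3 by rewrite divr_gt0.
  pose B := E0 * expR (cq * S).
  have [eta eta0 heta] : exists2 eta, 0 < eta & B * (expR (cq * eta) - 1) <= e / 3.
    have hB : B * (expR (cq * n%:R^-1) - 1) @[n --> \oo] --> B * (expR (cq * 0) - 1).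
      apply: cvgM; first exact: cvg_cst.
      apply: cvgB; last exact: cvg_cst.
      apply: (continuous_cvg _ (@continuous_expR R _)).
      by apply: cvgM; [exact: cvg_cst|exact: cvg_invn].
    rewrite mulr0 expR0 subrr mulr0 in hB.
    move/cvgrPdist_le: hB => /(_ _ e3)[N _ hN]; exists (N.+1%:R^-1); first by rewrite invr_gt0.
    by have := hN N.+1 (leqnSn N); rewrite /= sub0r normrN => /(le_trans (ler_norm _)).
  have [m m0 hm] : exists2 m, (0 < m)%N & KL * Num.sqrt (2 / m%:R) < eta / 2.
    have hK : KL * Num.sqrt (2 * n%:R^-1) @[n --> \oo] --> KL * Num.sqrt (2 * 0).
      apply: cvgM; first exact: cvg_cst.
      apply: (continuous_cvg _ (@sqrt_continuous R _)).
      by apply: cvgM; [exact: cvg_cst|exact: cvg_invn].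
    rewrite mulr0 sqrtr0 mulr0 in hK.
    have eta2 : 0 < eta / 2 by rewrite divr_gt0.
    have [N _ hN] := cvgr_lt _ hK _ eta2.
    by exists N.+1 => //; exact: hN N.+1 (leqnSn N).
  have delta0 : 0 < eta / 2 / m.+1%:R by rewrite !divr_gt0.
  have [d [lam_d ld Pd]] := exists_truncation e3 delta0.
  have hd : \forall n \near U, `|\sum_(k < n.+1) TS n predT k - \sum_(k < n.+1) TS n (fun a => a < d)%N k| <=
      B * (expR (cq * eta) - 1).
    apply: near_truncation => //; exists m => //.
    by move: ld; rewrite ltr_pdivlMr ?ltr0n //; lra.
  have tr := truncated_cvg lam_d; move/cvgrPdist_le: tr => /(_ _ e3) tr.
  near=> n.
  pose X := \sum_(k < n.+1) TS n predT k; pose Y := \sum_(k < n.+1) TS n (fun a => a < d)%N k.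
  pose P := \prod_(a < d) (1 - lam a ^+ 2) `^ (- 2^-1).
  have h1 : `|X - Y| <= e / 3 by apply: le_trans heta; rewrite /X /Y; near: n.
  have h2 : `|P - Y| <= e / 3 by rewrite /P /Y; near: n.
  have h3 : `|T - P| <= e / 3 := Pd.
  rewrite -/X; move: X Y P T h1 h2 h3 => X Y P T; rewrite !ler_norml; lra.
have hu : \prod_(i < n) kweight rho i @[n --> U] --> (1 : R).
  by apply: cvg_trans (prod_kweight_cvg rk) => A; exact: oU.
have h : (\prod_(i < n) kweight rho i) ^+ 2 * \sum_(k < n.+1) TS n predT k @[n --> U] --> T.
  rewrite -[X in _ --> X]mul1r; apply: cvgM hX.
  rewrite -[X in _ --> X](mulr1 1); under eq_fun do rewrite expr2.
  by apply: cvgM.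
apply: cvg_near_eq h; near=> n; have gn : good rho L C n by near: n.
have [n0 _ u0 _] := gn; apply/esym/perm_average_expand => //.
- by move=> i; rewrite gt_eqF.
- by move=> a i; rewrite (ef_eig ef).
Unshelve. all: end_near. Qed.

End PermAverageLimit.

(** * Integrals and almost everywhere equality on the unit interval *)

Section UnitInterval.
Variable R : realType.
Implicit Types (f g h : R -> R) (B m : R).

Local Notation leb := (@lebesgue_measure R).
Local Notation I01 := `[(0 : R), 1]%classic.

Local Instance leb_ae_filter : Filter (nbhs (almost_everywhere leb)).
Proof. exact: ae_filter_ringOfSetsType. Qed.

Definition integ01 f : Prop := leb.-integrable I01 (EFin \o f).

Lemma lip01_integ B f : lip01 B f -> integ01 f.
Proof. exact: lip01_integrable. Qed.

Lemma integ01_measurable f : integ01 f -> measurable_fun (T := measurableTypeR R) I01 f.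
Proof. by move=> /integrableP[h _]; apply/measurable_EFinP. Qed.

Lemma eq_int01 f g : (forall x, 0 <= x <= 1 -> f x = g x) -> int01 f = int01 g.
Proof. by move=> fg; apply: eq_Rintegral => x; rewrite inE /= in_itv /=; exact: fg. Qed.

Lemma integ01Z (c : R) f : integ01 f -> integ01 (fun x => c * f x).
Proof. by move=> fi; apply: eq_integrable (integrableZl _ c fi). Qed.

Lemma int01Z (c : R) f : integ01 f -> int01 (fun x => c * f x) = c * int01 f.
Proof. by move=> fi; rewrite /int01 RintegralZl. Qed.

Lemma integ01D f g : integ01 f -> integ01 g -> integ01 (fun x => f x + g x).
Proof. by move=> fi gi; apply: eq_integrable (integrableD _ fi gi). Qed.

Lemma int01D f g : integ01 f -> integ01 g -> int01 (fun x => f x + g x) = int01 f + int01 g.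
Proof. by move=> fi gi; rewrite /int01 RintegralD. Qed.

Lemma integ01B f g : integ01 f -> integ01 g -> integ01 (fun x => f x - g x).
Proof. by move=> fi gi; apply: eq_integrable (integrableB _ fi gi). Qed.

Lemma int01B f g : integ01 f -> integ01 g -> int01 (fun x => f x - g x) = int01 f - int01 g.
Proof. by move=> fi gi; rewrite /int01 RintegralB. Qed.

Lemma integ01_sum (J : finType) (f : J -> R -> R) : (forall j, integ01 (f j)) ->
  integ01 (fun x => \sum_j f j x).
Proof.
move=> fi; apply: eq_integrable (@integrable_sum _ _ _ leb I01 _ J (index_enum J) predT
  (fun j => EFin \o f j) (fun j _ => fi j)) => //.
by move=> x _ /=; rewrite sumEFin.
Qed.

Lemma int01_sum (J : finType) (f : J -> R -> R) : (forall j, integ01 (f j)) ->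
  int01 (fun x => \sum_j f j x) = \sum_j int01 (f j).
Proof.
move=> fi; have gen s : integ01 (fun x => \sum_(j <- s) f j x) /\
    int01 (fun x => \sum_(j <- s) f j x) = \sum_(j <- s) int01 (f j).
  elim: s => [|j s [IH1 IH2]].
    rewrite big_nil; have E : (fun x : R => \sum_(j <- [::]) f j x) = (fun x => 0 * 0).
      by apply/funext => x; rewrite big_nil mul0r.
    have i0 : integ01 (fun=> 0).
      by apply: (@lip01_integ 0) => x y _ _; rewrite subrr normr0 mul0r.
    by rewrite E; split; [exact: integ01Z|rewrite int01Z // mul0r].
  have E : (fun x => \sum_(j' <- j :: s) f j' x) = (fun x => f j x + \sum_(j <- s) f j x).
    by apply/funext => x; rewrite big_cons.
  by rewrite E big_cons -IH2; split; [exact: integ01D|rewrite int01D].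
by have [_] := gen (index_enum J).
Qed.

Lemma integ01_lipM B f g : lip01 B g -> integ01 f -> integ01 (fun x => g x * f x).
Proof.
move=> gB fi.
have mg : measurable_fun (T := measurableTypeR R) I01 g by apply: integ01_measurable; exact: lip01_integ gB.
have bg : [bounded g x | x in I01].
  exists (`|g 0| + B); split; first exact: num_real.
  move=> y yB x /=; rewrite in_itv /= => x01.
  by apply: le_trans (lip01_bounded gB x01) _; exact: ltW.
by apply: eq_integrable (@integrableMr _ _ _ leb I01 _ g (EFin \o f) mg bg fi).
Qed.

Lemma ae_leb01 (P : R -> Prop) : (\forall x \ae leb01 R, P x) <->
  (\forall x \ae leb, I01 x -> P x).
Proof.
split=> [[A [mA A0 PA]]|[A [mA A0 PA]]].
  exists (A `&` I01); split => //; first exact: measurableI.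
  by move=> x /= /not_implyP[x01 nP]; split=> //; exact: PA.
exists (A `|` ~` I01); split.
- by apply: measurableU => //; exact: measurableC.
- rewrite /leb01 /= /mrestr setIUl setICl setU0.
  apply/eqP; rewrite -measure_le0 -A0; apply: le_measure; rewrite ?inE //; exact: measurableI.
move=> x nP; have [x01|] := pselect (I01 x); last by right.
by left; apply: PA => /= h; apply: nP; exact: h.
Qed.

Lemma int01_ae f g : measurable_fun (T := measurableTypeR R) I01 f -> measurable_fun (T := measurableTypeR R) I01 g ->
  f = g %[ae leb01 R] -> int01 f = int01 g.
Proof.
move=> mf mg fg; congr fine; apply: ae_eq_integral => //; [exact/measurable_EFinP..|].
by move/ae_leb01: fg; apply: filterS => x h x01 /=; rewrite h.
Qed.

Lemma leb01_setT : leb01 R setT = 1%E.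
Proof. by rewrite /leb01 /= /mrestr setTI lebesgue_measure_itv /= lte01 sube0. Qed.

Lemma integral_leb01 (F : R -> \bar R) :
  (\int[leb01 R]_(x in I01) F x = \int[leb]_(x in I01) F x)%E.
Proof.
by apply: eq_measure_integral => A mA A01; rewrite /leb01 /= /mrestr setIidl.
Qed.

Lemma Lfun2_integ01 f :
  (f : measurableTypeR R -> R) \in Lfun (leb01 R) 2%:E -> integ01 f.
Proof.
move=> /Lfun_subset12 h; have := h _; rewrite leb01_setT => /(_ isT)/Lfun1_integrable.
move=> hi; have /integrableP[mf fi] : (leb01 R).-integrable I01 (EFin \o f).
  by apply: integrableS hi.
by apply/integrableP; split => //; rewrite -integral_leb01.
Qed.

Lemma Lnorm_lip01 B g : lip01 B g ->
  ('N[leb01 R]_2%:E[EFin \o (g \_ I01)] = (Num.sqrt (int01 (fun x => g x * g x)))%:E)%E.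
Proof.
move=> gB; rewrite unlock /Lnorm.
have -> : (\int[leb01 R]_x `|(EFin \o g \_ I01) x| `^ 2 = (int01 (fun x => g x * g x))%:E)%E.
  transitivity (\int[leb01 R]_(x in I01) (g x * g x)%:E)%E.
    rewrite [RHS]integral_mkcond; apply: eq_integral => x _ /=.
    rewrite !patchE; case: ifP => _ /=; last by rewrite normr0 powR0.
    by rewrite powR_mulrn // real_normK ?num_real // expr2.
  rewrite integral_leb01 /int01 /Rintegral fineK //.
  by apply: integrable_fin_num => //; exact: lip01_integ (lip01M gB gB).
by rewrite /= powR12_sqrt // Rintegral_ge0 // => x _; rewrite -expr2 sqr_ge0.
Qed.

Lemma lip01_Lfun2 B g : lip01 B g ->
  ((g \_ I01) : measurableTypeR R -> R) \in Lfun (leb01 R) 2%:E.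
Proof.
move=> gB; rewrite inE; apply/andP; split; rewrite inE /=.
  apply/(measurable_restrictT _ _).1 => //.
  by apply: integ01_measurable; exact: lip01_integ gB.
by rewrite /finite_norm (Lnorm_lip01 gB) ltry.
Qed.

Lemma lip01_L2_mean0 B g : lip01 B g -> int01 g = 0 -> @L2_mean0 R (g \_ I01).
Proof.
move=> gB g0; split; first exact: lip01_Lfun2 gB.
by rewrite -[RHS]g0; apply: eq_int01 => x x01; rewrite patchE mem_set // /= in_itv.
Qed.

End UnitInterval.

(** * Multiplicities of eigenvalues *)

Section AlmostEverywhereDimension.
Context d (X : measurableType d) (R : realType).
Variable mu : {measure set X -> \bar R}.

Local Instance mu_ae_filter : Filter (nbhs (almost_everywhere mu)).
Proof. exact: ae_filter_ringOfSetsType. Qed.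

(** Expressing each basis through the other gives matrices with [A *m A' = 1%:M], because [b] is
    free almost everywhere. *)
Lemma has_ae_dim_le (E : set (X -> R)) k k' :
  has_ae_dim mu E k -> has_ae_dim mu E k' -> (k <= k')%N.
Proof.
move=> [b [Eb bfree bspan]] [b' [Eb' _ bspan']].
have [C hC] := choice (fun i => bspan' _ (Eb i)).
have [C' hC'] := choice (fun j => bspan _ (Eb' j)).
pose A : 'M[R]_(k, k') := \matrix_(i, j) C i j.
pose A' : 'M[R]_(k', k) := \matrix_(j, i) C' j i.
suff h : A *m A' = 1%:M by exact: mulmx1_min h.
apply/matrixP => i l; apply/eqP; rewrite -subr_eq0; apply/eqP; move: l.
apply: (bfree (fun l => (A *m A') i l - (1%:M : 'M[R]_k) i l)).
have hC2 := filter_forall mu_ae_filter hC'.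
apply: filterS2 (hC i) hC2 => x /(_ I) h1 h2 _ /=.
have {}h2 j := h2 j I.
rewrite (eq_bigr (fun l => (A *m A') i l * b l x - (1%:M : 'M[R]_k) i l * b l x)) => [|l _]; last by rewrite mulrBl.
rewrite sumrB [X in _ - X](bigD1 i) //= mxE eqxx mul1r [X in _ - (_ + X)]big1 ?addr0; last first.
  by move=> l li; rewrite mxE eq_sym (negbTE li) mul0r.
rewrite h1; apply/eqP; rewrite subr_eq0; apply/eqP.
under eq_bigr => l _ do rewrite mxE mulr_suml.
rewrite exchange_big /=; apply: eq_bigr => j _; rewrite h2 mulr_sumr.
by apply: eq_bigr => l _; rewrite !mxE mulrA.
Qed.

Lemma has_ae_dim_uniq (E : set (X -> R)) k k' :
  has_ae_dim mu E k -> has_ae_dim mu E k' -> k = k'.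
Proof. by move=> h h'; apply/eqP; rewrite eqn_leq !(@has_ae_dim_le E). Qed.

End AlmostEverywhereDimension.

Section Counting.
Variables (T : eqType) (s : nat -> T) (m : T) (k : nat).
Hypothesis sk : ([set i | s i = m] #= `I_k)%card.

Lemma count_card_le n : (count_mem m [seq s i | i <- iota 0 n] <= k)%N.
Proof.
have /card_set_bijP[f [fA fI _]] := sk.
rewrite count_map -size_filter.
rewrite -(size_map f) -[leqRHS](size_iota 0); apply: uniq_leq_size.
  rewrite map_inj_in_uniq ?filter_uniq ?iota_uniq // => i j.
  rewrite !mem_filter /= => /andP[/eqP si _] /andP[/eqP sj _]; apply: fI; rewrite inE //.
move=> j /mapP[l]; rewrite mem_filter /= => /andP[/eqP sl _] ->.
by rewrite mem_iota /=; exact: (fA l sl).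
Qed.

Lemma count_card_ge : exists N, forall n, (N <= n)%N ->
  (k <= count_mem m [seq s i | i <- iota 0 n])%N.
Proof.
have sk' : (`I_k #= [set i | s i = m])%card by rewrite card_eq_sym.
have /card_set_bijP[f [fA fI _]] := sk'.
exists (\max_(j < k) f j).+1 => n nN; rewrite count_map -size_filter.
rewrite -[leqLHS](size_iota 0) -(size_map f); apply: uniq_leq_size.
  rewrite map_inj_in_uniq ?iota_uniq // => i j.
  by rewrite !mem_iota /= => ik jk; apply: fI; rewrite inE.
move=> i /mapP[j]; rewrite mem_iota /= => jk ->; rewrite mem_filter mem_iota /=.
apply/andP; split; first by apply/eqP; exact: (fA j jk).
apply: leq_trans nN; rewrite ltnS; exact: (leq_bigmax (Ordinal jk)).
Qed.

End Counting.

(** Dropping factors from [0, 1] can only increase a product, and entries 0 give factors 1, so only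
    the multiplicities of nonzero entries have to be compared. *)
Lemma prod_seq_count_le (R : numDomainType) (F : R -> R) (s s' : seq R) :
  (forall x, x \in s -> 0 <= F x <= 1) -> F 0 = 1 ->
  (forall m, m != 0 -> (count_mem m s' <= count_mem m s)%N) ->
  \prod_(x <- s) F x <= \prod_(x <- s') F x.
Proof.
move=> F01 F0; elim: s' s F01 => [|a s' IH] s F01 h.
  rewrite big_nil; elim: s F01 {h} => [|x s IH] F01; first by rewrite big_nil.
  have /andP[h0 h1] := F01 x (mem_head _ _).
  rewrite big_cons mulr_ile1 //; last by apply: IH => y ys; apply: F01; rewrite inE ys orbT.
  rewrite big_seq; apply: prodr_ge0 => y ys.
  have ys' : y \in x :: s by rewrite inE ys orbT.
  by have /andP[] := F01 y ys'.
rewrite big_cons; have [->|a0] := eqVneq a 0.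
  rewrite F0 mul1r; apply: IH => // m m0; apply: leq_trans (h m m0).
  by rewrite /= leq_addl.
have as' : a \in s.
  by rewrite -has_pred1 has_count; apply: leq_trans (h a a0); rewrite /= eqxx.
have ps := perm_to_rem as'; rewrite (perm_big _ ps) big_cons.
have /andP[h0 h1] := F01 a as'; apply: ler_wpM2l => //.
apply: IH => [x xs|m m0]; first by apply: F01; exact: mem_rem xs.
have := h m m0; rewrite (seq.permP ps (pred1 m)) /= leq_add2l; by [].
Qed.

Section EigenvalueProducts.
Variable R : realType.
Implicit Types s : nat -> R.

Let P s n : R := \prod_(i < n) (1 - s i ^+ 2).

Let P_seq s n : P s n = \prod_(x <- [seq s i | i <- iota 0 n]) (1 - x ^+ 2).
Proof. by rewrite big_map (_ : iota 0 n = index_iota 0 n) ?big_mkord // /index_iota subn0. Qed.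

Definition same_multiplicities s s' := forall m, m != 0 -> exists k,
  ([set i | s i = m] #= `I_k)%card /\ ([set i | s' i = m] #= `I_k)%card.

Lemma same_multiplicities_sym s s' : same_multiplicities s s' -> same_multiplicities s' s.
Proof. by move=> h m /h[k [h1 h2]]; exists k. Qed.

Let sqr01 (x : R) : `|x| <= 1 -> 0 <= 1 - x ^+ 2 <= 1.
Proof.
move=> x1; rewrite subr_ge0 gerBl sqr_ge0 andbT.
by rewrite -real_normK ?num_real // expr_le1.
Qed.

Let P_le s s' : (forall i, `|s i| <= 1) -> same_multiplicities s s' ->
  forall n, exists N, P s N <= P s' n.
Proof.
move=> s1 ss' n.
have hN m : exists N, m != 0 -> (count_mem m [seq s' i | i <- iota 0 n] <=
    count_mem m [seq s i | i <- iota 0 N])%N /\ forall N', (N <= N')%N ->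
    (count_mem m [seq s' i | i <- iota 0 n] <= count_mem m [seq s i | i <- iota 0 N'])%N.
  have [->|m0] := eqVneq m 0; first by exists 0%N.
  have [k [h1 h2]] := ss' m m0; have [N hN] := count_card_ge h1.
  exists N => _; split => [|N' NN']; apply: leq_trans (count_card_le h2 n) _; exact: hN.
have [Nf hf] := choice hN; pose N := \max_(i < n) Nf (s' i).
exists N; rewrite !P_seq; apply: prod_seq_count_le.
- by move=> x /mapP[i _ ->]; exact: sqr01.
- by rewrite expr0n subr0.
move=> m m0; have [|/count_memPn -> //] := boolP (m \in [seq s' i | i <- iota 0 n]).
move=> /mapP; case=> i; rewrite mem_iota /= => ni mE; have [_] := hf m m0; apply.
by rewrite mE; exact: (leq_bigmax (Ordinal ni)).
Qed.

Let P_nincr s : (forall i, `|s i| <= 1) -> forall n n', (n <= n')%N -> P s n' <= P s n.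
Proof.
move=> s1 n n' nn'; rewrite /P -!(big_mkord predT (fun i => 1 - s i ^+ 2)).
rewrite (big_cat_nat (leq0n n) nn') /= ler_piMr //.
  by apply: prodr_ge0 => i _; have /andP[] := sqr01 (s1 i).
by apply: prodr_ile1 => i _; exact: sqr01.
Qed.

(** Both sequences of partial products decrease, and every term of one has a term of the other below
    it. Comparing them in this way avoids matching indices, which may fail since the two sequences
    can contain different numbers of zeros. *)
Lemma eigenvalue_prod_cvg s s' (D : R) :
  (forall i, `|s i| <= 1) -> (forall i, `|s' i| <= 1) -> same_multiplicities s s' ->
  \prod_(i < n) (1 - s i ^+ 2) @[n --> \oo] --> D ->
  \prod_(i < n) (1 - s' i ^+ 2) @[n --> \oo] --> D.
Proof.
move=> s1 s1' ss' hD.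
have DP n : D <= P s n.
  apply: (cvgr_to_le hD); exists n => // n' /= nn'; exact: P_nincr.
have DP' n : D <= P s' n.
  by have [N hN] := P_le s1 ss' n; apply: le_trans hN.
apply/cvgrPdist_le => e e0; move/cvgrPdist_le: hD => /(_ e e0)[n0 _ hn0].
have [N hN] := P_le s1' (same_multiplicities_sym ss') n0.
exists N => // n /= Nn; have h1 := P_nincr s1' Nn.
have := hn0 n0 (leqnn _); rewrite /= -/(P s n0) -/(P s' n) => h2.
rewrite distrC ger0_norm ?subr_ge0 //; move: h2; rewrite distrC ger0_norm ?subr_ge0 //.
lra.
Qed.

End EigenvalueProducts.

(** * Eigenfunctions of the kernel operator *)

Section KernelEigenfunctions.
Variables (R : realType) (rho : R * R -> R) (L C M : R).
Hypothesis rk : regular_kernel rho L C M.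
Local Notation S := (trace_const L C M).
Variables (v : forall n, nat -> 'I_n -> R) (ka : nat -> nat -> R).
Arguments v : clear implicits.
Hypothesis ef : eigen_family rho v ka.
Variable U : set_system nat.
Hypotheses (UU : UltraFilter U) (oU : \oo `<=` U).

Let PU : ProperFilter U. Proof. exact: ultra_proper. Qed.
#[local] Existing Instance PU.

Local Notation lam := (lam ka U).
Local Notation phi := (phi rho v ka U).
Local Notation leb := (@lebesgue_measure R).
Local Notation I01 := `[(0 : R), 1]%classic.
Local Notation A := (kernel_op rho).

#[local] Existing Instance leb_ae_filter.

Lemma kernel_mul_lip B (g : R -> R) : lip01 B g ->
  exists B1, forall x, 0 <= x <= 1 -> lip01 B1 (fun y => rho (x, y) * g y).
Proof.
move=> gB; have B0 := lip01_ge0 gB.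
exists (L * (`|g 0| + B) + (M + L) * B) => x x01 y z y01 z01.
apply: le_trans (lip01M (lip_fst rk x01) gB y01 z01) _.
rewrite ler_wpM2r // lerD2l ler_wpM2r // lerD2r.
by apply: (rk_bound rk) => //; rewrite lexx ler01.
Qed.

Lemma grid_kernel B (g : R -> R) : lip01 B g ->
  grid_unif U (fun n i => n%:R^-1 * \sum_(j < n) rho (grid R n i, grid R n j) * g (grid R n j))
    (fun x => int01 (fun y => rho (x, y) * g y)).
Proof.
move=> gB e e0; have [B1 hB1] := kernel_mul_lip gB.
have hO : B1 / n%:R @[n --> U] --> (0 : R).
  by rewrite -[X in _ --> X](mulr0 B1); apply: cvgM (ultra_invn oU); exact: cvg_cst.
move/cvgrPdist_le: hO => /(_ _ e0) hO.
near=> n => i.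
have : `|0 - B1 / n%:R| <= e by near: n.
rewrite sub0r normrN => /(le_trans (ler_norm _)); apply: le_trans.
apply: riemann_sum_lip (hB1 _ (grid01 R i)).
near: n; exact: ultra_gt.
Unshelve. all: end_near. Qed.

Definition kernel_eigen (m : R) (g : R -> R) : Prop :=
  forall x, 0 <= x <= 1 -> int01 (fun y => rho (x, y) * g y) = m * g x.

(** Symmetry of the operator is obtained from Riemann double sums, in which the two summations are
    finite and can be exchanged, instead of from Fubini's theorem. *)
Lemma kernel_eigen_orth B B' (m m' : R) (g h : R -> R) : lip01 B g -> lip01 B' h ->
  kernel_eigen m g -> kernel_eigen m' h -> m != m' -> int01 (fun x => g x * h x) = 0.
Proof.
have half B0 B0' (m0 : R) (f f' : R -> R) : lip01 B0 f -> lip01 B0' f' -> kernel_eigen m0 f ->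
    n%:R^-1 * (\sum_(i < n) n%:R^-1 * (\sum_(j < n) rho (grid R n i, grid R n j) *
      f (grid R n j)) * f' (grid R n i)) @[n --> U] --> m0 * int01 (fun x => f x * f' x).
  move=> fB fB' fm.
  have mf : lip01 (`|m0| * B0) (fun x => m0 * f x).
    by move=> x y x01 y01; rewrite -mulrBr normrM -mulrA ler_wpM2l //; exact: fB.
  have hk : grid_unif U (fun n i => n%:R^-1 * \sum_(j < n) rho (grid R n i, grid R n j) *
      f (grid R n j)) (fun x => m0 * f x).
    move=> e e0; have hf := grid_kernel fB e0; near=> n => i.
    by rewrite -(fm _ (grid01 R i)); move: i; near: n.
  have hc := grid_unif_cvg UU oU (lip01M mf fB')
    (grid_unifM UU mf fB' hk (@grid_unif_refl R U UU f')).
  rewrite -int01Z; last exact: lip01_integ (lip01M fB fB').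
  rewrite (@eq_int01 R _ (fun x => m0 * f x * f' x)) // => x _; exact: mulrA.
move=> gB hB gm hm mm'.
have h1 := half _ _ _ _ _ gB hB gm; have h2 := half _ _ _ _ _ hB gB hm.
rewrite (@eq_int01 R (fun x => h x * g x) (fun x => g x * h x)) in h2; last first.
  by move=> x _; exact: mulrC.
set I := int01 _ in h1 h2 *; have E : m * I = m' * I.
  apply: (cvgr_unique _ h1); apply: cvg_near_eq h2; near=> n; congr (_ * _).
  under eq_bigr => i _ do rewrite -mulrA mulr_suml.
  under [RHS]eq_bigr => i _ do rewrite -mulrA mulr_suml.
  rewrite -!mulr_sumr exchange_big /=; congr (_ * _).
  apply: eq_bigr => i _; apply: eq_bigr => j _.
  by rewrite (rk_sym rk) ?grid01 //; ring.
by apply/eqP; move: mm'; rewrite -subr_eq0 => mm'; rewrite -(mulrI_eq0 _ (lregP mm')) mulrBl E subrr.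
Unshelve. all: end_near. Qed.

Lemma kernel_opE f x : 0 <= x <= 1 -> A f x = int01 (fun y => rho (x, y) * f y).
Proof. by move=> x01; rewrite /kernel_op patchE mem_set // /= in_itv. Qed.

Lemma restrictE (g : R -> R) x : 0 <= x <= 1 -> (g \_ I01) x = g x.
Proof. by move=> x01; rewrite patchE mem_set // /= in_itv. Qed.

Lemma ae_leb01_on (P : R -> Prop) : (forall x, 0 <= x <= 1 -> P x) ->
  \forall x \ae leb01 R, P x.
Proof. by move=> hP; apply/ae_leb01/aeW => x; rewrite /= in_itv /=; exact: hP. Qed.

Lemma lip01_eigenspace B (m : R) (g : R -> R) : lip01 B g -> int01 g = 0 ->
  kernel_eigen m g -> eigenspace_on (leb01 R) A (@L2_mean0 R) m (g \_ I01).
Proof.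
move=> gB g0 gm; split; first exact: lip01_L2_mean0 gB g0.
apply: ae_leb01_on => x x01 _; rewrite kernel_opE //.
transitivity (m * g x); last by rewrite /= restrictE.
by rewrite -gm //; apply: eq_int01 => y y01; rewrite restrictE.
Qed.

(** An eigenfunction agrees almost everywhere with its image divided by [m], and the image inherits
    a Lipschitz bound from the kernel. *)
Lemma eigenspace_lip (m : R) f : m != 0 ->
  eigenspace_on (leb01 R) A (@L2_mean0 R) m f ->
  exists B g, [/\ lip01 B g, f = g %[ae leb01 R], int01 g = 0 & kernel_eigen m g].
Proof.
move=> m0 [[f2 f0] fm]; have fi := Lfun2_integ01 f2.
pose g x := m^-1 * int01 (fun y => rho (x, y) * f y).
have rfi x : 0 <= x <= 1 -> integ01 (fun y => rho (x, y) * f y).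
  by move=> x01; exact: integ01_lipM (lip_fst rk x01) fi.
have gB : lip01 (`|m|^-1 * (L * int01 (fun x => `|f x|))) g.
  move=> x y x01 y01; rewrite /g -mulrBr -int01B; try exact: rfi.
  rewrite normrM normfV -!mulrA ler_wpM2l ?invr_ge0 //.
  have fai : integ01 (fun y => `|f y|) by have := integrable_abse fi.
  apply: le_trans (le_normr_Rintegral _ _) _ => //; first by apply: integ01B; exact: rfi.
  have -> : L * (int01 (fun x => `|f x|) * `|x - y|) = int01 (fun t => L * `|x - y| * `|f t|).
    by rewrite int01Z //; ring.
  apply: le_Rintegral => //; [|exact: integ01Z|].
    by have := integrable_abse (integ01B (rfi x x01) (rfi y y01)).
  move=> t; rewrite /= in_itv /= => t01; rewrite -mulrBl normrM ler_wpM2r //.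
  exact: (rk_lip rk).
have fg : f = g %[ae leb01 R].
  apply/ae_leb01; move/ae_leb01: fm; apply: filterS => x h /[dup] x01.
  rewrite /= in_itv /= => x01' _; have := h x01 I; rewrite kernel_opE //= /g => ->.
  by rewrite mulKf.
have mf := integ01_measurable fi; have mg := integ01_measurable (lip01_integ gB).
exists (`|m|^-1 * (L * int01 (fun x => `|f x|))), g; split=> //.
  by rewrite -(int01_ae mf mg fg).
move=> x x01; rewrite /g mulVKf //; apply/esym/int01_ae.
- exact: integ01_measurable (rfi x x01).
- exact: integ01_measurable (lip01_integ (lip01M (lip_fst rk x01) gB)).
by move/ae_leb01: fg => fg; apply/ae_leb01; move: fg; apply: filterS => y h y01 _ /=; rewrite h.
Qed.

Lemma int01_sqr_eq0 B (h : R -> R) : lip01 B h -> int01 (fun x => h x * h x) = 0 ->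
  \forall x \ae leb01 R, h x = 0.
Proof.
move=> hB h0; have hi : integ01 (fun x => h x * h x) := lip01_integ (lip01M hB hB).
apply/ae_leb01.
have mh : measurable_fun (T := measurableTypeR R) I01 (EFin \o (fun x => h x * h x)).
  by have /integrableP[] := hi.
have [H _] := ae_eq_integral_abs leb (measurable_itv _) mh.
have H0 : (\int[leb]_(x in I01) `|(h x * h x)%:E| = 0)%E.
  transitivity (\int[leb]_(x in I01) (h x * h x)%:E)%E.
    by apply: eq_integral => x _; rewrite gee0_abs // lee_fin -expr2 sqr_ge0.
  transitivity ((int01 (fun x => h x * h x))%:E); last by rewrite h0.
  by rewrite /int01 /Rintegral fineK //; apply: integrable_fin_num.
apply: filterS (H H0) => x /= hx x01; have [] := hx x01.
by move/eqP; rewrite -expr2 sqrf_eq0 => /eqP.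
Qed.

Lemma phi_kernel_eigen a : lam a != 0 -> kernel_eigen (lam a) (phi a).
Proof. by move=> la x x01; exact: (phi_eigen rk ef UU oU). Qed.

Lemma lam_eventually_lt (m : R) : m != 0 -> exists N, forall i, (N <= i)%N -> `|lam i| < `|m|.
Proof.
move=> m0; have mp : 0 < `|m| by rewrite normr_gt0.
exists (Num.truncn (S / `|m|)) => i Ni.
have i0 : 0 < i.+1%:R :> R by rewrite ltr0n.
rewrite -(ltr_pM2r i0); apply: le_lt_trans (@lam_decay R rho L C M rk v ka ef U UU oU i) _.
rewrite mulrC -ltr_pdivrMr //; apply: lt_le_trans (truncnS_gt _) _.
by rewrite ler_nat ltnS.
Qed.

(** By decay, finitely many indices [a] have [lam a = m]; their limit eigenfunctions are
    orthonormal, hence free, and they span by [phi_complete]. *)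
Lemma lam_eigenvalue_seq : eigenvalue_seq (leb01 R) A (@L2_mean0 R) lam.
Proof.
move=> m m0; have [N hN] := lam_eventually_lt m0.
pose Im := [seq i <- iota 0 N | lam i == m]; pose k := size Im; exists k.
have Iu : uniq Im by rewrite filter_uniq ?iota_uniq.
have memI i : (i \in Im) = (lam i == m).
  rewrite mem_filter mem_iota /=; case: eqP => //= E; rewrite ltnNge; apply/negP => /hN.
  by rewrite E ltxx.
have lamI j : (j < k)%N -> lam (nth 0%N Im j) = m.
  by move=> jk; apply/eqP; rewrite -memI mem_nth.
have lam0 (j : 'I_k) : lam (nth 0%N Im j) != 0 by rewrite lamI.
pose b (j : 'I_k) := phi (nth 0%N Im j).
have bL (j : 'I_k) : lip01 (phi_lip_const L ka U (nth 0%N Im j)) (b j) := phi_lip rk ef UU oU (lam0 j).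
have b_orth (i j : 'I_k) : int01 (fun x => b i x * b j x) = (i == j)%:R.
  by rewrite /b (phi_orth rk ef UU oU) // nth_uniq.
split; last first.
  rewrite card_eq_sym; apply/card_set_bijP; exists (nth 0%N Im); split.
  - by move=> j jk; exact: lamI.
  - by move=> i j; rewrite !inE => ik jk /eqP; rewrite nth_uniq // => /eqP.
  - move=> i /= /eqP; rewrite -memI => iI; exists (index i Im); last by rewrite nth_index.
    by rewrite /= index_mem.
exists (fun j => b j \_ I01); split.
- move=> j; apply: lip01_eigenspace (bL j) _ _; first exact: (phi_mean0 rk ef UU oU).
  by rewrite -(lamI j (ltn_ord j)); exact: phi_kernel_eigen.
- move=> c cb i.
  have cL j : integ01 (fun x => c j * (b j x * b i x)).
    by apply: integ01Z; exact: lip01_integ (lip01M (bL j) (bL i)).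
  have : int01 (fun x => \sum_j c j * (b j x * b i x)) = int01 (fun=> 0).
    apply: int01_ae; first by apply: integ01_measurable; exact: integ01_sum.
      exact: measurable_cst.
    move/ae_leb01: cb => cb; apply/ae_leb01; move: cb; apply: filterS => x h x01 _.
    have := h x01 I; rewrite /= => E.
    under eq_bigr => j _ do rewrite mulrA.
    rewrite -mulr_suml -[RHS](mul0r (b i x)); congr (_ * _); rewrite -[RHS]E.
    apply: eq_bigr => j _; rewrite restrictE //; by move: x01; rewrite /= in_itv.
  rewrite int01_sum // (bigD1 i) //= big1 ?addr0; last first.
    move=> j ji; rewrite int01Z ?b_orth ?(negbTE ji) ?mulr0 //.
    exact: lip01_integ (lip01M (bL j) (bL i)).
  rewrite int01Z; last exact: lip01_integ (lip01M (bL i) (bL i)).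
  rewrite b_orth eqxx mulr1 => ->; rewrite (@eq_int01 R (fun=> 0) (fun x => 0 * 0)).
    rewrite int01Z ?mul0r //; apply: (@lip01_integ R 0) => x y _ _.
    by rewrite subrr normr0 mul0r.
  by move=> x _; rewrite mul0r.
move=> f /(eigenspace_lip m0)[B [g [gB fg g0 gm]]].
pose c j := int01 (fun x => g x * b j x); exists c.
(* The residual of the projection is again an eigenfunction of mean 0. It is orthogonal to the
   [phi a] with eigenvalue [m] by construction and to the others by [kernel_eigen_orth]. *)
pose h x := g x - \sum_j c j * b j x.
have sumL : lip01 (\sum_j `|c j| * phi_lip_const L ka U (nth 0%N Im j)) (fun x => \sum_(j < k) c j * b j x).
  move=> x y x01 y01; rewrite -sumrB mulr_suml; apply: le_trans (ler_norm_sum _ _ _) _.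
  apply: ler_sum => j _; rewrite -mulrBr normrM -mulrA ler_wpM2l //; exact: bL.
have [Bh hB] : exists Bh, lip01 Bh h.
  eexists => x y x01 y01.
  rewrite (_ : h x - h y = (g x - g y) - (\sum_j c j * b j x - \sum_j c j * b j y)); last first.
    by rewrite /h; ring.
  apply: le_trans (ler_normB _ _) _; apply: le_trans (lerD (gB _ _ x01 y01) (sumL _ _ x01 y01)) _.
  by rewrite -mulrDl.
have sb_int (w : R -> R) Bw : lip01 Bw w ->
    int01 (fun x => h x * w x) = int01 (fun x => g x * w x) - \sum_j c j * int01 (fun x => b j x * w x).
  move=> wB; have bw j : integ01 (fun x => b j x * w x) := lip01_integ (lip01M (bL j) wB).
  transitivity (int01 (fun x => g x * w x - \sum_j c j * (b j x * w x))).
    apply: eq_int01 => x _; rewrite /h mulrBl mulr_suml; congr (_ - _).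
    by apply: eq_bigr => j _; rewrite mulrA.
  rewrite int01B; [|exact: lip01_integ (lip01M gB wB)|by apply: integ01_sum => j; exact: integ01Z].
  rewrite int01_sum; last by move=> j; exact: integ01Z.
  by congr (_ - _); apply: eq_bigr => j _; rewrite int01Z.
have hm : kernel_eigen m h.
  move=> x x01; rewrite (@eq_int01 R _ (fun y => h y * rho (x, y))); last by move=> y _; rewrite mulrC.
  rewrite (sb_int _ _ (lip_fst rk x01)) /h mulrBr; congr (_ - _).
    by rewrite -gm //; apply: eq_int01 => y _; rewrite mulrC.
  rewrite mulr_sumr; apply: eq_bigr => j _.
  rewrite (@eq_int01 R _ (fun y => rho (x, y) * b j y)); last by move=> y _; rewrite mulrC.
  by rewrite (phi_kernel_eigen (lam0 j)) // lamI // mulrCA.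
have one_lip : lip01 0 (fun=> 1 : R) by move=> x y _ _; rewrite subrr normr0 mul0r.
have h0 : int01 h = 0.
  rewrite (@eq_int01 R _ (fun y => h y * 1)); last by move=> y _; rewrite mulr1.
  rewrite (sb_int _ _ one_lip) (@eq_int01 R _ g); last by move=> y _; rewrite mulr1.
  rewrite g0 big1 ?subr0 // => j _; rewrite (@eq_int01 R _ (b j)); last by move=> y _; rewrite mulr1.
  by rewrite (phi_mean0 rk ef UU oU) ?mulr0.
have hphi a : lam a != 0 -> int01 (fun x => h x * phi a x) = 0.
  move=> la; have [E|ne] := eqVneq m (lam a); last first.
    exact: kernel_eigen_orth hB (phi_lip rk ef UU oU la) hm (phi_kernel_eigen la) ne.
  have aI : a \in Im by rewrite memI E.
  have ak : (index a Im < k)%N by rewrite index_mem.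
  have -> : phi a = b (Ordinal ak) by rewrite /b /= nth_index.
  rewrite (sb_int _ _ (bL _)) (bigD1 (Ordinal ak)) //= b_orth eqxx mulr1 big1 ?addr0 ?subrr //.
  by move=> j ji; rewrite b_orth (negbTE ji) mulr0.
have hz := int01_sqr_eq0 hB (phi_complete rk ef UU oU hB m0 hm h0 hphi).
move/ae_leb01: fg => fg; move/ae_leb01: hz => hz; apply/ae_leb01.
apply: filterS2 fg hz => x h1 h2 x01 _; rewrite (h1 x01 I).
have := h2 x01; rewrite /h => /eqP; rewrite subr_eq0 => /eqP ->.
by apply: eq_bigr => j _; rewrite restrictE //; move: x01; rewrite /= in_itv.
Qed.

(** Unless [lam 0] vanishes, [phi 0] is a unit vector of mean 0 whose image has norm [|lam 0|], so
    the operator norm is at least that. *)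
Lemma lam0_lt1 : (opnorm2_on (leb01 R) A (@L2_mean0 R) < 1)%E -> `|lam 0| < 1.
Proof.
have [->|l0] := eqVneq (lam 0) 0; first by rewrite normr0.
have pL := phi_lip rk ef UU oU l0; move=> gap.
rewrite -lte_fin; apply: le_lt_trans gap; apply: ereal_sup_ubound.
exists (phi 0 \_ I01).
  split; first by apply: lip01_L2_mean0 pL _; exact: (phi_mean0 rk ef UU oU).
  by rewrite (Lnorm_lip01 pL) (phi_orth rk ef UU oU) // eqxx sqrtr1.
have lL : lip01 (`|lam 0| * phi_lip_const L ka U 0) (fun x => lam 0 * phi 0 x).
  by move=> x y x01 y01; rewrite -mulrBr normrM -mulrA ler_wpM2l //; exact: pL.
have -> : A (phi 0 \_ I01) = (fun x => lam 0 * phi 0 x) \_ I01.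
  apply/funext => x; rewrite /kernel_op !patchE; case: ifPn => // /set_mem /=.
  rewrite in_itv /= => x01; rewrite -(phi_kernel_eigen l0) //.
  by apply: eq_int01 => y y01; rewrite restrictE.
rewrite (Lnorm_lip01 lL); congr EFin.
rewrite (@eq_int01 R _ (fun x => lam 0 ^+ 2 * (phi 0 x * phi 0 x))); last by move=> x _; ring.
rewrite int01Z; last exact: lip01_integ (lip01M pL pL).
by rewrite (phi_orth rk ef UU oU) // eqxx mulr1 sqrtr_sqr.
Qed.

End KernelEigenfunctions.

(** * The determinant as a product over the limit eigenvalues *)

Section FredholmDeterminant.
Variables (R : realType) (rho : R * R -> R) (L C M : R).
Hypothesis rk : regular_kernel rho L C M.
Local Notation S := (trace_const L C M).
Variables (v : forall n, nat -> 'I_n -> R) (ka : nat -> nat -> R).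
Arguments v : clear implicits.
Hypothesis ef : eigen_family rho v ka.
Variable U : set_system nat.
Hypotheses (UU : UltraFilter U) (oU : \oo `<=` U).

Let PU : ProperFilter U. Proof. exact: ultra_proper. Qed.
#[local] Existing Instance PU.

Local Notation lam := (lam ka U).
Hypothesis lam0_lt1 : `|lam 0| < 1.

Let lam1 a : `|lam a| < 1 := lam_lt1 rk ef UU oU lam0_lt1 a.

Lemma sum_lam_le d : \sum_(a < d) `|lam a| <= S.
Proof.
have h : \sum_(a < d) `|ka n a| @[n --> U] --> \sum_(a < d) `|lam a|.
  by apply: cvg_sumr => a; apply: cvg_norm; exact: (lam_cvg rk ef UU oU).
apply: (cvgr_to_le h); near=> n.
have gn : good rho L C n by near: n; apply: oU; exact: near_good rk.
have dn : (d <= n)%N by near: n; apply: filterS (ultra_gt oU d) => ? /ltnW.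
apply: le_trans (sum_ka_le rk ef gn).
rewrite -!(big_mkord predT (fun a => `|ka n a|)) [leRHS](big_cat_nat (leq0n d) dn) /=.
by rewrite lerDl sumr_ge0.
Unshelve. all: end_near. Qed.

(* [1 - x = 1 / (1 + y) >= exp (- y)] with [y = x / (1 - x)]. *)
Let factor_ge a : expR (- (`|lam a| / (1 - `|lam 0|))) <= 1 - lam a ^+ 2.
Proof.
have d0 : 0 < 1 - `|lam 0| by rewrite subr_gt0.
have l1 := lam1 a; have l0 : `|lam a| <= `|lam 0| := lam_sorted rk ef UU oU (leq0n a).
have x0 : 0 <= lam a ^+ 2 by exact: sqr_ge0.
have xl : lam a ^+ 2 <= `|lam a|.
  by rewrite -real_normK ?num_real // expr2 ler_piMl // ltW.
have x1 : 0 < 1 - lam a ^+ 2 by rewrite subr_gt0 (le_lt_trans xl).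
apply: le_trans (_ : expR (- (lam a ^+ 2 / (1 - lam a ^+ 2))) <= _).
  rewrite ler_expR lerN2; apply: ler_pM => //; first by rewrite invr_ge0 ltW.
  by rewrite lef_pV2 ?posrE // lerD2l lerN2 (le_trans xl).
rewrite expRN -[leRHS]invrK lef_pV2 ?posrE ?expR_gt0 ?invr_gt0 //.
apply: le_trans (expR_ge1Dx _).
by rewrite le_eqVlt; apply/orP; left; apply/eqP; field; rewrite gt_eqF.
Qed.

(** The partial products decrease and stay above a positive constant, because the [|lam a|] are
    summable and bounded away from 1. Positivity of [D] is needed for the power -1/2. *)
Lemma lam_prod_cvg : exists2 D : R, 0 < D & \prod_(a < d) (1 - lam a ^+ 2) @[d --> \oo] --> D.
Proof.
pose P d := \prod_(a < d) (1 - lam a ^+ 2).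
pose m := expR (- (S / (1 - `|lam 0|))).
have d0 : 0 < 1 - `|lam 0| by rewrite subr_gt0.
have mP d : m <= P d.
  apply: le_trans (_ : expR (- (\sum_(a < d) `|lam a| / (1 - `|lam 0|))) <= _).
    by rewrite ler_expR lerN2 -mulr_suml ler_wpM2r ?invr_ge0 ?(ltW d0) // sum_lam_le.
  rewrite -sumrN expR_sum; apply: ler_prod => a _; rewrite expR_ge0; exact: factor_ge.
have P_nincr : {homo P : n n' / (n <= n')%N >-> n' <= n}.
  apply/nonincreasing_seqP => n; rewrite /P big_ord_recr /= ler_piMr //.
    by apply: prodr_ge0 => a _; apply: le_trans (factor_ge a); exact: expR_ge0.
  by rewrite gerBl sqr_ge0.
have Pc : cvgn P.
  apply: nonincreasing_is_cvgn => //; exists m => _ [n _ <-]; exact: mP.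
exists (lim (P n @[n --> \oo])) => //.
apply: lt_le_trans (_ : m <= _); first exact: expR_gt0.
by apply: limr_ge => //; near=> n; exact: mP.
Unshelve. all: end_near. Qed.

(** The enumeration [s] picked by [xget] is unknown, but uniqueness of dimension gives it the same
    multiplicities as [lam]. *)
Lemma fredholm_det_lam (D : R) : \prod_(a < d) (1 - lam a ^+ 2) @[d --> \oo] --> D ->
  fredholm_det_1_sub_sqr (leb01 R) (kernel_op rho) (@L2_mean0 R) = D.
Proof.
move=> hD; rewrite /fredholm_det_1_sub_sqr.
set s := xget _ _; apply: cvg_lim => //.
have lamE := lam_eigenvalue_seq rk ef UU oU.
have sE : eigenvalue_seq (leb01 R) (kernel_op rho) (@L2_mean0 R) s.
  by apply: (xgetPex (cst 0)); exists lam.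
have same : same_multiplicities lam s.
  move=> m m0; have [k [h1 h2]] := lamE m m0; have [k' [h1' h2']] := sE m m0.
  by exists k; split => //; rewrite (has_ae_dim_uniq h1 h1').
apply: (eigenvalue_prod_cvg _ _ same hD) => [i|i]; first exact: ltW.
(* A nonzero value of [s] has positive multiplicity and therefore occurs in [lam], which bounds
   it. *)
have [->|si0] := eqVneq (s i) 0; first by rewrite normr0.
have [k [h1 h2]] := same _ si0; have [N hN] := count_card_ge h1.
have /mapP[j _ ->] : s i \in [seq lam j | j <- iota 0 N]; last exact: ltW.
rewrite -has_pred1 has_count; apply: leq_trans (hN N (leqnn N)).
apply: leq_trans (count_card_le h2 i.+1); rewrite -has_count has_pred1.
by apply: map_f; rewrite mem_iota /=.
Qed.

End FredholmDeterminant.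

Theorem theorem1p3 (R : realType) (rho : R * R -> R)
    (rho_ge0 : forall p, @unit_square R p -> 0 <= rho p)
    (rho_C2 : Ck_unit_square 2 rho)
    (rho_sym : forall x y, @unit_square R (x, y) -> rho (x, y) = rho (y, x))
    (rho_int2 : forall x, x \in `[0, 1] ->
       \int[@lebesgue_measure R]_(y in `[0, 1]) rho (x, y) = 1)
    (rho_int1 : forall y, y \in `[0, 1] ->
       \int[@lebesgue_measure R]_(x in `[0, 1]) rho (x, y) = 1)
    (gap : (opnorm2_on (leb01 R) (kernel_op rho) (@L2_mean0 R) < 1)%E) :
  perm_average rho n @[n --> \oo] -->
    (fredholm_det_1_sub_sqr (leb01 R) (kernel_op rho) (@L2_mean0 R))
      `^ (- 2^-1).
Proof.
have [L [C [M rk]]] := C2_regular_kernel rho_C2 rho_sym rho_int1.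
have [v [ka ef]] := eigen_family_exists rk.
apply: cvg_ultra_all => U UU oU.
have l1 := lam0_lt1 rk ef UU oU gap.
have [D D0 hD] := lam_prod_cvg rk ef UU oU l1.
rewrite (fredholm_det_lam rk ef UU oU l1 hD).
exact: (perm_average_ultra rk ef UU oU l1 D0 hD).
Qed.
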